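(* Let $\alpha\in(0,2)$, $d\ge1$, let $(W,\mathcal W)$ be a standard Borel space with a $\sigma$-finite measure $\nu$, $\zeta$ counting measure on $\mathbb Z^d$, $f\in L^\alpha(W\times\mathbb Z^d,\nu\otimes\zeta)$, and let $$X_t=\sum_{i=1}^\infty j_if(v_i,u_i-t),\quad t\in\mathbb Z^d,$$ where $\sum_i\delta_{(j_i,v_i,u_i)}$ is a Poisson random measure on $([-\infty,\infty]\setminus\{0\})\times W\times\mathbb Z^d$ with mean measure $\nu_\alpha\otimes\nu\otimes\zeta$. Let $\gamma_n>0$ satisfy $n^{d/\alpha}/\gamma_n\to0$. Let $X_{1:n}\ge X_{2:n}\ge\dots\ge X_{(2n+1)^d:n}$ be the order statistics, in descending order, of $\{X_t\}_{t\in[-n\mathbf 1_d,n\mathbf 1_d]}$. For $v\in W$ let $f_i^+(v)$ (resp. $f_i^-(v)$) be the $i$-th order statistic in descending order of $\{f^+(v,u)\}_{u\in\mathbb Z^d}$ (resp. $\{f^-(v,u)\}_{u\in\mathbb Z^d}$). Then for all $m\ge1$ and $y_1,\dots,y_m>0$, $$\lim_{n\to\infty}\frac{\gamma_n^\alpha}{n^d}\mathbb P(X_{1:n}>\gamma_ny_1,\dots,X_{m:n}>\gamma_ny_m)=2^d\int_W\Big(\min_{1\le i\le m}(f_i^+(v)y_i^{-1})^\alpha+\min_{1\le i\le m}(f_i^-(v)y_i^{-1})^\alpha\Big)\nu(dv).$$ In particular, for all $a>0$ and $\lambda>0$, with $\tau^a_n:=\inf\{\|t\|_\infty:\ X_t>a\gamma_n\}$,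 $$\lim_{n\to\infty}\frac{\gamma_n^\alpha}{n^d}\mathbb P(\tau^a_n\le\lambda n)=(2\lambda)^da^{-\alpha}\int_W\Big(\big(\sup_{u\in\mathbb Z^d}f^+(v,u)\big)^\alpha+\big(\sup_{u\in\mathbb Z^d}f^-(v,u)\big)^\alpha\Big)\nu(dv).$$
   Context: $x^+=\max(x,0)$, $x^-=\max(-x,0)$; $\mathbf 1_d=(1,\dots,1)$; $[u,v]=\{t\in\mathbb Z^d:u\le t\le v\}$ coordinatewise; $\|\cdot\|_\infty$ is the max norm. $\nu_\alpha$ is the symmetric measure on $[-\infty,\infty]\setminus\{0\}$ with $\nu_\alpha(x,\infty]=\nu_\alpha[-\infty,-x)=x^{-\alpha}$, $x>0$. Series convention: for $g\in L^\alpha(W\times\mathbb Z^d,\nu\otimes\zeta)$, $\sum_i j_i g(v_i,u_i)$ denotes the limit in probability as $\delta\downarrow0$ of the finite sums over those $i$ with $|j_ig(v_i,u_i)|>\delta$; it is a symmetric $\alpha$-stable random variable and is a.s. linear in $g$. Order statistics are counted with multiplicity (for $\nu$-almost every $v$ the family $\{|f(v,u)|\}_u$ tends to $0$ at infinity, so they are well defined). *)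

(* Defs.v *)
From HB Require Import structures.
From mathcomp Require Import all_boot all_order all_algebra finmap.
From mathcomp Require Import all_classical all_reals all_analysis.
From mathcomp Require Import measurable_realfun.
Set Implicit Arguments.
Unset Strict Implicit.
Unset Printing Implicit Defensive.
Import Order.TTheory GRing.Theory Num.Theory.
Import numFieldNormedType.Exports.
Local Open Scope classical_set_scope.
Local Open Scope ring_scope.

Definition Zd (d : nat) : Type := 'rV[int]_d.
HB.instance Definition _ d := GRing.Zmodule.on (Zd d).
HB.instance Definition _ d := Countable.on (Zd d).
HB.instance Definition _ d := isPointed.Build (Zd d) 0.
HB.instance Definition _ d := @isMeasurable.Build default_measure_display
  (Zd d) discrete_measurable discrete_measurable0
  discrete_measurableC discrete_measurableU.

(* A constant of its own, because the library already attaches to [counting]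
   the sigma-finite structure of the counting measure on nat. *)
Definition zeta (R : realType) (d : nat) : set (Zd d) -> \bar R := counting.
Arguments zeta R d : clear implicits.

HB.instance Definition _ (R : realType) (d : nat) :=
  Measure.copy (zeta R d) (counting : set (Zd d) -> \bar R).

Lemma sigma_finite_zeta (R : realType) (d : nat) :
  sigma_finite [set: Zd d] (zeta R d).
Proof.
exists (fun n => [set t : Zd d | choice.pickle t = n]).
  by apply/seteqP; split=> // t _; exists (choice.pickle t).
move=> n; split=> //.
rewrite /zeta /counting asboolT ?ltry//.
apply: (@sub_finite_set _ _ (if choice.unpickle n is Some t then [set t]
  else set0 : set (Zd d))); last by case: (choice.unpickle n).
by move=> t /= <-; rewrite choice.pickleK.
Qed.

HB.instance Definition _ (R : realType) (d : nat) :=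
  @Measure_isSigmaFinite.Build _ _ _ (zeta R d) (sigma_finite_zeta R d).

Definition ones (d : nat) : Zd d := const_mx 1.
Arguments ones d : clear implicits.

Definition box (d : nat) (u v : Zd d) : set (Zd d) :=
  [set t | forall k : 'I_d, u ord0 k <= t ord0 k <= v ord0 k].

Lemma finite_box (d : nat) (u v : Zd d) : finite_set (box u v).
Proof.
pose N (k : 'I_d) := `|v ord0 k - u ord0 k|%N.
pose M := (\max_k N k)%N.
pose h (s : {ffun 'I_d -> 'I_M.+1}) : Zd d :=
  \row_k (u ord0 k + (s k : nat)%:Z).
apply: (@sub_finite_set _ _ (h @` setT)); last first.
  by apply: finite_image; exact: finite_finset.
move=> t /= tb; exists [ffun k => inord `|t ord0 k - u ord0 k|%N] => //.
have tu k : 0 <= t ord0 k - u ord0 k by rewrite subr_ge0; case/andP: (tb k).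
apply/matrixP => i k; rewrite !mxE ffunE inordK.
  by rewrite (ord1 i) gez0_abs// subrKC.
rewrite ltnS (leq_trans _ (leq_bigmax k))// /N -lez_nat.
have tv : t ord0 k - u ord0 k <= v ord0 k - u ord0 k.
  by rewrite lerD2r; case/andP: (tb k).
by rewrite !gez0_abs// (le_trans (tu k)).
Qed.

(* A measurable space isomorphic to a Polish space with its Borel sets. *)
Definition standard_borel (R : realType) (dW : measure_display)
    (W : measurableType dW) : Prop :=
  exists (S : completePseudoMetricType R) (h : W -> S),
    [/\ hausdorff_space S, @second_countable S, bijective h &
        measurable = preimage_set_system [set: W] h <<s open >>].

(* The punctured line [-oo, +oo] \ {0} is represented by \bar R with {0} a null
   set, so that a measure on the former is one on the latter. *)
Definition is_nu_alpha (R : realType) (alpha : R)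
    (m : {measure set (\bar R) -> \bar R}) : Prop :=
  m [set 0%E] = 0%E /\
  forall x : R, 0 < x ->
    m `]x%:E, +oo%E]%classic = (x `^ (- alpha))%:E /\
    m `[-oo%E, (- x)%:E[%classic = (x `^ (- alpha))%:E.

Definition mutually_independent (R : realType) (dO : measure_display)
    (Omega : measurableType dO) (P : probability Omega R) (n : nat)
    (Y : 'I_n -> Omega -> \bar R) : Prop :=
  forall B : 'I_n -> set (\bar R), (forall k, measurable (B k)) ->
    P (\bigcap_k (Y k @^-1` B k)) = (\prod_(k < n) P (Y k @^-1` B k))%E.

Section PoissonRandomMeasure.
Context (R : realType) (dO : measure_display) (Omega : measurableType dO)
  (P : probability Omega R) (dE : measure_display) (E : measurableType dE).
Implicit Types (p : nat -> Omega -> E).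

Definition point_measure p (A : set E) (w : Omega) : \bar R :=
  (\sum_(0 <= i <oo) \d_(p i w) A)%E.

(* The library's [poisson_pmf] is not used because it is constantly 1 at
   rate 0. *)
Definition poisson_random_measure (M : set E -> \bar R) p : Prop :=
  [/\ forall i, measurable_fun [set: Omega] (p i),
      forall (A : set E) (k : nat), measurable A ->
        P [set w | point_measure p A w = k%:R%:E] =
          if (M A < +oo)%E
          then (fine (M A) ^+ k / k`!%:R * expR (- fine (M A)))%:E
          else 0%E &
      forall (n : nat) (A : 'I_n -> set E), (forall k, measurable (A k)) ->
        trivIset [set: 'I_n] A ->
        mutually_independent P (fun k => point_measure p (A k))].

End PoissonRandomMeasure.

Section StableSeries.
Context (R : realType) (dO : measure_display) (Omega : measurableType dO)
  (P : probability Omega R) (T : Type).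
Implicit Types (j : nat -> Omega -> \bar R) (z : nat -> Omega -> T) (g : T -> R).

(* The sum runs over almost surely finitely many indices, with [j] almost surely
   finite; on the exceptional null set it takes the library's default values. *)
Definition truncated_series j z g (delta : R) (w : Omega) : R :=
  \sum_(i \in [set i | (delta%:E < `|j i w * (g (z i w))%:E|)%E])
    fine (j i w * (g (z i w))%:E)%E.

Definition is_stable_series j z g (Y : Omega -> R) : Prop :=
  forall e : R, 0 < e ->
    P [set w | e < `|truncated_series j z g delta w - Y w|]
      @[delta --> 0^'+] --> 0%E.

End StableSeries.

Section OrderStatistics.
Context (R : realType).

(* [i] is counted from 1. *)
Definition box_order_stat (d : nat) (x : Zd d -> R) (n i : nat) : R :=
  nth 0 (sort >=%R
    [seq x t | t <- fset_set (box (- (ones d *+ n)) (ones d *+ n))]) i.-1.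

(* The [i]-th largest value, counted from 1 and with multiplicity, of a
   possibly infinite family: the largest level attained or exceeded at [i]
   distinct indices. *)
Definition order_stat (T : eqType) (g : T -> R) (i : nat) : \bar R :=
  ereal_sup [set y%:E | y in [set y : R |
    exists s : seq T, [/\ uniq s, size s = i & forall u, u \in s -> y <= g u]]].

Definition hitting_radius (d : nat) (x : Zd d -> R) (level : R) : \bar R :=
  ereal_inf [set ((mx_norm t)%:~R : R)%:E | t in [set t : Zd d | level < x t]].

End OrderStatistics.

(* Main.v *)
(** A single big jump decides everything. Fix a small [eta]. With probability
    [1 - O((n^d / gamma_n^alpha)^2)] at most one point of the Poisson measure
    contributes a term of modulus above [eta gamma_n] to some [X_t] with [t] in
    the window, and for each [t] the sum of the other terms exceeds
    [delta gamma_n] with probability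
    [O(eta^(2 - alpha) gamma_n^-alpha / delta^2)], by Chebyshev's inequality.
    Outside these events the field exceeds each level [gamma_n y_k] at [k]
    points of the window if and only if, up to a factor [1 +- delta] on the
    levels, one point [(j, v, u)] does so through [t |-> j f(v, u - t)] alone.
    The intensity of such points is [gamma_n^-alpha] times the sum over [u] and
    the integral over [v] of the rank functional of [f(v, .)] restricted to the
    window seen from [u]. About [(2 n)^d] locations [u] see essentially all of
    [f(v, .)] and the others see only its tail, so dominated convergence gives
    the limit after division by [n^d]; then [eta] and [delta] go to 0. *)

Require Import Defs.
From HB Require Import structures.
From mathcomp Require Import all_boot all_order all_algebra finmap.
From mathcomp Require Import all_classical all_reals all_analysis.
From mathcomp Require Import measurable_realfun ring lra zify.
Set Implicit Arguments.
Unset Strict Implicit.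
Unset Printing Implicit Defensive.
Import Order.TTheory GRing.Theory Num.Theory.
Import numFieldNormedType.Exports.
Local Open Scope classical_set_scope.
Local Open Scope ring_scope.

(** * Poisson counts *)

(** The obstacle is the sum of the small jumps. The series is given only as a limit in probability,
    which yields no second moment for Chebyshev's inequality. That inequality is therefore applied
    to the jumps of modulus between a truncation level and [eta gamma_n], after rounding them to a
    grid: a finite combination of Poisson counts. Since [alpha < 2], its bound stays uniform as the
    truncation level and the mesh go to 0, and only then does convergence in probability enter. The
    hypothesis on [gamma_n] says that [n^d / gamma_n^alpha] tends to 0, so the squared error
    vanishes even after multiplication by [gamma_n^alpha / n^d]. The error of the small jumps does
    not vanish; its limit is of order [eta^(2 - alpha) / dl^2] with [dl] the slack of the levels, so
    [eta] is chosen after [dl]. Sorting is avoided through [ranked], the existence of [k] distinct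
    points above the [k]-th level, which is monotone, compatible with reflections of the lattice and
    measurable. Both claims then become one statement about windows of radius [n0 n] with [n0 n / n]
    tending to [lambda]; hitting times are the case of a single level. *)

Section RealInequalities.
Context {R : realType}.
Implicit Types a x y z : R.

(* The left side bounds from below, and the right side is, the integral of [x^2]
   over (y, z] against the measure with tail [x^-a]. *)
Lemma sqr_powR_increment a y z : 0 < a < 2 -> 0 < y -> y <= z ->
  y ^+ 2 * (y `^ (- a) - z `^ (- a)) <=
    a / (2 - a) * (z `^ (2 - a) - y `^ (2 - a)).
Proof.
move=> /andP[a0 a2] y0 yz; have z0 : 0 < z by exact: lt_le_trans yz.
have b0 : 0 < 2 - a by rewrite subr_gt0.
(* Writing [z = y * expR s] reduces the claim to [1 - expR (- a s) <= a s <= a / (2 - a) * (expR ((2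
   - a) s) - 1)], two instances of [1 + x <= expR x]. *)
pose s := ln z - ln y.
have s0 : 0 <= s by rewrite subr_ge0 ler_ln.
have zE b : z `^ b = y `^ b * expR (b * s).
  rewrite /powR !gt_eqF// -expRD; congr expR; rewrite /s; ring.
rewrite !zE.
have -> : y ^+ 2 * (y `^ (- a) - y `^ (- a) * expR (- a * s)) =
    y `^ (2 - a) * (1 - expR (- a * s)).
  rewrite powRD; last by rewrite gt_eqF ?implybT.
  by rewrite powR_mulrn ?ltW//; ring.
rewrite mulrBr [in leRHS]mulrBr mulrA -mulrBr.
have -> : a / (2 - a) * y `^ (2 - a) * expR ((2 - a) * s) -
    a / (2 - a) * y `^ (2 - a) =
    y `^ (2 - a) * (a / (2 - a) * (expR ((2 - a) * s) - 1)) by ring.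
rewrite ler_wpM2l ?powR_ge0//.
apply: (@le_trans _ _ (a * s)).
  by have := expR_ge1Dx (- a * s); lra.
rewrite -mulrA ler_wpM2l ?(ltW a0)//.
rewrite -[s in leLHS](mulKf (lt0r_neq0 b0)) ler_wpM2l ?invr_ge0 ?(ltW b0)//.
by have := expR_ge1Dx ((2 - a) * s); lra.
Qed.

(** This bound and the next replace the probability that a Poisson count is positive by its mean, up
    to the square of the mean. *)
Lemma onem_expRN_le x : 1 - expR (- x) <= x.
Proof. by have := expR_ge1Dx (- x); lra. Qed.

Lemma onem_expRN_ge x : 0 <= x -> x - x ^+ 2 <= 1 - expR (- x).
Proof.
move=> x0; have h := expR_ge1Dx x.
have : expR (- x) * (1 + x) <= 1.
  by rewrite -[leRHS](expRxMexpNx_1 x) mulrC ler_wpM2r// expR_ge0.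
have := expR_ge0 (- x); nra.
Qed.

Lemma poisson_two_points_le x : 0 <= x -> 1 - expR (- x) * (1 + x) <= x ^+ 2.
Proof. by move=> x0; have := expR_ge1Dx (- x); nra. Qed.

(** Since [k ^_ q / k! = 1 / (k - q)!], the series is the exponential series shifted by [q]. The
    cases [q = 0, 1, 2] give the total mass, the mean and the second moment of a Poisson count. *)
Lemma poisson_ffact_series a (q : nat) : 0 <= a ->
  (\sum_(0 <= k <oo) ((k ^_ q)%:R * (a ^+ k / k`!%:R * expR (- a)))%:E)%E =
    (a ^+ q)%:E.
Proof.
move=> a0; apply/cvg_lim => //; rewrite -(cvg_shiftn q).
have partial n :
    (\sum_(0 <= k < n + q) ((k ^_ q)%:R * (a ^+ k / k`!%:R * expR (- a)))%:E)%E =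
    (a ^+ q * expR (- a) * series (exp_coeff a) n)%:E.
  rewrite sumEFin; congr EFin; elim: n => [|n IH].
    rewrite /series/= add0n !big_mkord big_ord0 mulr0 big1// => i _.
    by rewrite ffact_small ?mul0r.
  rewrite addSn big_nat_recr//= IH seriesSr mulrDr; congr +%R.
  rewrite exp_coeffE/= exprD -(@ffact_fact (n + q) q) ?leq_addl// addnK natrM.
  rewrite invfM; have : (((n + q) ^_ q)%:R : R) != 0.
    by rewrite pnatr_eq0 -lt0n ffact_gt0 leq_addl.
  move: (_ ^_ _)%:R (_`!%:R^-1) => b c b0; field.
  by [].
under eq_fun do rewrite partial.
apply: cvg_EFin; first exact: nearW.
rewrite [X in _ --> X](_ : _ = a ^+ q * expR (- a) * expR a); last first.
  by rewrite -mulrA [expR _ * _]mulrC expRxMexpNx_1 mulr1.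
apply: cvgMr; rewrite expRE.
have /cvg_ex[l hl] := is_cvg_series_exp_coeff a.
rewrite [pseries _ _](_ : _ = series (exp_coeff a)).
  by rewrite (cvg_lim _ hl).
by rewrite exp_coeffE.
Qed.

End RealInequalities.

Lemma markov_ge0 {R : realType} d (T : measurableType d)
    (mu : {measure set T -> \bar R}) (g : T -> \bar R) (x : R) :
  0 < x -> (forall w, 0 <= g w)%E -> measurable_fun [set: T] g ->
  (x%:E * mu [set w | x%:E <= g w] <= \int[mu]_w g w)%E.
Proof.
move=> x0 g0 mg; rewrite -[X in mu X]setTI.
rewrite (_ : _ `&` _ = [set: T] `&` [set w | (x%:E <= `|g w|)%E]); last first.
  by congr (_ `&` _); apply/seteqP; split=> w /=; rewrite gee0_abs.
apply: le_trans (@le_integral_comp_abse _ _ _ mu _ measurableT g x id _ _ _ _ _) _ => //.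
by rewrite le_eqVlt; apply/orP; left; apply/eqP/eq_integral => w _;
  rewrite gee0_abs.
Qed.

Section PoissonCounts.
Context {R : realType} (dO : measure_display) (Omega : measurableType dO)
  (P : probability Omega R) (dE : measure_display) (E : measurableType dE)
  (M : {measure set E -> \bar R}) (p : nat -> Omega -> E)
  (hp : poisson_random_measure P M p).
Implicit Types (A B : set E) (w : Omega) (k : nat).

Lemma point_measureE A w :
  point_measure R p A w = counting [set i | A (p i w)].
Proof. by rewrite counting_dirac. Qed.

Lemma measurable_point_measure A : measurable A ->
  measurable_fun [set: Omega] (point_measure R p A).
Proof.
move=> mA; apply: ge0_emeasurable_sum => // k _.
have [mp _ _] := hp.
rewrite (_ : (fun _ => _) = EFin \o (\1_A \o p k)); last exact/funext.
by apply/measurable_EFinP; apply: measurableT_comp.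
Qed.

Lemma point_measure_nat A w : (point_measure R p A w < +oo)%E ->
  exists k : nat, point_measure R p A w = k%:R%:E.
Proof.
by rewrite point_measureE /counting; case: ifPn => // _ _; eexists.
Qed.

Lemma point_measure_finite A w : (point_measure R p A w < +oo)%E ->
  finite_set [set i | A (p i w)].
Proof. by rewrite point_measureE /counting; case: asboolP. Qed.

Lemma point_measure_sum A w n : (forall i, (n <= i)%N -> ~ A (p i w)) ->
  point_measure R p A w = (\sum_(i < n) \1_A (p i w))%:E.
Proof.
move=> h; rewrite -sumEFin -(big_mkord xpredT (fun i => (\1_A (p i w))%:E)).
apply: cvg_lim => //; apply: cvg_near_cst; near=> m.
have nm : (n <= m)%N by near: m; exact: nbhs_infty_ge.
rewrite (@big_cat_nat _ _ _ n)//=.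
have -> : (\sum_(n <= i < m) \d_(p i w) A = 0 :> \bar R)%E.
  rewrite big_nat_cond big1// => i.
  by rewrite andbT => /andP[/h Ai _]; rewrite diracE memNset.
by rewrite adde0.
Unshelve. all: by end_near. Qed.

Lemma point_measure_eq0 A w :
  point_measure R p A w = 0%E <-> forall i, ~ A (p i w).
Proof.
split=> [h i Ai|h]; last first.
  by rewrite (@point_measure_sum _ _ 0) ?big_ord0.
have : (1 <= 0 :> \bar R)%E.
  rewrite -h /point_measure (@nneseriesD1 _ _ i)//.
  by rewrite diracE mem_set// leeDl// nneseries_ge0.
by rewrite lee_fin ler10.
Qed.

Lemma measurable_point_measure_set A (B : set (\bar R)) : measurable A ->
  measurable B -> measurable [set w | B (point_measure R p A w)].
Proof.
move=> mA mB; rewrite -[X in measurable X]setTI.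
exact: measurable_point_measure.
Qed.

Lemma measurable_point_measure_eq A (e : \bar R) : measurable A ->
  measurable [set w | point_measure R p A w = e].
Proof.
by move=> mA; exact: (measurable_point_measure_set mA (emeasurable_set1 e)).
Qed.

Lemma poisson_pmfE A k : measurable A -> (M A < +oo)%E ->
  P [set w | point_measure R p A w = k%:R%:E] =
    (fine (M A) ^+ k / k`!%:R * expR (- fine (M A)))%:E.
Proof. by move=> mA hA; have [_ -> // _] := hp; rewrite hA. Qed.

Lemma intensity_fineK A : (M A < +oo)%E -> (fine (M A))%:E = M A.
Proof. by move=> h; rewrite fineK// ge0_fin_numE. Qed.

Lemma prob_point_measure_pos A : measurable A -> (M A < +oo)%E ->
  P [set w | point_measure R p A w != 0%E] = (1 - expR (- fine (M A)))%:E.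
Proof.
move=> mA hA; rewrite (_ : mkset _ = ~` [set w | point_measure R p A w = 0%:R%:E]).
  rewrite probability_setC; last first.
    exact: measurable_point_measure_eq.
  by rewrite poisson_pmfE// expr0 fact0 divr1 mul1r.
by apply/seteqP; split=> w /=; [move/eqP|move/eqP].
Qed.

Lemma prob_point_measure_ge2 A : measurable A -> (M A < +oo)%E ->
  (P [set w | (1 < point_measure R p A w)%E] <= (fine (M A) ^+ 2)%:E)%E.
Proof.
move=> mA hA; set a := fine (M A).
have a0 : 0 <= a by rewrite fine_ge0.
pose F k := [set w | point_measure R p A w = k%:R%:E].
have mF k : measurable (F k).
  exact: measurable_point_measure_eq.
rewrite (_ : mkset _ = ~` (F 0 `|` F 1%N)); last first.
  apply/seteqP; split=> w /=.
    by rewrite /F/= => + [] hk; rewrite hk lte_fin ?ltr10 ?ltxx.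
  move=> h; rewrite ltNge; apply/negP => h1; apply: h.
  have [k hk] := point_measure_nat (le_lt_trans h1 (ltry _)).
  rewrite /F/= hk; move: h1; rewrite hk lee_fin (ler_nat _ _ 1).
  by case: k {hk} => [|[|]]//; [left|right].
rewrite probability_setC; last exact: measurableU.
have PF k : P (F k) = (a ^+ k / k`!%:R * expR (- a))%:E by exact: poisson_pmfE.
have -> : P (F 0%N `|` F 1%N) = (P (F 0%N) + P (F 1%N))%E.
  apply: measureU => //.
  by apply/seteqP; split=> // w []; rewrite /F/= => -> [] /eqP; rewrite eqr_nat.
rewrite !PF expr0 expr1 !divr1 mul1r.
apply: (@le_trans _ _ (1 - (expR (- a) + a * expR (- a)))%:E).
  by rewrite EFinB EFinD.
rewrite lee_fin.
by have := poisson_two_points_le a0; lra.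
Qed.

(** The Poisson weights of the integer values already sum to 1, which leaves nothing for [+oo]. *)
Lemma point_measure_ae_finite A : measurable A -> (M A < +oo)%E ->
  P [set w | point_measure R p A w = +oo%E] = 0%E.
Proof.
move=> mA hA; pose F k := [set w | point_measure R p A w = k%:R%:E].
have mF k : measurable (F k).
  exact: measurable_point_measure_eq.
rewrite (_ : mkset _ = ~` (\bigcup_k F k)); last first.
  apply/seteqP; split=> w /=; first by move=> h [k _]; rewrite /F/= h.
  move=> h; apply: contrapT => h'; apply: h.
  have [|k hk] := @point_measure_nat A w; first by rewrite ltey; exact/eqP.
  by exists k.
rewrite probability_setC; last exact: bigcup_measurable.
rewrite measure_bigcup//; last first.
  apply/trivIsetP => i j _ _ ij; apply/seteqP; split=> // w []; rewrite /F/= => -> [] /eqP.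
  by rewrite eqr_nat (negPf ij).
rewrite (@eq_eseriesl _ _ xpredT); last by move=> k; rewrite in_setT.
rewrite -(@eq_eseriesr _ (fun k => ((k ^_ 0)%:R * (fine (M A) ^+ k / k`!%:R *
    expR (- fine (M A))))%:E)); last first.
  by move=> k _; rewrite ffactn0 mul1r; apply/esym; exact: poisson_pmfE.
by rewrite poisson_ffact_series ?expr0 ?fine_ge0// subee.
Qed.

Local Notation K A w := (fine (point_measure R p A w)).

Lemma measurable_fine_point_measure A : measurable A ->
  measurable_fun [set: Omega] (fun w => K A w).
Proof.
by move=> mA; apply: measurableT_comp => //; exact: measurable_point_measure.
Qed.

Lemma expectation_point_measure (psi : R -> R) A :
  measurable_fun [set: R] psi -> (forall x, 0 <= psi x) ->
  measurable A -> (M A < +oo)%E ->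
  (\int[P]_w (psi (K A w))%:E = \sum_(0 <= k <oo)
    (psi k%:R * (fine (M A) ^+ k / k`!%:R * expR (- fine (M A))))%:E)%E.
Proof.
move=> mpsi psi0 mA hA; pose F k := [set w | point_measure R p A w = k%:R%:E].
have mF k : measurable (F k) by exact: measurable_point_measure_eq.
have tF : trivIset setT F.
  apply/trivIsetP => i j _ _ ij; apply/seteqP; split=> // w []; rewrite /F/= => -> [] /eqP.
  by rewrite eqr_nat (negPf ij).
have mpsiK : measurable_fun [set: Omega] (fun w => (psi (K A w))%:E).
  apply/measurable_EFinP; apply: measurableT_comp => //.
  exact: measurable_fine_point_measure.
have psiK0 w : (0 <= (psi (K A w))%:E)%E by rewrite lee_fin.
rewrite (ge0_negligible_integral (measurable_point_measure_eq +oo%E mA))//;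
  last exact: point_measure_ae_finite.
rewrite (_ : _ `\` _ = \bigcup_k F k); last first.
  apply/seteqP; split=> w /=; last by move=> [k _] -> .
  move=> [_ h]; have [|k hk] := @point_measure_nat A w.
    by rewrite ltey; exact/eqP.
  by exists k.
rewrite ge0_integral_bigcup//; first last.
  exact: measurable_funS mpsiK.
apply: eq_eseriesr => k _.
rewrite (eq_integral (fun=> (psi k%:R)%:E)); last first.
  by move=> w; rewrite inE => ->.
by rewrite integral_cst// EFinM -poisson_pmfE.
Qed.

Lemma expectation_count A : measurable A -> (M A < +oo)%E ->
  (\int[P]_w (K A w)%:E = M A)%E.
Proof.
move=> mA hA; rewrite -[RHS]intensity_fineK// -[fine (M A)]expr1.
rewrite -poisson_ffact_series ?fine_ge0//.
(* The modulus makes the test function non-negative on all of [R]; on counts it changes nothing. *)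
transitivity (\int[P]_w (`|K A w|%R)%:E)%E.
  by apply: eq_integral => w _; rewrite ger0_norm// fine_ge0// nneseries_ge0.
rewrite (expectation_point_measure (psi := fun x => `|x|))//.
by apply: eq_eseriesr => k _; rewrite normr_nat ffactn1.
Qed.

Lemma expectation_count_sqr A : measurable A -> (M A < +oo)%E ->
  (\int[P]_w (K A w ^+ 2)%:E = (fine (M A) + fine (M A) ^+ 2)%:E)%E.
Proof.
move=> mA hA.
rewrite (expectation_point_measure (psi := fun x => x ^+ 2))//; last first.
  by move=> x; exact: sqr_ge0.
rewrite -[X in (X + _)%:E]expr1 EFinD -!poisson_ffact_series ?fine_ge0//.
rewrite -nneseriesD; last 2 first.
- by move=> k _ _; rewrite lee_fin !mulr_ge0 ?expR_ge0 ?exprn_ge0 ?fine_ge0.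
- by move=> k _ _; rewrite lee_fin !mulr_ge0 ?expR_ge0 ?exprn_ge0 ?fine_ge0.
apply: eq_eseriesr => k _; rewrite -EFinD -mulrDl; congr (_ * _)%:E.
rewrite -natrX -natrD; congr _%:R.
by rewrite ffactn1 ffactnSr ffactn1; case: k => // k; rewrite subSS subn0; lia.
Qed.

(* Polarisation of the second moment replaces independence. *)
Lemma expectation_count_mul A B : measurable A -> measurable B ->
  (M A < +oo)%E -> (M B < +oo)%E -> A `&` B = set0 ->
  (\int[P]_w (K A w * K B w)%:E = (fine (M A) * fine (M B))%:E)%E.
Proof.
move=> mA mB hA hB AB0.
have mAB : measurable (A `|` B) by exact: measurableU.
have MU : M (A `|` B) = (fine (M A) + fine (M B))%:E.
  by rewrite measureU// EFinD !intensity_fineK.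
have hAB : (M (A `|` B) < +oo)%E by rewrite MU ltry.
have NU w : point_measure R p (A `|` B) w =
    (point_measure R p A w + point_measure R p B w)%E.
  rewrite /point_measure -nneseriesD//.
  by apply: eq_eseriesr => k _; rewrite measureU.
have mK C : measurable C -> measurable_fun [set: Omega] (fun w => K C w).
  exact: measurable_fine_point_measure.
have mK2 C : measurable C ->
    measurable_fun [set: Omega] (fun w => (K C w ^+ 2)%:E).
  by move=> mC; apply/measurable_EFinP; apply: measurable_funX; exact: mK.
have K0 C w : 0 <= K C w by rewrite fine_ge0// nneseries_ge0.
have mKK : measurable_fun [set: Omega] (fun w => (K A w * K B w)%:E).
  by apply/measurable_EFinP; apply: measurable_funM; exact: mK.
have KK0 w : (0 <= (K A w * K B w)%:E)%E by rewrite lee_fin mulr_ge0.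
have := expectation_count_sqr mAB hAB.
(* [fine] is additive on the two counts only where both are finite, hence almost surely. *)
rewrite (ae_eq_integral (fun w => (K A w ^+ 2)%:E + (K B w ^+ 2)%:E +
    ((K A w * K B w)%:E + (K A w * K B w)%:E))%E)//; last 3 first.
- exact: mK2.
- by apply: emeasurable_funD => //; apply: emeasurable_funD => //; exact: mK2.
- exists ([set w | point_measure R p A w = +oo%E] `|`
      [set w | point_measure R p B w = +oo%E]); split.
  + by apply: measurableU; exact: measurable_point_measure_eq.
  + apply: null_set_setU; [exact: measurable_point_measure_eq..| |];
      exact: point_measure_ae_finite.
  + move=> w /= h; apply: contrapT => /not_orP[/eqP fA /eqP fB].
    move: h; apply => _; rewrite NU fineD; last 2 first.
    * by rewrite ge0_fin_numE ?nneseries_ge0// ltey.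
    * by rewrite ge0_fin_numE ?nneseries_ge0// ltey.
    by rewrite -!EFinD; congr EFin; ring.
have sq0 C w : (0 <= (K C w ^+ 2)%:E)%E by rewrite lee_fin sqr_ge0.
rewrite ge0_integralD//; last 4 first.
- by move=> w _; rewrite adde_ge0.
- by apply: emeasurable_funD; exact: mK2.
- by move=> w _; rewrite adde_ge0.
- by apply: emeasurable_funD.
rewrite ge0_integralD//; [|exact: mK2|exact: mK2].
rewrite ge0_integralD// !expectation_count_sqr// MU.
have : (0 <= \int[P]_w (K A w * K B w)%:E)%E by apply: integral_ge0.
case: (\int[P]_w _)%E => [r _||]//=; rewrite -!EFinD => -[] h.
by congr EFin; move: h; nra.
Qed.

(** Variance plus squared mean: counts of disjoint sets are uncorrelated, and the variance of a
    Poisson count is its mean. *)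
Lemma expectation_sum_count_sqr (I : finType) (A : I -> set E) (c : I -> R) :
  (forall i, measurable (A i)) -> (forall i, (M (A i) < +oo)%E) ->
  (forall i k : I, i != k -> A i `&` A k = set0) ->
  (\int[P]_w ((\sum_i c i * K (A i) w) ^+ 2)%:E =
    (\sum_i c i ^+ 2 * fine (M (A i)) +
      (\sum_i c i * fine (M (A i))) ^+ 2)%:E)%E.
Proof.
move=> mA hA dA; set a := fun i => fine (M (A i)).
have KK (i k : I) : (\int[P]_w (K (A i) w * K (A k) w)%:E =
    (a i * a k + (i == k)%:R * a i)%:E)%E.
  have [->|ik] := eqVneq i k.
    rewrite -[RHS]/(_%:E) mul1r addrC -expr2 -expectation_count_sqr//.
  by rewrite mul0r addr0 expectation_count_mul//; exact: dA.
have mKK (i k : I) : measurable_fun [set: Omega] (fun w => (K (A i) w * K (A k) w)%:E).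
  by apply/measurable_EFinP; apply: measurable_funM;
    exact: measurable_fine_point_measure.
(* The coefficients [c] may be negative, so the expanded square has to be integrated by
   integrability rather than by positivity. *)
have iKK (i k : I) : P.-integrable [set: Omega] (fun w => (K (A i) w * K (A k) w)%:E).
  apply/integrableP; split=> //.
  rewrite (eq_integral (fun w => (K (A i) w * K (A k) w)%:E)).
    by rewrite KK ltry.
  by move=> w _; rewrite gee0_abs// lee_fin mulr_ge0// fine_ge0// nneseries_ge0.
have icKK (i k : I) : P.-integrable [set: Omega]
    (fun w => (c i * c k)%:E * (K (A i) w * K (A k) w)%:E)%E.
  exact: integrableZl.
transitivity (\int[P]_w (\sum_i \sum_k
    (c i * c k)%:E * (K (A i) w * K (A k) w)%:E))%E.
  apply: eq_integral => w _; rewrite expr2 big_distrlr/= -sumEFin.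
  apply: eq_bigr => i _; rewrite -sumEFin; apply: eq_bigr => k _.
  by rewrite -EFinM; congr EFin; ring.
rewrite integral_sum//=; last by move=> i; exact: integrable_sum.
transitivity ((\sum_i \sum_k
    ((c i * c k) * (a i * a k + (i == k)%:R * a i)))%R%:E)%E.
  rewrite -sumEFin; apply: eq_bigr => i _; rewrite integral_sum//= -sumEFin.
  by apply: eq_bigr => k _; rewrite integralZl// KK.
congr EFin.
rewrite expr2 big_distrlr/= -big_split/=; apply: eq_bigr => i _.
transitivity (\sum_k (c i * a i * (c k * a k) + (i == k)%:R * (c i * c k * a i))).
  by apply: eq_bigr => k _; ring.
rewrite big_split/= addrC; congr +%R.
rewrite (bigD1 i)//= eqxx big1 ?addr0; last first.
  by move=> k; rewrite eq_sym => /negPf ->; rewrite mul0r.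
by rewrite mul1r expr2.
Qed.

Lemma chebyshev_sum_count (I : finType) (A : I -> set E) (c : I -> R) (x : R) :
  (forall i, measurable (A i)) -> (forall i, (M (A i) < +oo)%E) ->
  (forall i k : I, i != k -> A i `&` A k = set0) ->
  \sum_i c i * fine (M (A i)) = 0 -> 0 < x ->
  (P [set w | (x <= `|\sum_i c i * K (A i) w|)%R] <=
    ((\sum_i c i ^+ 2 * fine (M (A i))) / x ^+ 2)%:E)%E.
Proof.
move=> mA hA dA c0 x0.
have mS : measurable_fun [set: Omega] (fun w => \sum_i c i * K (A i) w).
  apply: measurable_sum => i; apply: measurable_funM => //.
  exact: measurable_fine_point_measure.
rewrite EFinM lee_pdivlMr ?exprn_gt0// muleC.
rewrite (_ : mkset _ =
    [set w | ((x ^+ 2)%:E <= ((\sum_i c i * K (A i) w) ^+ 2)%:E)%E]); last first.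
  apply/seteqP; split=> w /=; rewrite lee_fin;
    by rewrite -(@real_normK _ (\sum_i _)) ?num_real// ler_pXn2r ?nnegrE// ltW.
apply: (le_trans (@markov_ge0 _ _ _ P
  (fun w => ((\sum_i c i * K (A i) w) ^+ 2)%:E) (x ^+ 2) _ _ _)).
- by rewrite exprn_gt0.
- by move=> w; rewrite lee_fin sqr_ge0.
- by apply/measurable_EFinP; exact: measurable_funX.
- by rewrite expectation_sum_count_sqr// c0 expr0n/= addr0.
Qed.

Lemma prob_count_ge A (x : R) : measurable A -> (M A < +oo)%E -> 0 < x ->
  (P [set w | (x%:E <= point_measure R p A w)%E] <= (fine (M A) / x)%:E)%E.
Proof.
move=> mA hA x0; rewrite EFinM lee_pdivlMr// muleC.
apply: (le_trans (@markov_ge0 _ _ _ P (point_measure R p A) x x0 _ _)).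
- by move=> w; exact: nneseries_ge0.
- exact: measurable_point_measure.
rewrite intensity_fineK// -expectation_count//.
rewrite (ae_eq_integral (fun w => (K A w)%:E))//.
- exact: measurable_point_measure.
- by apply/measurable_EFinP; exact: measurable_fine_point_measure.
exists [set w | point_measure R p A w = +oo%E]; split.
- exact: measurable_point_measure_eq.
- exact: point_measure_ae_finite.
move=> w /= h; apply: contrapT => /eqP fA; apply: h => _.
by rewrite fineK// ge0_fin_numE ?nneseries_ge0// ltey.
Qed.

End PoissonCounts.

(** * The error of the truncated series *)

Section TruncatedSums.
Context {R : realType} (dO : measure_display) (Omega : measurableType dO)
  (P : probability Omega R) (dE : measure_display) (E : measurableType dE)
  (M : {measure set E -> \bar R}) (p : nat -> Omega -> E)
  (hp : poisson_random_measure P M p) (h : E -> \bar R)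
  (mh : measurable_fun [set: E] h).
Implicit Types (x y delta : R) (w : Omega).

(** With [h] the contribution [jump f t] of a point, this is [truncated_series] by conversion, so
    the convergence that defines the stable series applies to it. *)
Definition big_jump_sum delta w : R :=
  \sum_(i \in [set i | (delta%:E < `|h (p i w)|)%E]) fine (h (p i w)).

Local Notation B delta := [set z | (delta%:E < `|h z| < +oo)%E].

Let mabs_h : measurable_fun [set: E] (fun z => `|h z|%E).
Proof. exact: measurableT_comp. Qed.

Let mset_lt (g : E -> \bar R) (e : \bar R) : measurable_fun [set: E] g ->
  measurable [set z | (e < g z)%E].
Proof.
by move=> mg; rewrite -[X in measurable X]setTI; exact: emeasurable_fun_o_infty.
Qed.

Let mB delta : measurable (B delta).
Proof.
rewrite (_ : mkset _ = [set z | (delta%:E < `|h z|)%E] `&`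
    [set z | (`|h z| < +oo)%E]).
  apply: measurableI; first exact: mset_lt.
  by rewrite -[X in measurable X]setTI; exact: emeasurable_fun_infty_o.
by apply/seteqP; split=> z /= => [/andP[]|[-> ->]].
Qed.

(** Infinite values drop out because [fine] sends them to 0, while a finite value of modulus above
    [delta >= 0] is nonzero. So [B delta] carries exactly the support of the sum. *)
Let B_supp delta w : 0 <= delta ->
  [set i | (delta%:E < `|h (p i w)|)%E] `&`
    (fun i => fine (h (p i w))) @^-1` [set~ 0] = [set i | B delta (p i w)].
Proof.
move=> d0; apply/seteqP; split=> i /=.
  by move=> [-> ]; case: (h _) => [r| |]//= _; rewrite ltry.
case: (h _) => [r| |]//=; rewrite ?ltxx ?andbF// lte_fin => /andP[dr _].
by split=> // r0; move: dr; rewrite r0 normr0 ltNge d0.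
Qed.

Lemma big_jump_sumE delta w n : 0 <= delta ->
  (forall i, (n <= i)%N -> ~ B delta (p i w)) ->
  big_jump_sum delta w = \sum_(i < n) \1_(B delta) (p i w) * fine (h (p i w)).
Proof.
move=> d0 hn; rewrite /big_jump_sum fsbig_supp B_supp// fsbig_mkcond.
rewrite -(fsbig_widen `I_n)//=; last first.
  move=> i /= [_ /negP]; rewrite -leqNgt => /hn Bi.
  by rewrite patchE memNset.
rewrite (fsbig_ord _ _ (fun i => \1_(B delta) (p i w) * fine (h (p i w)))).
apply: eq_fsbigr => i _; rewrite patchE indicE.
by case: ifPn => [/set_mem/= Bi|/negP Bi];
  [rewrite mem_set ?mul1r|rewrite memNset ?mul0r// => Bi'; apply: Bi; rewrite inE].
Qed.

Lemma finite_set_nat_bound (A : set nat) : finite_set A ->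
  exists n, forall i, (n <= i)%N -> ~ A i.
Proof.
move=> /finite_fsetP[X ->]; exists (\max_(i <- X) i).+1 => i ni /= iX.
by move: ni; apply/negP; rewrite -leqNgt (@leq_bigmax_seq _ _ xpredT id).
Qed.

(** On the event [D] that finitely many points contribute, the sum is a limit of measurable partial
    sums; off [D] the finitely supported sum takes its default value 0, which the factor [\1_D]
    reproduces. *)
Lemma measurable_big_jump_sum delta : 0 <= delta ->
  measurable_fun [set: Omega] (big_jump_sum delta).
Proof.
move=> d0; pose D := [set w | (point_measure R p (B delta) w < +oo)%E].
pose s n w := \1_D w *
  \sum_(i < n) \1_(B delta) (p i w) * fine (h (p i w)).
have mD : measurable D.
  rewrite /D -[X in measurable X]setTI; apply: emeasurable_fun_infty_o => //.
  exact: (measurable_point_measure hp).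
apply: (@measurable_fun_cvg _ _ _ _ s) => [n|w _].
  apply: measurable_funM => //; apply: measurable_sum => i.
  have [mp _ _] := hp.
  by apply: measurable_funM; apply: measurableT_comp => //; exact: measurableT_comp.
have [Dw|Dw] := pselect (D w).
  have [n hn] := finite_set_nat_bound (point_measure_finite Dw).
  apply: cvg_near_cst; near=> k.
  rewrite /s indicE mem_set// mul1r -(@big_jump_sumE _ _ k)// => i ki.
  by apply: hn; rewrite (leq_trans _ ki)//; near: k; exact: nbhs_infty_ge.
rewrite /big_jump_sum fsbig_dflt.
  by apply: cvg_near_cst; apply: nearW => k; rewrite /s indicE memNset// mul0r.
rewrite B_supp// => fB; apply: Dw.
by rewrite /D/= point_measureE /counting; case: asboolP => //; rewrite ltry.
Unshelve. all: by end_near. Qed.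

Let sh (b : bool) z := if b then h z else (- h z)%E.

Let msh b : measurable_fun [set: E] (sh b).
Proof. by case: b => //; exact: measurableT_comp. Qed.

Let layer x y (b : bool) := [set z | (x%:E < sh b z <= y%:E)%E].
Local Notation A x y := [set z | (x%:E < `|h z| <= y%:E)%E].

Let layerE x y b :
  layer x y b = [set z | (x%:E < sh b z)%E] `\` [set z | (y%:E < sh b z)%E].
Proof.
apply/seteqP; split=> z; rewrite /layer/=.
  by move=> /andP[-> zy]; split=> //; apply/negP; rewrite -leNgt.
by move=> [-> /negP]; rewrite -leNgt.
Qed.

Let mlayer x y b : measurable (layer x y b).
Proof. by rewrite layerE; apply: measurableD; exact: mset_lt. Qed.

Let indic_mkset (q : pred E) z : \1_[set z | q z] z = (q z)%:R :> R.
Proof.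
by rewrite indicE; case: (boolP (q z)) => [qz|/negP qz];
  [rewrite mem_set|rewrite memNset].
Qed.

Let abs_layer x y z : 0 < x ->
  \1_(A x y) z = \sum_(b : bool) \1_(layer x y b) z :> R.
Proof.
move=> x0; rewrite big_bool/= !indic_mkset -natrD; congr _%:R; rewrite /sh/=.
case: (h z) => [r| |] /=; last 2 first.
- by rewrite !leye_eq/= !andbF.
- by rewrite !leye_eq/= !andbF.
rewrite !lte_fin !lee_fin; have [r0|r0] := leP 0 r.
  have -> : (x < - r) = false by apply/negbTE; rewrite -leNgt; lra.
  by rewrite addn0 ger0_norm.
have -> : (x < r) = false by apply/negbTE; rewrite -leNgt; lra.
by rewrite add0n ltr0_norm.
Qed.

Let layer_sum (y : nat -> R) b n z : {homo y : k l / (k <= l)%N >-> k <= l} ->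
  \sum_(k < n) \1_(layer (y k) (y k.+1) b) z = \1_(layer (y 0%N) (y n) b) z :> R.
Proof.
move=> y_nd; rewrite -(big_mkord xpredT (fun k => \1_(layer (y k) (y k.+1) b) z)).
have lE k l : (k <= l)%N -> \1_(layer (y k) (y l) b) z =
    - ((y l)%:E < sh b z)%E%:R - - ((y k)%:E < sh b z)%E%:R :> R.
  move=> kl; rewrite indic_mkset opprK addrC.
  have : ((y l)%:E < sh b z)%E ==> ((y k)%:E < sh b z)%E.
    by apply/implyP; apply: le_lt_trans; rewrite lee_fin y_nd.
  by rewrite leNgt; do 2 case: (_ < _)%E => //=; rewrite ?subrr ?subr0.
under eq_bigr do rewrite lE//.
by rewrite telescope_sumr// lE.
Qed.

(* Rounding the jumps of modulus between [delta] and [x] to a grid turns their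
   sum into a finite linear combination of counts, whose second moment is
   explicit; the opposite layers cancel in the mean by symmetry. *)
Section Discretization.
Context (delta e : R) (n : nat) (hd : 0 < delta) (he : 0 < e).
Let y (k : nat) := delta + k%:R * e.
Let I : finType := ('I_n * bool)%type.
Let L (i : I) := layer (y i.1) (y i.1.+1) i.2.
Let cf (i : I) := if i.2 then y i.1 else - y i.1.

Let y_nd : {homo y : k l / (k <= l)%N >-> k <= l}.
Proof. by move=> k l kl; rewrite lerD2l ler_wpM2r ?(ltW he)// ler_nat. Qed.

Let y_gt0 k : 0 < y k.
Proof. by rewrite ltr_wpDr// mulr_ge0// ltW. Qed.

Let sum_L z : \sum_i \1_(L i) z = \1_(A delta (y n)) z :> R.
Proof.
rewrite abs_layer// -(pair_bigA _ (fun (k : 'I_n) b =>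
  \1_(layer (y k) (y k.+1) b) z))/= exchange_big/=.
by apply: eq_bigr => b _; rewrite layer_sum// /y mul0r addr0.
Qed.

(** Each cell has width [e], and [cf] is its endpoint nearest to 0, with the sign of the cell. *)
Let discretization_error z :
  `|\sum_i cf i * \1_(L i) z - \1_(A delta (y n)) z * fine (h z)| <=
    e * \1_(A delta (y n)) z.
Proof.
rewrite -sum_L mulr_suml -sumrB mulr_sumr (le_trans (ler_norm_sum _ _ _))//.
apply: ler_sum => -[k b] _; rewrite /L/= indic_mkset /cf/= /sh.
have yS : y k.+1 = y k + e by rewrite /y -natr1; ring.
case: b; case: (h z) => [r| |]/=; rewrite ?leye_eq/= ?andbF ?mulr0 ?mul0r ?subrr
  ?normr0//.
- rewrite lte_fin lee_fin yS; case: andP => [[h1 h2]|_] /=.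
    by rewrite !mulr1 mul1r ler_norml; lra.
  by rewrite !mulr0 mul0r subrr normr0.
- rewrite lte_fin lee_fin yS; case: andP => [[h1 h2]|_] /=.
    by rewrite !mulr1 mul1r ler_norml; lra.
  by rewrite !mulr0 mul0r subrr normr0.
Qed.

(** All the sets involved lie in [B delta], so one bound on the indices turns every count and both
    truncated sums into finite sums over the same points, which are then compared point by point. *)
Lemma big_jump_sum_discretization w :
  (point_measure R p (B delta) w < +oo)%E ->
  `|\sum_i cf i * fine (point_measure R p (L i) w) -
     (big_jump_sum delta w - big_jump_sum (y n) w)| <=
   e * fine (point_measure R p (A delta (y n)) w).
Proof.
move=> Bw; have [m hm] := finite_set_nat_bound (point_measure_finite Bw).
have dy : delta <= y n by have := y_nd (leq0n n); rewrite {1}/y mul0r addr0.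
have A_B z : A delta (y n) z -> B delta z.
  by move=> /= /andP[-> hy]; rewrite (le_lt_trans hy) ?ltry.
have By_B z : B (y n) z -> B delta z.
  by move=> /= /andP[hz ->]; rewrite andbT (le_lt_trans _ hz)// lee_fin.
have L_A i z : L i z -> A delta (y n) z.
  move=> Lz; have := sum_L z; rewrite (bigD1 i)//= indicE mem_set//.
  rewrite indicE; case: (boolP (z \in _)) => [/set_mem//|_].
  have S0 : 0 <= \sum_(j | j != i) \1_(L j) z :> R by apply: sumr_ge0.
  by move/eqP; rewrite gt_eqF// ltr_wpDr.
rewrite !(@big_jump_sumE _ _ m) ?(ltW (y_gt0 _)) ?(ltW hd)//; last first.
  by move=> i mi /By_B; exact: hm.
rewrite (point_measure_sum (n := m)); last first.
  by move=> i mi /A_B; exact: hm.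
under eq_bigr => i _.
  rewrite (point_measure_sum (n := m))/=; last first.
    by move=> k mk /L_A /A_B; exact: hm.
  rewrite mulr_sumr.
  over.
rewrite exchange_big/= -!sumrB mulr_sumr (le_trans (ler_norm_sum _ _ _))//.
apply: ler_sum => i _; apply: le_trans (discretization_error _).
rewrite le_eqVlt; apply/orP; left; apply/eqP; congr (`|_ - _|).
rewrite -mulrBl !indic_mkset; case: (h _) => [r| |]/=; rewrite ?mulr0//.
rewrite !ltry !andbT leNgt.
have : ((y n)%:E < `|r|%:E)%E ==> (delta%:E < `|r|%:E)%E.
  by apply/implyP; apply: le_lt_trans; rewrite lee_fin.
by case: (_ < _)%E; case: (_ < _)%E => //= _; ring.
Qed.

Context (a c : R) (ha : 0 < a < 2) (c0 : 0 <= c).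
Context (htail : forall b x, 0 < x ->
  M [set z | (x%:E < sh b z)%E] = (c * x `^ (- a))%:E).

Let M_layer x z b : 0 < x -> x <= z ->
  M (layer x z b) = (c * (x `^ (- a) - z `^ (- a)))%:E.
Proof.
move=> x0 xz; have z0 : 0 < z by exact: lt_le_trans xz.
pose T t := [set u | (t%:E < sh b u)%E].
have mT t : measurable (T t) by exact: mset_lt.
have TT : T x `&` T z = T z.
  apply/seteqP; split=> t /= => [[]//|zt]; split=> //.
  by apply: le_lt_trans zt; rewrite lee_fin.
have TD : M (T x `\` T z) = (M (T x) - M (T z))%E.
  rewrite -[in RHS]TT; apply: measureD => //.
  by rewrite [ltLHS]htail// ltry.
by rewrite layerE TD !htail// -EFinB mulrBr.
Qed.

(** A common point of two cells would make the sum of all indicators at least 2, but that sum is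
    itself an indicator. *)
Let trivL (i k : I) : i != k -> L i `&` L k = set0.
Proof.
move=> ik; apply/seteqP; split=> // z [Li Lk].
have := sum_L z; rewrite (bigD1 i)//= (bigD1 k) ?(eq_sym k)//=.
rewrite !indicE (mem_set Li) (mem_set Lk) => h1.
have S0 : 0 <= \sum_(j | (j != i) && (j != k)) \1_(L j) z :> R by apply: sumr_ge0.
have b1 (b : bool) : b%:R <= 1 :> R by rewrite lern1 leq_b1.
by have := b1 (z \in A delta (y n)); rewrite -h1 /= mulr1n; lra.
Qed.

(** The bound involves the outer radius [y n] alone: by [sqr_powR_increment] the second moment lies
    below a telescoping sum. Hence [delta] and the mesh may go to 0 afterwards. *)
Lemma prob_discretized_sum x : 0 < x ->
  (P [set w | (x <= `|\sum_i cf i * fine (point_measure R p (L i) w)|)%R] <=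
    (2 * c * (a / (2 - a)) * y n `^ (2 - a) / x ^+ 2)%:E)%E.
Proof.
move=> x0.
have ML i : M (L i) = (c * (y i.1 `^ (- a) - y i.1.+1 `^ (- a)))%:E.
  by rewrite M_layer// y_nd.
apply: le_trans (chebyshev_sum_count hp _ _ _ _ x0) _ => //.
- by move=> i; exact: mlayer.
- by move=> i; rewrite [ltLHS]ML ltry.
- rewrite -(pair_bigA _ (fun (k : 'I_n) b => cf (k, b) * fine (M (L (k, b)))))/=.
  by rewrite big1// => k _; rewrite big_bool/= !ML/= /cf/=; ring.
rewrite lee_fin ler_wpM2r ?invr_ge0 ?exprn_ge0 ?(ltW x0)//.
rewrite -(pair_bigA _ (fun (k : 'I_n) b =>
  cf (k, b) ^+ 2 * fine (M (L (k, b)))))/=.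
have [a0 a2] := andP ha.
have C0 : 0 <= a / (2 - a) by rewrite divr_ge0 ?(ltW a0)// subr_ge0 ltW.
apply: (@le_trans _ _ (\sum_(k < n) (2 * c * (a / (2 - a)) *
    (y k.+1 `^ (2 - a) - y k `^ (2 - a))))).
  apply: ler_sum => k _; rewrite big_bool/= !ML/= /cf/= sqrrN.
  have := sqr_powR_increment ha (y_gt0 k) (y_nd (leqnSn k)).
  by move=> /(ler_wpM2l c0); lra.
rewrite -mulr_sumr; apply: ler_wpM2l.
  by apply: mulr_ge0 => //; exact: mulr_ge0.
rewrite -(big_mkord xpredT (fun k => y k.+1 `^ (2 - a) - y k `^ (2 - a))).
by rewrite telescope_sumr// gerBl powR_ge0.
Qed.

Lemma intensity_annulus :
  M (A delta (y n)) = (2 * c * (delta `^ (- a) - y n `^ (- a)))%:E.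
Proof.
have dy : delta <= y n by have := y_nd (leq0n n); rewrite {1}/y mul0r addr0.
have -> : A delta (y n) = layer delta (y n) true `|` layer delta (y n) false.
  apply/seteqP; split=> z.
    move=> Az; have := abs_layer (y n) z hd; rewrite indicE mem_set// big_bool/=.
    rewrite !indicE; case: (boolP (z \in layer _ _ true)) => [/set_mem|_];
      first by left.
    case: (boolP (z \in layer _ _ false)) => [/set_mem|_]; first by right.
    by move=> /eqP; rewrite addr0 oner_eq0.
  move=> Lz; have := abs_layer (y n) z hd; rewrite big_bool/= !indicE.
  case: (boolP (z \in A _ _)) => [/set_mem//|_].
  by case: Lz => /mem_set ->; case: (_ \in _) => /eqP; rewrite eq_sym -natrD pnatr_eq0.
have -> : M (layer delta (y n) true `|` layer delta (y n) false) =
    (M (layer delta (y n) true) + M (layer delta (y n) false))%E.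
  apply: measureU => //.
  apply/seteqP; split=> // z [] /= /andP[h1 _] /andP[h2 _]; move: h1 h2.
  rewrite /sh; case: (h z) => [r| |]//=; rewrite !lte_fin => h1 h2.
  by have := ltrD h1 h2; rewrite subrr; move: hd; lra.
by rewrite !M_layer// -EFinD; congr EFin; ring.
Qed.

Let M_B_fin : (M (B delta) < +oo)%E.
Proof.
pose T b := [set u | (delta%:E < sh b u)%E].
have mT b : measurable (T b) by exact: mset_lt.
apply: (@le_lt_trans _ _ (M (T true `|` T false))).
  apply: le_measure; rewrite ?inE//; first exact: measurableU.
  move=> z /= /andP[h1 h2]; move: h1 h2; rewrite /T/= /sh.
  case: (h z) => [r| |]//=; rewrite !lte_fin => h1 _.
  by have [r0|r0] := leP 0 r; [left; rewrite -(ger0_norm r0)|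
    right; rewrite -(ltr0_norm r0)].
apply: (@le_lt_trans _ _ (M (T true) + M (T false))%E); first exact: measureU2.
by rewrite [X in (X + _)%E]htail// [X in (_ + X)%E]htail// -EFinD ltry.
Qed.

Lemma big_jump_sum_error_step (kappa : R) (Y : Omega -> R) :
  measurable_fun [set: Omega] Y -> 0 < kappa ->
  (P [set w | (kappa < `|big_jump_sum (y n) w - Y w|)%R] <=
    P [set w | (kappa / 4 < `|big_jump_sum delta w - Y w|)%R] +
    (2 * c * (a / (2 - a)) * y n `^ (2 - a) / (kappa / 4) ^+ 2)%:E +
    (2 * c * (delta `^ (- a) - y n `^ (- a)) / (kappa / 2 / e))%:E)%E.
Proof.
move=> mY k0.
have mbig t u : 0 < t ->
    measurable [set w | (u < `|big_jump_sum t w - Y w|)%R].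
  move=> t0; rewrite -[X in measurable X]setTI.
  have mZ : measurable_fun [set: Omega] (fun w => `|big_jump_sum t w - Y w|).
    apply: measurableT_comp => //; apply: measurable_funB => //.
    by apply: measurable_big_jump_sum; exact: ltW.
  have := mZ measurableT `]u, +oo[%classic (measurable_itv _).
  by congr measurable; apply/seteqP; split=> w [_ /=];
    rewrite ?in_itv/= ?andbT => ?; split=> //=; rewrite in_itv/= andbT.
(* The error [kappa] is shared out: a quarter for the truncation at [delta], a quarter for the
   discretized sum, a half for the rounding. *)
have k40 : 0 < kappa / 4 by rewrite divr_gt0.
have k20 : 0 < kappa / 2 / e by rewrite !divr_gt0.
set S1 := [set w | (kappa / 4 < `|big_jump_sum delta w - Y w|)%R].
pose S2 := [set w |
  (kappa / 4 <= `|\sum_i cf i * fine (point_measure R p (L i) w)|)%R].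
pose S3 := [set w |
  ((kappa / 2 / e)%:E <= point_measure R p (A delta (y n)) w)%E].
pose S4 := [set w | (point_measure R p (B delta) w = +oo)%E].
have mA : measurable (A delta (y n)).
  rewrite (_ : mkset _ = [set z | (delta%:E < `|h z|)%E] `\`
      [set z | ((y n)%:E < `|h z|)%E]).
    by apply: measurableD; exact: mset_lt.
  apply/seteqP; split=> z /=.
    by move=> /andP[-> zy]; split=> //; apply/negP; rewrite -leNgt.
  by move=> [-> /negP]; rewrite -leNgt.
have mS1 : measurable S1 by exact: mbig.
have mS2 : measurable S2.
  rewrite -[X in measurable X]setTI.
  have mZ : measurable_fun [set: Omega]
      (fun w => `|\sum_i cf i * fine (point_measure R p (L i) w)|).
    apply: measurableT_comp => //; apply: measurable_sum => i.
    apply: measurable_funM => //.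
    by apply: (measurable_fine_point_measure hp); exact: mlayer.
  have := mZ measurableT `[kappa / 4, +oo[%classic (measurable_itv _).
  by congr measurable; apply/seteqP; split=> w [_ /=];
    rewrite ?in_itv/= ?andbT => ?; split=> //=; rewrite in_itv/= andbT.
have mS3 : measurable S3.
  rewrite -[X in measurable X]setTI; apply: emeasurable_fun_c_infty => //.
  exact: (measurable_point_measure hp).
have mS4 : measurable S4 by exact: (measurable_point_measure_eq hp).
have sub : [set w | (kappa < `|big_jump_sum (y n) w - Y w|)%R] `<=`
    S1 `|` S2 `|` S3 `|` S4.
  move=> w /= kw; apply: contrapT => /not_orP[/not_orP[/not_orP[n1 n2] n3] n4].
  have Bw : (point_measure R p (B delta) w < +oo)%E by rewrite ltey; exact/eqP.
  have Aw : fine (point_measure R p (A delta (y n)) w) < kappa / 2 / e.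
    move: n3 => /negP; rewrite -ltNge => n3.
    by rewrite -lte_fin fineK// ge0_fin_numE ?(lt_trans n3) ?ltry ?nneseries_ge0.
  have := big_jump_sum_discretization Bw.
  move: n1 n2 => /negP; rewrite -leNgt => n1 /negP; rewrite -ltNge => n2.
  have : e * fine (point_measure R p (A delta (y n)) w) < kappa / 2.
    by rewrite mulrC -ltr_pdivlMr.
  move: kw n1 n2; set t1 := big_jump_sum _ _; set t2 := big_jump_sum _ _.
  set s := \sum_i _; set q := e * _.
  move=> kw n1 n2 q1 hs; move: kw; apply/negP; rewrite -leNgt.
  have -> : t1 - Y w = (s - (t2 - t1)) + (t2 - Y w) - s by ring.
  apply: (le_trans (ler_normB _ _)).
  have := ler_normD (s - (t2 - t1)) (t2 - Y w); lra.
apply: (@le_trans _ _ (P (S1 `|` S2 `|` S3 `|` S4))).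
  by apply: le_measure => //; rewrite inE; [exact: mbig|do !apply: measurableU].
have P4 : P S4 = 0%E by exact: (point_measure_ae_finite hp).
apply: (@le_trans _ _ (P (S1 `|` S2 `|` S3) + P S4)%E).
  by apply: measureU2 => //; do !apply: measurableU.
rewrite [X in (_ + X)%E]P4 adde0.
apply: (@le_trans _ _ (P (S1 `|` S2) + P S3)%E).
  by apply: measureU2 => //; do !apply: measurableU.
apply: leeD.
  apply: (@le_trans _ _ (P S1 + P S2)%E); first exact: measureU2.
  by apply: leeD => //; exact: prob_discretized_sum.
apply: le_trans (prob_count_ge hp mA _ k20) _; rewrite intensity_annulus//.
by rewrite ltry.
Qed.

End Discretization.

(** First [delta] is taken small, by the convergence in probability, then the mesh, by Markov's
    inequality for the rounding; the term that remains depends on neither. The constant is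
    [32 = 2 * 4 ^ 2], from the quarter of [kappa]. *)
Lemma big_jump_sum_error (a c x kappa : R) (Y : Omega -> R) :
  0 < a < 2 -> 0 <= c ->
  (forall (b : bool) (t : R), 0 < t ->
    M [set z | (t%:E < sh b z)%E] = (c * t `^ (- a))%:E) ->
  measurable_fun [set: Omega] Y ->
  (forall e : R, 0 < e -> P [set w | e < `|big_jump_sum delta w - Y w|]
    @[delta --> 0^'+] --> 0%E) ->
  0 < x -> 0 < kappa ->
  (P [set w | (kappa < `|big_jump_sum x w - Y w|)%R] <=
    (32 * c * (a / (2 - a)) * x `^ (2 - a) / kappa ^+ 2)%:E)%E.
Proof.
move=> ha c0 htail mY hY x0 k0.
set V := (X in (_ <= X%:E)%E).
apply/lee_addgt0Pr => e e0.
have k40 : 0 < kappa / 4 by rewrite divr_gt0.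
have k20 : 0 < kappa / 2 by rewrite divr_gt0.
have e20 : 0 < e / 2 by rewrite divr_gt0.
have [delta [d0 dx hdelta]] : exists delta, [/\ 0 < delta, delta < x &
    (P [set w | (kappa / 4 < `|big_jump_sum delta w - Y w|)%R] < (e / 2)%:E)%E].
  near (0 : R)^'+ => delta; exists delta; split.
  - by near: delta; exact: nbhs_right_gt.
  - by near: delta; exact: nbhs_right_lt.
  near: delta; apply: (hY _ k40 [set u | (u < (e / 2)%:E)%E]).
  apply: open_nbhs_nbhs; split; first exact: open_ereal_lt_ereal.
  by rewrite /= lte_fin.
have xd0 : 0 < x - delta by rewrite subr_gt0.
pose m0 := 2 * c * (delta `^ (- a) - x `^ (- a)).
have m00 : 0 <= m0.
  rewrite !mulr_ge0// subr_ge0.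
  have /andP[a0 _] := ha.
  by rewrite !powRN lef_pV2 ?posrE ?powR_gt0// ge0_ler_powR ?nnegrE ?ltW.
(* With [n] cells of width [(x - delta) / n] the grid ends exactly at [x]; [m0] is the mean number
   of rounded points, and this [n] makes the rounding cost at most [e / 2]. *)
pose n := Num.bound (m0 * (x - delta) / (kappa / 2) / (e / 2)).
have t0 : 0 <= m0 * (x - delta) / (kappa / 2) / (e / 2).
  apply: divr_ge0 (ltW e20); apply: divr_ge0 (ltW k20).
  by apply: mulr_ge0 => //; exact: ltW.
have hn : m0 * (x - delta) / (kappa / 2) / (e / 2) < n%:R by exact: archi_boundP.
have n0 : 0 < n%:R :> R by exact: le_lt_trans hn.
have st0 : 0 < (x - delta) / n%:R by rewrite divr_gt0.
have := @big_jump_sum_error_step _ _ n d0 st0 a c ha c0 htail _ Y mY k0.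
have -> : delta + n%:R * ((x - delta) / n%:R) = x.
  by rewrite mulrC divfK ?gt_eqF// subrKC.
move=> /le_trans; apply; rewrite -/m0.
have -> : 2 * c * (a / (2 - a)) * x `^ (2 - a) / (kappa / 4) ^+ 2 = V.
  by rewrite /V; field; rewrite gt_eqF//=; lra.
apply: le_trans (leeD (leeD (ltW hdelta) (lexx V%:E)) (_ : _ <= (e / 2)%:E)%E) _.
  rewrite lee_fin.
  have -> : m0 / (kappa / 2 / ((x - delta) / n%:R)) =
      m0 * (x - delta) / (kappa / 2) / n%:R.
    by field; rewrite !gt_eqF.
  by rewrite ler_pdivrMr// [leRHS]mulrC -ler_pdivrMr// ltW.
by rewrite -!EFinD lee_fin; lra.
Unshelve. all: by end_near. Qed.

End TruncatedSums.

(** * The intensity of the jumps *)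

Section SigmaFiniteCopy.
Context {R : realType} d (T : measurableType d).

(* The library declares no sigma-finite structure on a product measure. *)
Definition sigma_finite_copy (m : {measure set T -> \bar R})
  (hm : sigma_finite [set: T] m) : set T -> \bar R := m.

Context (m : {measure set T -> \bar R}) (hm : sigma_finite [set: T] m).

HB.instance Definition _ := Measure.on (sigma_finite_copy hm).
HB.instance Definition _ :=
  @Measure_isSigmaFinite.Build _ _ _ (sigma_finite_copy hm) hm.

End SigmaFiniteCopy.

Section NuAlpha.
Context {R : realType} (alpha : R) (nu_alpha : {measure set (\bar R) -> \bar R})
  (hna : is_nu_alpha alpha nu_alpha).

(** A negative [r] exchanges the two tails, which have equal mass, so only the modulus of [r]
    matters; for [r = 0] both sides vanish. *)
Lemma nu_alpha_gt (x r : R) : 0 < alpha -> 0 < x ->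
  nu_alpha [set j | (x%:E < j * r%:E)%E] = (x `^ (- alpha) * `|r| `^ alpha)%:E.
Proof.
move=> a0 x0; have [n0 hn] := hna.
have pw y : 0 < y -> ((x / y) `^ (- alpha) = x `^ (- alpha) * y `^ alpha)%R.
  move=> y0; rewrite powRM ?invr_ge0 ?(ltW x0) ?(ltW y0)//; congr (_ * _).
  by rewrite -powR_inv1 ?(ltW y0)// -powRrM mulrNN mul1r.
have [r0|r0|->] := ltgtP r 0.
- have Nr0 : 0 < - r by rewrite oppr_gt0.
  have [_] := hn (x / - r) (divr_gt0 x0 Nr0).
  rewrite ltr0_norm// -pw// => <-; congr (nu_alpha _).
  apply/seteqP; split=> -[j| |] /=; rewrite in_itv/= ?leNye ?lt0_mulye ?lt0_mulNye
    ?lte_fin ?ltry ?ltNyr//= -?EFinM ?lte_fin.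
  + by rewrite invrN mulrN opprK ltr_ndivlMr.
  + by rewrite invrN mulrN opprK ltr_ndivlMr.
- have [+ _] := hn (x / r) (divr_gt0 x0 r0).
  rewrite gtr0_norm// -pw// => <-; congr (nu_alpha _).
  apply/seteqP; split=> -[j| |] /=; rewrite in_itv/= ?leey ?gt0_mulye ?gt0_mulNye
    ?lte_fin ?ltry ?ltNyr ?andbT//= -?EFinM ?lte_fin ?ltr_pdivrMr//.
- rewrite normr0 powR0 ?gt_eqF// mulr0 [X in nu_alpha X](_ : _ = set0) ?measure0//.
  by apply/seteqP; split=> // j /=; rewrite mule0 lte_fin ltNge (ltW x0).
Qed.

(** The tails control the complement of each neighbourhood of 0, and 0 itself is a null set.
    Tonelli's theorem for the intensity relies on this. *)
Lemma sigma_finite_nu_alpha : 0 < alpha -> sigma_finite [set: \bar R] nu_alpha.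
Proof.
move=> a0; have [n0 hn] := hna.
pose G (k : nat) (r : R) := [set j : \bar R | ((k.+1%:R)^-1%:E < j * r%:E)%E].
pose F (k : nat) := if k is k'.+1 then G k' 1 `|` G k' (-1) else [set 0%E].
have k0 (k : nat) : 0 < (k.+1%:R)^-1 :> R by rewrite invr_gt0.
have mG k r : measurable (G k r).
  rewrite /G -[X in measurable X]setTI; apply: emeasurable_fun_o_infty => //.
  by apply: emeasurable_funM.
exists F.
  apply/seteqP; split=> // j _.
  have [->|j0] := eqVneq j 0%E; first by exists 0%N.
  case: j j0 => [j j0| _| _].
  - have j0' : 0 < `|j| by rewrite normr_gt0; apply: contra j0 => /eqP ->.
    pose k := Num.bound (`|j|^-1); exists k.+1 => //=.
    have kj : (k.+1%:R)^-1 < `|j|.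
      rewrite invf_plt ?posrE//; apply: lt_trans (archi_boundP _) _.
        by rewrite invr_ge0.
      by rewrite ltr_nat.
    move: kj; rewrite /G/= -!EFinM !lte_fin mulr1 mulrN1.
    by have [j1|j1] := leP 0 j; [left; rewrite -(ger0_norm j1)|
      right; rewrite -(ltr0_norm j1)].
  - by exists 1%N => //; left; rewrite /G/= gt0_mulye ?lte_fin ?ltry.
  - by exists 1%N => //; right; rewrite /G/= lt0_mulNye ?lte_fin ?ltry.
case=> [|k] /=; first by rewrite n0; split => //; exact: emeasurable_set1.
have hG r : nu_alpha (G k r) = ((k.+1%:R^-1) `^ (- alpha) * `|r| `^ alpha)%:E.
  exact: nu_alpha_gt.
split; first exact: measurableU.
apply: (@le_lt_trans _ _ (nu_alpha (G k 1%R) + nu_alpha (G k (-1)%R))%E).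
  exact: measureU2.
by rewrite !hG -EFinD ltry.
Qed.

End NuAlpha.

Section Lattice.
Context {R : realType} {d : nat}.
Implicit Types (t u : Zd d) (phi : Zd d -> \bar R).

Lemma measurable_fun_Zd d' (T : measurableType d') (g : Zd d -> T) (D : set (Zd d)) :
  measurable_fun D g.
Proof. by move=> _ B mB. Qed.

Lemma zeta_finite (A : set (Zd d)) : finite_set A ->
  zeta R d A = (#|` fset_set A|%:R)%:E.
Proof. by move=> fA; rewrite /zeta /counting asboolT. Qed.

Lemma zeta_infinite (A : set (Zd d)) : infinite_set A -> zeta R d A = +oo%E.
Proof. by move=> fA; rewrite /zeta /counting asboolF. Qed.

Lemma integral_zeta_shift t phi : (forall u, 0 <= phi u)%E ->
  (\int[zeta R d]_u phi (u - t)%R = \int[zeta R d]_u phi u)%E.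
Proof.
move=> phi0; pose s u : Zd d := u - t.
have ms : measurable_fun [set: Zd d] s by exact: measurable_fun_Zd.
rewrite -[RHS](@eq_measure_integral _ _ _ _ _ (pushforward (zeta R d) s)).
  by rewrite (ge0_integral_pushforward ms)//= => u _; exact: phi0.
move=> A _ _; rewrite -[LHS]/(zeta R d (s @^-1` A)) -[RHS]/(zeta R d A).
have inj_s : injective s by move=> u1 u2 /addIr.
have sE : s @` (s @^-1` A) = A.
  by apply: image_preimage; apply/seteqP; split=> // u _; exists (u + t) => //=;
    rewrite /s addrK.
rewrite /pushforward; have [fA|fA] := pselect (finite_set (s @^-1` A)); last first.
  rewrite !zeta_infinite//.
  move=> fA'; apply: fA.
  have -> : s @^-1` A = (fun u => u + t) @` A.
    apply/seteqP; split=> u /=; first by exists (s u) => //; rewrite /s subrK.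
    by move=> [x Ax <-]; rewrite /s addrK.
  exact: finite_image.
have fA' : finite_set A by rewrite -sE; exact: finite_image.
by rewrite !zeta_finite// -{2}sE fset_set_image// card_imfset.
Qed.

End Lattice.

Section ProductMeasures.
Context {R : realType}.

Lemma product_measure12 d1 d2 (T1 : measurableType d1) (T2 : measurableType d2)
    (m1 : {sigma_finite_measure set T1 -> \bar R})
    (m2 : {sigma_finite_measure set T2 -> \bar R}) (X : set (T1 * T2)) :
  measurable X -> ((m1 \x m2) X = \int[m2]_y m1 (ysection X y))%E.
Proof.
move=> mX; rewrite (@product_measure_unique _ _ _ _ _ m1 m2 (m1 \x^ m2)%E)//.
by move=> A B mA mB; exact: product_measure2E.
Qed.

Lemma sigma_finite_product d1 d2 (T1 : measurableType d1)
    (T2 : measurableType d2)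
    (m1 : {sigma_finite_measure set T1 -> \bar R})
    (m2 : {sigma_finite_measure set T2 -> \bar R}) :
  sigma_finite [set: T1 * T2] (m1 \x m2)%E.
Proof.
have /sigma_finiteP[F [TF ndF Foo]] := sigma_finiteT m1.
have /sigma_finiteP[G [TG ndG Goo]] := sigma_finiteT m2.
exists (fun n => F n `*` G n).
  apply/seteqP; split=> // -[x y] _.
  have [n _ Fn] : (\bigcup_n F n) x by rewrite -TF.
  have [k _ Gk] : (\bigcup_n G n) y by rewrite -TG.
  exists (maxn n k) => //; split=> /=.
    by apply: subsetPset (ndF _ _ (leq_maxl n k)) _ Fn.
  by apply: subsetPset (ndG _ _ (leq_maxr n k)) _ Gk.
move=> k; have [mF Fk] := Foo k; have [mG Gk] := Goo k.
split; first exact: measurableX.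
by rewrite product_measure1E// lte_mul_pinfty// ge0_fin_numE.
Qed.

(** The jump is integrated first because sections have an explicit [nu_alpha]-mass; the
    [W]-coordinate comes last because dominated convergence will take place in it. *)
Lemma product_measure3E d1 d2 d3 (T1 : measurableType d1)
    (T2 : measurableType d2) (T3 : measurableType d3)
    (m1 : {sigma_finite_measure set T1 -> \bar R})
    (m2 : {sigma_finite_measure set T2 -> \bar R})
    (m3 : {sigma_finite_measure set T3 -> \bar R}) (A : set ((T1 * T2) * T3)) :
  measurable A ->
  (((m1 \x m2) \x m3) A =
    \int[m2]_v \int[m3]_u m1 [set j | A ((j, v), u)])%E.
Proof.
move=> mA.
(* Reassociating makes the mass of the sections jointly measurable in the last two coordinates, as
   exchanging their integrals requires. *)
pose s (x : T1 * (T2 * T3)) : (T1 * T2) * T3 := ((x.1, x.2.1), x.2.2).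
have ms : measurable_fun setT s.
  apply: measurable_fun_pair; last exact: measurableT_comp.
  by apply: measurable_fun_pair => //; exact: measurableT_comp.
have mA' : measurable (s @^-1` A) by rewrite -[X in measurable X]setTI; exact: ms.
pose g (y : T2 * T3) := m1 [set j | A ((j, y.1), y.2)].
have mg : measurable_fun setT g.
  have -> : g = m1 \o ysection (s @^-1` A).
    apply/funext => y; rewrite /g/=; congr (m1 _).
    by apply/seteqP; split=> x; rewrite /ysection/= inE.
  exact: measurable_fun_ysection.
transitivity (\int[m3]_u (m1 \x m2) (ysection A u))%E.
  have h := @product_measure12 _ _ (T1 * T2)%type T3
    (sigma_finite_copy (sigma_finite_product m1 m2)) m3 A mA.
  exact: h.
transitivity (\int[m3]_u \int[m2]_v g (v, u))%E.
  apply: eq_integral => u _.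
  rewrite (product_measure12 _ _ (measurable_ysection _ mA)).
  apply: eq_integral => v _; congr (m1 _).
  by apply/seteqP; split=> x; rewrite /ysection/= !inE/= ?inE.
by rewrite -(fubini_tonelli g).
Qed.

End ProductMeasures.

Section Intensity.
Context {R : realType} (alpha : R) (a0 : 0 < alpha) {d : nat}
  (nu_alpha : {measure set (\bar R) -> \bar R})
  (hna : is_nu_alpha alpha nu_alpha)
  (dW : measure_display) (W : measurableType dW)
  (nu : {sigma_finite_measure set W -> \bar R}).

Local Notation M := ((nu_alpha \x nu) \x zeta R d)%E.

Lemma intensityE (A : set ((\bar R * W) * Zd d)) : measurable A ->
  (M A = \int[nu]_v \int[zeta R d]_u nu_alpha [set j | A ((j, v), u)])%E.
Proof.
exact: (@product_measure3E R _ _ _ _ _ _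
  (sigma_finite_copy (sigma_finite_nu_alpha hna a0)) nu (zeta R d) A).
Qed.

Context (f : W * Zd d -> R) (hf : f \in Lfun (nu \x zeta R d)%E alpha%:E).

(** The [alpha]-th power of the [L^alpha] norm of [f], as an iterated integral. *)
Definition alpha_mass : \bar R :=
  (\int[nu]_v \int[zeta R d]_u (`|f (v, u)| `^ alpha)%:E)%E.

Lemma measurable_Lfun : measurable_fun [set: W * Zd d] f.
Proof. by move: hf => /sub_Lfun_mfun /set_mem. Qed.

Lemma measurable_alpha_density :
  measurable_fun [set: W * Zd d] (fun z => (`|f z| `^ alpha)%:E).
Proof.
apply/measurable_EFinP; apply: (measurableT_comp (measurable_powR _)) => //.
by apply: measurableT_comp => //; exact: measurable_Lfun.
Qed.

Lemma alpha_mass_lty : (alpha_mass < +oo)%E.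
Proof.
move: hf => /sub_Lfun_finLfun /set_mem.
rewrite /finite_norm unlock /Lnorm => /lty_poweRy.
rewrite invr_neq0 ?gt_eqF// => /(_ isT).
rewrite (fubini_tonelli1 (fun z => (`|f z| `^ alpha)%:E))//.
exact: measurable_alpha_density.
Qed.

Lemma alpha_mass_ge0 : (0 <= alpha_mass)%E.
Proof. by apply: integral_ge0 => v _; apply: integral_ge0 => u _; rewrite lee_fin powR_ge0. Qed.

Definition jump (t : Zd d) (z : (\bar R * W) * Zd d) : \bar R :=
  (z.1.1 * (f (z.1.2, z.2 - t))%:E)%E.

Lemma measurable_shift (t : Zd d) :
  measurable_fun [set: W * Zd d] (fun z : W * Zd d => f (z.1, z.2 - t)).
Proof.
apply: measurableT_comp; first exact: measurable_Lfun.
apply: measurable_fun_pair => //=.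
have mS : measurable_fun [set: Zd d] (fun u : Zd d => (u : Zd d) - t).
  exact: measurable_fun_Zd.
exact: (measurableT_comp mS).
Qed.

Lemma measurable_jump t : measurable_fun setT (jump t).
Proof.
apply: emeasurable_funM.
  by apply: measurableT_comp => //.
apply/measurable_EFinP.
have mP : measurable_fun [set: (\bar R * W) * Zd d]
    (fun z : (\bar R * W) * Zd d => (z.1.2, z.2)).
  by apply: measurable_fun_pair => //; apply: measurableT_comp.
exact: (measurableT_comp (measurable_shift t) mP).
Qed.

(** The right side is free of [t] by translation invariance of [zeta], and free of [b] because
    [nu_alpha_gt] sees only the modulus of the factor. *)
Lemma intensity_jump_tail (b : bool) t (x : R) : 0 < x ->
  M [set z | (x%:E < if b then jump t z else - jump t z)%E] =
    (fine alpha_mass * x `^ (- alpha))%:E.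
Proof.
move=> x0; rewrite intensityE; last first.
  rewrite -[X in measurable X]setTI; apply: emeasurable_fun_o_infty => //.
  by case: b; [|apply: measurableT_comp => //]; exact: measurable_jump.
transitivity (\int[nu]_v \int[zeta R d]_u
    ((x `^ (- alpha))%:E * (`|f (v, (u : Zd d) - t)| `^ alpha)%:E))%E.
  apply: eq_integral => v _; apply: eq_integral => u _; rewrite -EFinM.
  pose r := if b then f (v, (u : Zd d) - t) else - f (v, (u : Zd d) - t).
  have -> : `|f (v, (u : Zd d) - t)| = `|r|.
    by rewrite /r; case: (b); rewrite ?normrN.
  rewrite -(nu_alpha_gt hna)//; congr (nu_alpha _).
  by rewrite /r; case: (b) => //; apply/seteqP; split=> j /=; rewrite EFinN muleN.
transitivity (\int[nu]_v ((x `^ (- alpha))%:E *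
    \int[zeta R d]_u (`|f (v, u)| `^ alpha)%:E))%E.
  apply: eq_integral => v _; rewrite ge0_integralZl; last 4 first.
  - exact: measurableT.
  - exact: measurable_fun_Zd.
  - by move=> u _; rewrite lee_fin powR_ge0.
  - by rewrite lee_fin powR_ge0.
  congr (_ * _)%E.
  by rewrite (integral_zeta_shift t (phi := fun u => (`|f (v, u)| `^ alpha)%:E))// => u;
    rewrite lee_fin powR_ge0.
rewrite ge0_integralZl//; last 3 first.
- exact: (measurable_fun_fubini_tonelli_F _ measurable_alpha_density).
- by move=> v _; apply: integral_ge0 => u _; rewrite lee_fin powR_ge0.
- by rewrite lee_fin powR_ge0.
rewrite -/alpha_mass muleC EFinM fineK// ge0_fin_numE ?alpha_mass_lty//.
exact: alpha_mass_ge0.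
Qed.

End Intensity.

(** * Order statistics over cubes *)

Section Cubes.
Context {d : nat}.
Implicit Types (N K : nat) (t u : Zd d).

Definition cube N : set (Zd d) := box (- (ones d *+ N)) (ones d *+ N).

Lemma cubeP N t : cube N t <-> forall k, `|t ord0 k| <= N%:Z.
Proof.
have e k : (ones d *+ N) ord0 k = N%:Z.
  by rewrite mulmxnE mxE -natz.
by split=> h k; have := h k; rewrite !mxE e ler_norml.
Qed.

Lemma cube_le N K : (N <= K)%N -> cube N `<=` cube K.
Proof.
move=> NK t /cubeP h; apply/cubeP => k; apply: le_trans (h k) _.
by rewrite lez_nat.
Qed.

Lemma cubeN N t : cube N t -> cube N (- t).
Proof. by move=> /cubeP h; apply/cubeP => k; rewrite mxE normrN. Qed.

Lemma cubeD N K t u : cube N t -> cube K u -> cube (N + K) (t + u).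
Proof.
move=> /cubeP h /cubeP h'; apply/cubeP => k; rewrite mxE PoszD.
by rewrite (le_trans (ler_normD _ _))// lerD.
Qed.

Lemma cubeB N K t u : cube N t -> cube K u -> cube (N + K) (t - u).
Proof. by move=> h /cubeN; exact: cubeD. Qed.

Lemma seq_in_cube (s : seq (Zd d)) : exists N, forall t, t \in s -> cube N t.
Proof.
elim: s => [|a s [N hN]]; first by exists 0%N.
exists (maxn N (\max_k `|a ord0 k|%N)) => t; rewrite inE => /orP[/eqP ->|ts].
  apply/cubeP => k; rewrite -abszE lez_nat leq_max.
  by rewrite (leq_bigmax (F := fun k => `|a ord0 k|%N))// orbT.
by apply: cube_le (hN _ ts); exact: leq_maxl.
Qed.

Lemma finite_cube N : finite_set (cube N).
Proof. exact: finite_box. Qed.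

Lemma card_cube N : #|` fset_set (cube N)| = ((2 * N + 1) ^ d)%N.
Proof.
pose h (s : {ffun 'I_d -> 'I_(2 * N + 1)}) : Zd d :=
  \row_k ((s k : nat)%:Z - N%:Z).
have inj_h : injective h.
  move=> s s' /matrixP e; apply/ffunP => k; apply/val_inj/eqP => /=.
  by have := e ord0 k; rewrite !mxE => /addIr [->].
have -> : cube N = h @` [set: {ffun 'I_d -> 'I_(2 * N + 1)}].
  apply/seteqP; split=> t.
    move=> /cubeP tN.
    have hk k : (absz (t ord0 k + N%:Z)%R < 2 * N + 1)%N.
      by have := tN k; rewrite ler_norml; lia.
    exists [ffun k => Ordinal (hk k)] => //; apply/matrixP => i k.
    rewrite !mxE ffunE/= (ord1 i) gez0_abs ?addrK//.
    by have := tN k; rewrite ler_norml; lia.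
  move=> [s _ <-]; apply/cubeP => k; rewrite mxE ler_norml.
  by have := ltn_ord (s k); lia.
rewrite fset_set_image; last exact: finite_finset.
rewrite card_imfset// -[LHS]/(size (enum_fset (fset_set [set: {ffun 'I_d -> 'I_(2 * N + 1)}]))).
transitivity #|{ffun 'I_d -> 'I_(2 * N + 1)}|; last by rewrite card_ffun !card_ord.
rewrite cardE; apply: perm_size; apply: uniq_perm; rewrite ?enum_uniq//.
move=> s; rewrite mem_enum.
rewrite -[LHS]/(s \in fset_set [set: {ffun 'I_d -> 'I_(2 * N + 1)}]).
rewrite in_fset_set; last exact: finite_finset.
by rewrite inE; apply/mem_set.
Qed.

Lemma zeta_cube (R : realType) N :
  zeta R d (cube N) = ((2 * N + 1) ^ d)%N%:R%:E.
Proof. by rewrite zeta_finite ?card_cube//; exact: finite_cube. Qed.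

End Cubes.

Section RankedSets.
Context {T : eqType} {m : nat}.
Implicit Types (Q : 'I_m -> T -> Prop).

(* With [Q k t] the event that [t] exceeds the [k]-th level, this compares the
   first [m] order statistics with the [m] levels without sorting. *)
Definition ranked Q : Prop := forall k : 'I_m, exists s : seq T,
  [/\ uniq s, size s = k.+1 & forall t, t \in s -> Q k t].

Lemma ranked_sub Q Q' : (forall k t, Q k t -> Q' k t) -> ranked Q -> ranked Q'.
Proof.
by move=> QQ' h k; have [s [us ss hs]] := h k; exists s; split=> // t /hs /QQ'.
Qed.

(** Meant for the reflection [t |-> u - t], which carries the profile of a jump at [u] to the
    support of [f (v, .)] and back. *)
Lemma ranked_inj Q (sg : T -> T) : injective sg ->
  ranked (fun k t => Q k (sg t)) -> ranked Q.
Proof.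
move=> isg h k; have [s [us ss hs]] := h k; exists (map sg s).
split; [by rewrite map_inj_uniq|by rewrite size_map|].
by move=> _ /mapP[t /hs + ->].
Qed.

Lemma ranked_ex Q (k : 'I_m) : ranked Q -> exists t, Q k t.
Proof.
move=> /(_ k) [[|t s] [_ //= _ hs]]; exists t; apply: hs; exact: mem_head.
Qed.

End RankedSets.

Section OrderStat.
Context {R : realType} {d : nat} (hd : (0 < d)%N).
Implicit Types (g h : Zd d -> R) (c : R).

Lemma order_stat_gt (T : eqType) (g : T -> R) i c :
  (c%:E < order_stat g i)%E <->
  exists s : seq T, [/\ uniq s, size s = i & forall t, t \in s -> c < g t].
Proof.
split=> [/ereal_sup_gt[_ [y [s [us ss hs] <-]]]|[s [us ss hs]]].
  rewrite lte_fin => cy; exists s; split=> // t ts.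
  exact: lt_le_trans (hs _ ts).
have [y cy hy] : exists2 y, c < y & forall t, t \in s -> y <= g t.
  elim: s {us ss} hs => [|a s ih] hs; first by exists (c + 1); rewrite ?ltrDl.
  have [y cy hy] := ih (fun t ts => hs t (mem_behead (s := a :: s) ts)).
  exists (Num.min y (g a)); first by rewrite lt_min cy hs// mem_head.
  move=> t; rewrite inE ge_min => /orP[/eqP ->|/hy ->//].
  by rewrite lexx orbT.
apply: (@lt_le_trans _ _ y%:E); first by rewrite lte_fin.
by apply: ereal_sup_ubound; exists y => //; exists s.
Qed.

(** Level 0 has to be reached at [i] distinct points; since [d > 0], the multiples of [ones d]
    supply them. *)
Lemma order_stat_ge0 g i : (forall t, 0 <= g t) -> (0 <= order_stat g i)%E.
Proof.
move=> g0; apply: ereal_sup_ubound; exists 0 => //.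
exists [seq ones d *+ k | k <- iota 0 i]; split; last by move=> *; exact: g0.
  rewrite map_inj_uniq ?iota_uniq// => a b /matrixP /(_ ord0 (Ordinal hd)).
  by rewrite !mulmxnE !mxE => /eqP; rewrite eqr_nat => /eqP.
by rewrite size_map size_iota.
Qed.

Lemma order_stat1 (T : eqType) (g : T -> R) :
  order_stat g 1 = ereal_sup [set (g t)%:E | t in [set: T]].
Proof.
apply/eqP; rewrite eq_le; apply/andP; split; apply: ge_ereal_sup.
  move=> _ [y [s [_ ss hs]] <-]; case: s ss hs => [|t [|]]//= _ hs.
  apply: (@le_trans _ _ (g t)%:E); first by rewrite lee_fin hs// mem_head.
  by apply: ereal_sup_ubound; exists t.
move=> _ [t _ <-]; apply: ereal_sup_ubound; exists (g t) => //.
by exists [:: t]; split=> // u; rewrite inE => /eqP ->.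
Qed.

Context (a : R) (a0 : 0 < a) {m : nat} (m0 : (0 < m)%N) (y : 'I_m -> R)
  (y0 : forall k, 0 < y k).

Lemma poweR_gtP c (e : \bar R) : 0 <= c -> (0 <= e)%E ->
  (c%:E < e `^ a)%E = ((c `^ a^-1)%:E < e)%E.
Proof.
move=> c0; case: e => [r| |]//=; last by rewrite gt_eqF// !ltry.
rewrite lee_fin !lte_fin => r0; apply/idP/idP => [|h].
  move=> /(gt0_ltr_powR (_ : 0 < a^-1)); rewrite invr_gt0 => /(_ a0).
  by rewrite !nnegrE powR_ge0 => /(_ c0 isT); rewrite -powRrM divff ?gt_eqF// powRr1.
rewrite -[ltLHS](powRr1 c0) -(mulVf (lt0r_neq0 a0)) powRrM.
by apply: gt0_ltr_powR; rewrite ?nnegrE ?powR_ge0.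
Qed.

(** The integrand of the limit, for one sign of [f]. *)
Definition rank_functional h : \bar R :=
  \big[Order.min/+oo%E]_(k < m) ((order_stat h k.+1 * ((y k)^-1)%:E) `^ a)%E.

(** Monotonicity, measurability and approximation by finite parts of the lattice are all read off
    from this description of the superlevel sets. *)
Lemma rank_functional_gt h c : (forall t, 0 <= h t) -> 0 <= c ->
  (c%:E < rank_functional h)%E <-> ranked (fun k t => c `^ a^-1 * y k < h t).
Proof.
move=> h0 c0.
have eqv (k : 'I_m) : (c%:E < (order_stat h k.+1 * ((y k)^-1)%:E) `^ a)%E <->
    ((c `^ a^-1 * y k)%:E < order_stat h k.+1)%E.
  rewrite poweR_gtP//; last by rewrite mule_ge0 ?order_stat_ge0// lee_fin invr_ge0 ltW.
  by rewrite lte_pdivlMr// EFinM.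
split=> [/bigmin_gtP[_ hk] k|hk].
  by apply/order_stat_gt/eqv; exact: hk.
by apply/bigmin_gtP; split=> [|k _]; [exact: ltry|apply/eqv/order_stat_gt/hk].
Qed.

Lemma rank_functional_ge0 h : (0 <= rank_functional h)%E.
Proof. by apply: le_bigmin => [|k _]; [exact: leey|exact: poweR_ge0]. Qed.

Lemma le_of_lt_reals (e e' : \bar R) : (0 <= e')%E ->
  (forall c, 0 <= c -> (c%:E < e)%E -> (c%:E < e')%E) -> (e <= e')%E.
Proof.
case: e' => [r| |]; [|by move=> _ _; rewrite leey|by rewrite leeNy_eq].
by rewrite lee_fin => r0 h; rewrite leNgt; apply/negP => /(h _ r0); rewrite ltxx.
Qed.

Lemma rank_functional_le h h' : (forall t, 0 <= h t) ->
  (forall t, h t <= h' t) -> (rank_functional h <= rank_functional h')%E.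
Proof.
move=> h0 hh'; apply: le_of_lt_reals; first exact: rank_functional_ge0.
move=> c c0 /(rank_functional_gt h0 c0) hk; apply/rank_functional_gt => //.
  by move=> t; apply: le_trans (hh' t).
by apply: ranked_sub hk => k t; move=> /lt_le_trans; exact.
Qed.

(** Finitely many points witness the inequality, and one cube contains them all. *)
Lemma rank_functional_cube h c : (forall t, 0 <= h t) -> 0 <= c ->
  (c%:E < rank_functional h)%E -> exists K,
  (c%:E < rank_functional (fun t => (h t * \1_(cube K) t)%R))%E.
Proof.
move=> h0 c0 /rank_functional_gt hk.
have {}hk := hk h0 c0.
have [s hs] := choice hk.
have [K hK] := seq_in_cube (flatten [seq s k | k <- enum 'I_m]).
exists K; apply/rank_functional_gt => //.
  by move=> t; rewrite mulr_ge0.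
move=> k; exists (s k); have [us ss hst] := hs k; split=> // t ts.
rewrite indicE mem_set ?mulr1 ?hst//; apply: hK.
by apply/flattenP; exists (s k) => //; rewrite map_f// mem_enum.
Qed.

(** Any [m] levels include the first one, which some single point must exceed. This is the source of
    every domination by sums of [a]-th powers below. *)
Lemma rank_functional_le_bound h (B : \bar R) : (forall t, 0 <= h t) ->
  (forall t, ((y (Ordinal m0))^-1 `^ a * h t `^ a)%:E <= B)%E ->
  (rank_functional h <= B)%E.
Proof.
move=> h0 hB; apply: le_of_lt_reals.
  by apply: le_trans (hB 0); rewrite lee_fin mulr_ge0// powR_ge0.
move=> c c0 /rank_functional_gt hk.
have [t ht] := ranked_ex (Ordinal m0) (hk h0 c0).
apply: lt_le_trans (hB t).
rewrite lte_fin -powRM ?invr_ge0 ?(ltW (y0 _))//.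
rewrite -[ltLHS](powRr1 c0) -(mulVf (lt0r_neq0 a0)) powRrM.
apply: gt0_ltr_powR; rewrite ?nnegrE ?powR_ge0 ?mulr_ge0 ?invr_ge0 ?(ltW (y0 _))//.
by rewrite mulrC ltr_pdivlMr.
Qed.

Context (nu_alpha : {measure set (\bar R) -> \bar R})
  (hna : is_nu_alpha a nu_alpha).

(** Write the rank functional as [r ^ a]. The factors [c >= 0] for which the levels [c * y k] are
    exceeded are those with [c < r], so by scaling the event is [x < j * r], up to the sign of
    [j]. *)
Lemma nu_alpha_ranked h (b : bool) (x : R) : (forall t, 0 <= h t) ->
  (rank_functional h < +oo)%E -> 0 < x ->
  (nu_alpha [set j | ranked (fun k t =>
    (x * y k)%:E < (if b then j else - j) * (h t)%:E)] =
  (x `^ (- a))%:E * rank_functional h)%E.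
Proof.
move=> h0 hoo x0.
have G0 := rank_functional_ge0 h.
have [r r0 Gr] : exists2 r, 0 <= r & rank_functional h = (r `^ a)%:E.
  exists (fine (rank_functional h) `^ a^-1); first exact: powR_ge0.
  by rewrite -powRrM mulVf ?gt_eqF// powRr1 ?fine_ge0// fineK// ge0_fin_numE.
have rP c : 0 <= c -> (c < r) <-> ranked (fun k t => c * y k < h t).
  move=> c0; rewrite -{2}(powRr1 c0) -(mulfV (lt0r_neq0 a0)) powRrM.
  rewrite -rank_functional_gt ?powR_ge0// Gr lte_fin.
  split=> [cr|]; first by apply: gt0_ltr_powR.
  move=> /(gt0_ltr_powR (_ : 0 < a^-1)); rewrite invr_gt0 => /(_ a0).
  rewrite !nnegrE !powR_ge0 => /(_ isT isT).
  by rewrite -!powRrM divff ?gt_eqF// !powRr1.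
transitivity (nu_alpha [set j | (x%:E < (if b then j else - j) * r%:E)%E]); last first.
  transitivity (nu_alpha [set j | (x%:E < j * (if b then r else - r)%:E)%E]).
    congr (nu_alpha _); case: b => //; apply/seteqP; split=> j /=;
      by rewrite EFinN muleN mulNe.
  rewrite (nu_alpha_gt hna)// Gr -EFinM.
  by case: b; rewrite ?normrN ger0_norm.
congr (nu_alpha _); apply/seteqP; split=> j /=; move: (if b then j else - j)%E => {}j.
  case: j => [j| |] /=.
  - move=> hk; have [t] := ranked_ex (Ordinal m0) hk.
    rewrite -EFinM lte_fin => ht.
    have j0 : 0 < j.
      rewrite ltNge; apply/negP => j0; have := mulr_le0_ge0 j0 (h0 t).
      by rewrite leNgt (lt_trans _ ht)// mulr_gt0.
    rewrite -EFinM lte_fin mulrC -ltr_pdivrMr//; apply/rP.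
      by rewrite divr_ge0 ?ltW.
    apply: ranked_sub hk => k u; rewrite -EFinM lte_fin mulrAC ltr_pdivrMr//.
    by rewrite [h u * _]mulrC.
  (* An infinite jump lifts every positive value of [h] above all levels, which is the case [c = 0]
     of [rP]. *)
  - move=> hk; rewrite gt0_mulye ?ltry// lte_fin; apply/rP => //.
    apply: ranked_sub hk => k u; rewrite mul0r.
    by have := h0 u; rewrite le_eqVlt => /orP[/eqP <-|//]; rewrite mule0 lte_fin ltNge mulr_ge0 ?ltW.
  - move=> hk; have [t] := ranked_ex (Ordinal m0) hk.
    have := h0 t; rewrite le_eqVlt => /orP[/eqP <-|ht].
      by rewrite mule0 lte_fin ltNge mulr_ge0 ?ltW.
    by rewrite gt0_mulNye.
case: j => [j| |] /=.
- rewrite -EFinM lte_fin => hr.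
  have j0 : 0 < j.
    rewrite ltNge; apply/negP => j0; have := mulr_le0_ge0 j0 r0.
    by rewrite leNgt (lt_trans _ hr).
  move: hr; rewrite mulrC -ltr_pdivrMr// => /rP.
  have xj : 0 <= x / j by rewrite divr_ge0 ?ltW.
  move=> /(_ xj); apply: ranked_sub => k u.
  by rewrite -EFinM lte_fin mulrAC ltr_pdivrMr// [h u * _]mulrC.
- have := r0; rewrite le_eqVlt => /orP[/eqP <-|r1 _].
    by rewrite mule0 lte_fin ltNge ltW.
  have := (rP 0 (lexx 0)).1 r1; apply: ranked_sub => k u.
  by rewrite mul0r => hu; rewrite gt0_mulye ?ltry.
- have := r0; rewrite le_eqVlt => /orP[/eqP <-|r1].
    by rewrite mule0 lte_fin ltNge ltW.
  by rewrite gt0_mulNye.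
Qed.

End OrderStat.

Section Cvg.
Context {R : realType}.

(** The constant [c] is the boundary correction to the side of a cube; it does not affect the
    limiting volume. *)
Lemma cvg_pow_add (n0 : nat -> nat) (lambda : R) (d : nat) (c : R) :
  (n0 n)%:R / n%:R @[n --> \oo] --> lambda ->
  ((2 * (n0 n)%:R + c) ^+ d / n%:R ^+ d) @[n --> \oo] --> (2 * lambda) ^+ d.
Proof.
move=> hn.
have inv0 : (n%:R^-1 : R) @[n --> \oo] --> (0 : R).
  by rewrite -(cvg_shiftS (fun n => n%:R^-1 : R)); exact: cvg_harmonic.
under eq_fun do rewrite -exprVn -exprMn mulrDl.
apply: (@continuous_cvg _ _ _ _ _ _ (fun x : R => x ^+ d)); first exact: exprn_continuous.
rewrite -[X in _ --> X]addr0; apply: cvgD.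
  under eq_fun do rewrite -mulrA; exact: cvgMr.
by rewrite -[X in _ --> X](mulr0 c); apply: cvgMr.
Qed.

End Cvg.

Section MeasurableRanked.
Context {R : realType} {d : nat} {dZ : measure_display} {Z : measurableType dZ}
  {m : nat}.

(** There are only countably many finite sequences of lattice points to quantify over. *)
Lemma measurable_ranked (Q : 'I_m -> Zd d -> Z -> Prop) :
  (forall k t, measurable [set z | Q k t z]) ->
  measurable [set z | ranked (fun k t => Q k t z)].
Proof.
move=> mQ.
pose F (k : 'I_m) (s : seq (Zd d)) : set Z :=
  if uniq s && (size s == k.+1) then [set z | forall t, t \in s -> Q k t z]
  else set0.
rewrite (_ : mkset _ = \bigcap_(k in [set: 'I_m]) \bigcup_s F k s).
  apply: fin_bigcap_measurable; first exact: finite_finset.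
  move=> k _; apply: countable_bigcupT_measurable; first exact: countableP.
  move=> s; rewrite /F; case: ifP => // _; elim: s => [|a s ih].
    by rewrite (_ : mkset _ = setT)//; apply/seteqP; split.
  rewrite (_ : mkset _ = [set z | Q k a z] `&`
      [set z | forall t, t \in s -> Q k t z]); first exact: measurableI.
  apply/seteqP; split=> z /=.
    move=> h; split; first by apply: h; exact: mem_head.
    by move=> t ts; apply: h; rewrite inE ts orbT.
  by move=> [ha hs] t; rewrite inE => /orP[/eqP ->|/hs].
apply/seteqP; split=> z /= hz k.
  move=> _; have [s [us ss hs]] := hz k; exists s => //.
  by rewrite /F us ss eqxx.
have [s _] := hz k I; rewrite /F; case: ifP => // /andP[us /eqP ss] hs.
by exists s.
Qed.

Lemma measurable_rank_functional (hd : (0 < d)%N) (a : R) (a0 : 0 < a)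
    (y : 'I_m -> R) (y0 : forall k, 0 < y k) (H : Zd d -> Z -> R) :
  (forall t, measurable_fun [set: Z] (H t)) -> (forall t z, 0 <= H t z) ->
  measurable_fun [set: Z] (fun z => rank_functional a y (fun t => H t z)).
Proof.
move=> mH H0; apply: (measurability _ (ErealGenOInfty.measurableE R)) => //.
move=> _ [_ [c ->] <-]; rewrite setTI.
have [c0|c0] := leP 0 c.
  rewrite (_ : _ @^-1` _ =
      [set z | ranked (fun k t => c `^ a^-1 * y k < H t z)]).
    apply: measurable_ranked => k t.
    rewrite -[X in measurable X]setTI (_ : [set z | _] =
      H t @^-1` `]c `^ a^-1 * y k, +oo[); first exact: mH.
    by apply/seteqP; split=> z /=; rewrite in_itv/= andbT.
  by apply/seteqP; split=> z /=; rewrite in_itv/= andbT => /rank_functional_gt; exact.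
rewrite (_ : _ @^-1` _ = setT)//; apply/seteqP; split=> z //= _.
rewrite in_itv/= andbT (lt_le_trans _ (rank_functional_ge0 _ _ _))//.
Qed.

End MeasurableRanked.

Lemma le_integral_zeta (R : realType) (d : nat) (phi psi : Zd d -> \bar R) :
  (forall u, 0 <= phi u)%E -> (forall u, phi u <= psi u)%E ->
  (\int[zeta R d]_u phi u <= \int[zeta R d]_u psi u)%E.
Proof.
move=> phi0 phipsi; apply: ge0_le_integral => //; exact: measurable_fun_Zd.
Qed.

(** The bounding sequences may depend on [e], and their limits need only come within [e] of [l]:
    auxiliary parameters are fixed while [n] grows and sent to their limits afterwards. *)
Lemma cvg_sandwich {R : realType} (s : nat -> R) (l : R) :
  (forall e, 0 < e -> exists u b, [/\ u n @[n --> \oo] --> b, b <= l + e &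
    \forall n \near \oo, s n <= u n]) ->
  (forall e, 0 < e -> exists u b, [/\ u n @[n --> \oo] --> b, l - e <= b &
    \forall n \near \oo, u n <= s n]) ->
  s n @[n --> \oo] --> l.
Proof.
move=> up lo; apply/cvgrPdist_le => e e0.
have e20 : 0 < e / 2 by rewrite divr_gt0.
have [u [b [hu bl su]]] := up _ e20; have [v [c [hv cl sv]]] := lo _ e20.
have hu' : \forall n \near \oo, u n < b + e / 2.
  by apply: (cvgr_lt _ hu); rewrite ltrDl.
have hv' : \forall n \near \oo, c - e / 2 < v n.
  by apply: (cvgr_gt _ hv); rewrite gtrBl.
near=> n; rewrite ler_norml.
have h1 : s n <= u n by near: n.
have h2 : v n <= s n by near: n.
have h3 : u n < b + e / 2 by near: n.
have h4 : c - e / 2 < v n by near: n.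
by apply/andP; split; lra.
Unshelve. all: by end_near. Qed.

Lemma sume_cst {R : realType} (T : Type) (s : seq T) (c : \bar R) :
  (0 <= c)%E -> (\sum_(r <- s) c = (size s)%:R%:E * c)%E.
Proof.
move=> c0; elim: s => [|x s ih]; first by rewrite big_nil mul0e.
by rewrite big_cons ih /= -natr1 EFinD ge0_muleDl ?lee_fin// mul1e addeC.
Qed.

(** * Sums over the locations of a jump *)

Section WindowSum.
Context {R : realType} {d : nat} (hd : (0 < d)%N) (a : R) (a0 : 0 < a)
  {m : nat} (m0 : (0 < m)%N) (y : 'I_m -> R) (y0 : forall k, 0 < y k).
Implicit Types (h : Zd d -> R) (N K : nat).

Local Notation G := (rank_functional a y).
Local Notation y1 := (y (Ordinal m0)).

(* The jump profile [t |-> h (u - t)] on [cube N], reindexed to live on the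
   support of [h]. *)
Definition window N (u : Zd d) h (t : Zd d) : R := h t * \1_(cube N) (u - t).

Definition window_sum N h : \bar R := (\int[zeta R d]_u G (window N u h))%E.

Definition power_density h t : R := y1^-1 `^ a * h t `^ a.

Lemma window_ge0 N u h : (forall t, 0 <= h t) -> forall t, 0 <= window N u h t.
Proof. by move=> h0 t; rewrite mulr_ge0. Qed.

Lemma power_density_ge0 h t : 0 <= power_density h t.
Proof. by rewrite mulr_ge0// powR_ge0. Qed.

Lemma window_le N u h : (forall t, 0 <= h t) -> forall t, window N u h t <= h t.
Proof.
move=> h0 t; rewrite /window indicE; case: (_ \in _); rewrite ?mulr1//.
by rewrite mulr0.
Qed.

(** A supremum over the window is at most the sum over it. [D] records which part of the lattice is
    seen: the complement of a cube when only the tail is to be charged, everything for the crude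
    bound. *)
Lemma rank_functional_window_le N u h (D : set (Zd d)) :
  (forall t, 0 <= h t) -> (forall t, cube N (u - t) -> D t) ->
  (G (window N u h) <= \sum_(r <- fset_set (cube N))
      (power_density h (u - r) * \1_D (u - r))%:E)%E.
Proof.
move=> h0 hD.
apply: (@rank_functional_le_bound _ _ hd a a0 m m0 y y0); first exact: window_ge0.
have T0 r : 0 <= power_density h (u - r) * \1_D (u - r).
  by rewrite mulr_ge0// power_density_ge0.
move=> t; rewrite /window indicE sumEFin lee_fin.
have [ut|ut] := boolP (_ \in _); last first.
  by rewrite mulr0 powR0 ?gt_eqF// mulr0 sumr_ge0.
rewrite mulr1.
have utN : u - t \in fset_set (cube N).
  by rewrite in_fset_set//; exact: finite_cube.
rewrite (big_fsetD1 (u - t))//= opprB subrKC.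
have -> : \1_D t = 1 :> R.
  by rewrite indicE mem_set//; apply: hD; move: ut; rewrite inE.
by rewrite mulr1 lerDl sumr_ge0.
Qed.

Lemma integral_zeta_cube_sum N (phi : Zd d -> R) : (forall t, 0 <= phi t) ->
  (\int[zeta R d]_u \sum_(r <- fset_set (cube N)) (phi (u - r)%R)%:E =
    ((2 * N%:R + 1) ^+ d)%:E * \int[zeta R d]_t (phi t)%:E)%E.
Proof.
move=> phi0; rewrite ge0_integral_sum; [|by []
  |by move=> r; exact: measurable_fun_Zd|by move=> r u _; rewrite lee_fin].
under eq_bigr => r _ do
  rewrite (integral_zeta_shift r (phi := fun t => (phi t)%:E))//.
rewrite sume_cst; last by apply: integral_ge0 => t _; rewrite lee_fin.
have -> : size (fset_set (cube (d := d) N)) = ((2 * N + 1) ^ d)%N := card_cube N.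
by rewrite natrX natrD natrM.
Qed.

(* A location [u] outside [cube (N + K)] sees [h] only outside [cube K]. *)
Lemma rank_functional_window_le_sum N K u h : (forall t, 0 <= h t) ->
  (G (window N u h) <= G h * (\1_(cube (N + K)) u)%:E +
    \sum_(r <- fset_set (cube N))
      (power_density h (u - r) * \1_(~` cube K) (u - r))%:E)%E.
Proof.
move=> h0; have S0 : (0 <= \sum_(r <- fset_set (cube (d := d) N))
    (power_density h (u - r) * \1_(~` cube K) (u - r))%:E)%E.
  by apply: sume_ge0 => r _; rewrite lee_fin mulr_ge0// power_density_ge0.
have [uNK|uNK] := pselect (cube (N + K) u).
  rewrite indicE mem_set// mule1 (le_trans _ (leeDl _ S0))//.
  by apply: rank_functional_le => //; [exact: window_ge0|exact: window_le].
rewrite [X in (_ * X%:E)%E]indicE memNset// mule0 add0e.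
apply: rank_functional_window_le => // t ut tK; apply: uNK.
by rewrite -(subrK t u); exact: cubeD.
Qed.

Definition power_tail K h : \bar R :=
  (\int[zeta R d]_t (power_density h t * \1_(~` cube K) t)%:E)%E.

Lemma window_sum_le N K h : (forall t, 0 <= h t) ->
  (window_sum N h <= G h * ((2 * N%:R + (2 * K%:R + 1)) ^+ d)%:E +
    ((2 * N%:R + 1) ^+ d)%:E * power_tail K h)%E.
Proof.
move=> h0; have G0 := rank_functional_ge0 a y h.
apply: (@le_trans _ _ (\int[zeta R d]_u (G h * (\1_(cube (N + K)) u)%:E +
    \sum_(r <- fset_set (cube (d := d) N))
      (power_density h ((u : Zd d) - r)%R * \1_(~` cube K) ((u : Zd d) - r)%R)%:E))%E).
  apply: le_integral_zeta => u; first exact: rank_functional_ge0.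
  exact: rank_functional_window_le_sum.
have T0 t : (0 <= (power_density h t * \1_(~` cube K) t)%:E)%E.
  by rewrite lee_fin mulr_ge0// power_density_ge0.
rewrite ge0_integralD; [|by []|by move=> u _; rewrite mule_ge0// lee_fin
  |exact: measurable_fun_Zd|by move=> u _; apply: sume_ge0 => r _; exact: T0
  |exact: measurable_fun_Zd].
apply: leeD.
  rewrite ge0_integralZl; [|by []|exact: measurable_fun_Zd
    |by move=> u _; rewrite lee_fin|by []].
  rewrite integral_indic// setIT -[X in (_ * X <= _)%E]/(zeta R d (cube (N + K))).
  rewrite zeta_cube lee_pmul// lee_fin ?ler0n//.
  rewrite natrX natrD natrM natrD le_eqVlt; apply/orP; left; apply/eqP.
  by congr (_ ^+ _); ring.
rewrite (integral_zeta_cube_sum N (phi := fun t =>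
  power_density h t * \1_(~` cube K) t)).
  exact: lexx.
by move=> t; rewrite mulr_ge0// power_density_ge0.
Qed.

(** Each location in [cube (N - K)] sees all of [h] on [cube K]. *)
Lemma window_sum_ge N K h : (forall t, 0 <= h t) -> (K <= N)%N ->
  (rank_functional a y (fun t => h t * \1_(cube K) t)%R *
    ((2 * N%:R + (1 - 2 * K%:R)) ^+ d)%:E <= window_sum N h)%E.
Proof.
move=> h0 KN; set GK := rank_functional _ _ _.
have GK0 : (0 <= GK)%E by exact: rank_functional_ge0.
apply: (@le_trans _ _ (\int[zeta R d]_u (GK * (\1_(cube (N - K)) u)%:E))%E).
  rewrite ge0_integralZl; [|by []|exact: measurable_fun_Zd
    |by move=> u _; rewrite lee_fin|by []].
  rewrite integral_indic// setIT -[X in (_ <= _ * X)%E]/(zeta R d (cube (N - K))).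
  rewrite zeta_cube natrX natrD natrM natrB// le_eqVlt; apply/orP; left; apply/eqP.
  by congr (_ * (_ ^+ _)%:E)%E; ring.
apply: le_integral_zeta => u; first by rewrite mule_ge0// lee_fin.
rewrite indicE; have [uNK|_] := boolP (u \in _); last first.
  by rewrite mule0 rank_functional_ge0.
rewrite mule1; apply: rank_functional_le => // t; first by rewrite mulr_ge0.
rewrite /window ler_wpM2l// indicE; have [tK|_] := boolP (t \in cube K); last by [].
rewrite indicE mem_set//; move: uNK tK; rewrite !inE => /cubeB h1 /h1.
by rewrite subnK.
Qed.

Context (h : Zd d -> R) (h0 : forall t, 0 <= h t).

Definition power_sum : \bar R := (\int[zeta R d]_t (power_density h t)%:E)%E.

Context (hfin : (power_sum < +oo)%E).

Lemma power_tail_cvg : power_tail K h @[K --> \oo] --> 0%E.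
Proof.
have mZ (g : Zd d -> \bar R) : measurable_fun [set: Zd d] g.
  exact: measurable_fun_Zd.
have dc := @dominated_convergence _ _ _ (zeta R d) [set: Zd d] measurableT
  (fun K t => (power_density h t * \1_(~` cube K) t)%:E) (cst 0%E)
  (fun t => (power_density h t)%:E)
  (fun n => mZ _) (mZ _).
have [|||_ _] := dc.
- apply: aeW => t _; have [K tK] := seq_in_cube [:: t].
  apply: cvg_near_cst; near=> n; rewrite indicE memNset ?mulr0//.
  move=> /(_ _)/=; apply; apply: (@cube_le _ K); last exact/tK/mem_head.
  by near: n; exact: nbhs_infty_ge.
- apply/integrableP; split; first exact: measurable_fun_Zd.
  by under eq_integral do rewrite gee0_abs ?lee_fin ?power_density_ge0//.
- apply: aeW => t K _ /=; rewrite lee_fin ger0_norm; last first.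
    by rewrite mulr_ge0// power_density_ge0.
  by rewrite ler_piMr ?power_density_ge0.
by rewrite integral_cst// mul0e.
Unshelve. all: by end_near. Qed.

Lemma rank_functional_lty : (G h < +oo)%E.
Proof.
apply: le_lt_trans hfin; apply: (@rank_functional_le_bound _ _ hd a a0 m m0 y y0) => // t.
rewrite -/(power_density h t).
apply: (@le_trans _ _
    (\int[zeta R d]_u ((power_density h t)%:E * (\1_[set t] u)%:E))%E).
  rewrite ge0_integralZl; [|by []|exact: measurable_fun_Zd
    |by move=> u _; rewrite lee_fin|by rewrite lee_fin power_density_ge0].
  rewrite integral_indic// setIT -[X in (_ <= _ * X)%E]/(zeta R d [set t]).
  by rewrite zeta_finite// fset_set1 cardfs1 mule1.
apply: le_integral_zeta => u; rewrite -EFinM lee_fin.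
  by rewrite mulr_ge0// power_density_ge0.
rewrite indicE; case: (boolP (u \in _)) => [|_].
  by rewrite inE/= => ->; rewrite mulr1.
by rewrite mulr0 power_density_ge0.
Qed.

Lemma window_sum_bound N :
  (window_sum N h <= ((2 * N%:R + 1) ^+ d)%:E * power_sum)%E.
Proof.
rewrite -integral_zeta_cube_sum; last by move=> t; exact: power_density_ge0.
apply: le_integral_zeta => u; first exact: rank_functional_ge0.
apply: (le_trans (rank_functional_window_le (D := setT) h0 (fun _ _ => I))).
by under eq_bigr do rewrite indicT mulr1.
Qed.

Lemma window_sum_cvg (n0 : nat -> nat) (lambda : R) : 0 < lambda ->
  (n0 n)%:R / n%:R @[n --> \oo] --> lambda ->
  ((n%:R ^+ d)^-1%:E * window_sum (n0 n) h)%E @[n --> \oo] -->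
    (((2 * lambda) ^+ d)%:E * G h)%E.
Proof.
move=> l0 hn; set L := (2 * lambda) ^+ d.
have L0 : 0 < L by rewrite exprn_gt0// mulr_gt0.
have gfin : G h = (fine (G h))%:E.
  by rewrite fineK// ge0_fin_numE ?rank_functional_lty ?rank_functional_ge0.
set g := fine (G h) in gfin.
have S0 N : (0 <= window_sum N h)%E.
  by apply: integral_ge0 => u _; exact: rank_functional_ge0.
have ps0 : (0 <= power_sum)%E.
  by apply: integral_ge0 => t _; rewrite lee_fin power_density_ge0.
have Sfin N : window_sum N h = (fine (window_sum N h))%:E.
  rewrite fineK// ge0_fin_numE// (le_lt_trans (window_sum_bound N))//.
  by rewrite lte_mul_pinfty// lee_fin exprn_ge0// addr_ge0// mulr_ge0.
have n0oo K : \forall n \near \oo, (K <= n0 n)%N.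
  have hl : \forall n \near \oo, lambda / 2 < (n0 n)%:R / n%:R.
    by apply: (cvgr_gt _ hn); rewrite ltr_pdivrMr//; lra.
  near=> n.
  have n_gt0 : 0 < n%:R :> R.
    by rewrite ltr0n; near: n; exact: nbhs_infty_gt.
  have h1 : lambda / 2 * n%:R < (n0 n)%:R.
    by rewrite -ltr_pdivlMr//; near: n.
  have h2 : K%:R / (lambda / 2) < n%:R by near: n; exact: nbhs_infty_gtr.
  rewrite -(ler_nat R) ltW// (lt_trans _ h1)//.
  by rewrite mulrC -ltr_pdivrMr// divr_gt0.
rewrite gfin -EFinM.
have -> : (fun n => (n%:R ^+ d)^-1%:E * window_sum (n0 n) h)%E =
    (fun n => ((n%:R ^+ d)^-1 * fine (window_sum (n0 n) h))%:E).
  by apply/funext => n; rewrite Sfin -EFinM.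
apply: cvg_EFin; first exact: nearW.
apply: cvg_sandwich => e e0.
- have [_ /cvgrPdist_lt tl] := (fine_cvgP _ _).1 power_tail_cvg.
  (* The tail gets multiplied by a volume ratio with limit [L], hence the tolerance [e / L]. *)
  have [K _ hK] := tl (e / L) (divr_gt0 e0 L0).
  have := hK K (leqnn K); rewrite sub0r normrN => tK.
  have t0 : (0 <= power_tail K h)%E.
    by apply: integral_ge0 => t _; rewrite lee_fin mulr_ge0// power_density_ge0.
  have tKfin : power_tail K h = (fine (power_tail K h))%:E.
    rewrite fineK// ge0_fin_numE// (le_lt_trans _ hfin)//.
    apply: le_integral_zeta => t; rewrite lee_fin.
      by rewrite mulr_ge0// power_density_ge0.
    by rewrite ler_piMr ?power_density_ge0// indicE; case: (_ \in _).
  exists (fun n => g * ((2 * (n0 n)%:R + (2 * K%:R + 1)) ^+ d / n%:R ^+ d) +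
    fine (power_tail K h) * ((2 * (n0 n)%:R + 1) ^+ d / n%:R ^+ d)).
  exists (g * L + fine (power_tail K h) * L); split.
  + by apply: cvgD; apply: cvgMr; exact: cvg_pow_add.
  + rewrite [L * g]mulrC lerD2l -ler_pdivlMr// (le_trans (ler_norm _))//.
    exact: ltW.
  + near=> n; have := window_sum_le (n0 n) K h0.
    rewrite gfin tKfin (Sfin (n0 n)) -!EFinM -EFinD lee_fin /= => hS.
    have i0 : 0 <= (n%:R ^+ d)^-1 :> R by rewrite invr_ge0 exprn_ge0.
    by apply: le_trans (ler_wpM2l i0 hS) _; rewrite le_eqVlt; apply/orP; left;
      apply/eqP; ring.
(* [rank_functional_cube] needs a non-negative level; when [g - e / L] is negative, the lower bound
   0 already suffices. *)
- have [ge|ge] := ltP (g - e / L) 0.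
    exists (fun=> 0), 0; split; first exact: cvg_cst.
      by rewrite subr_le0 mulrC -ler_pdivlMr//; lra.
    near=> n; rewrite mulr_ge0 ?invr_ge0 ?exprn_ge0// fine_ge0//.
  have [K] := rank_functional_cube hd a0 y0 h0 ge (ltac:(by rewrite gfin lte_fin gtrBl divr_gt0)).
  set GK := rank_functional _ _ _ => hGK.
  have GK0 : (0 <= GK)%E by exact: rank_functional_ge0.
  have GKfin : GK = (fine GK)%:E.
    rewrite fineK// ge0_fin_numE// (le_lt_trans _ rank_functional_lty)//.
    apply: rank_functional_le => // t; first by rewrite mulr_ge0.
    by rewrite ler_piMr// indicE; case: (_ \in _).
  exists (fun n => fine GK * ((2 * (n0 n)%:R + (1 - 2 * K%:R)) ^+ d / n%:R ^+ d)).
  exists (fine GK * L); split.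
  + by apply: cvgMr; exact: cvg_pow_add.
  + rewrite GKfin lte_fin in hGK.
    have := ler_wpM2l (ltW L0) (ltW hGK).
    by rewrite mulrBr [L * (e / L)]mulrC divfK ?gt_eqF// [leRHS]mulrC.
  + near=> n; have KN : (K <= n0 n)%N by near: n; exact: n0oo.
    have := window_sum_ge h0 KN; rewrite -/GK GKfin (Sfin (n0 n)) -EFinM lee_fin /= => hS.
    have i0 : 0 <= (n%:R ^+ d)^-1 :> R by rewrite invr_ge0 exprn_ge0.
    by apply: le_trans (ler_wpM2l i0 hS); rewrite le_eqVlt; apply/orP; left;
      apply/eqP; ring.
Unshelve. all: by end_near. Qed.

End WindowSum.

(** * Intensity of the points that exceed all levels by themselves *)

Section RankedJumps.
Context {R : realType} (alpha : R) (a0 : 0 < alpha) {d : nat} (hd : (0 < d)%N)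
  (nu_alpha : {measure set (\bar R) -> \bar R})
  (hna : is_nu_alpha alpha nu_alpha)
  (dW : measure_display) (W : measurableType dW)
  (nu : {sigma_finite_measure set W -> \bar R})
  (f : W * Zd d -> R) (hf : f \in Lfun (nu \x zeta R d)%E alpha%:E)
  {m : nat} (m0 : (0 < m)%N) (y : 'I_m -> R) (y0 : forall k, 0 < y k).

Local Notation M := ((nu_alpha \x nu) \x zeta R d)%E.
Local Notation G := (rank_functional alpha y).
Local Notation fp v := (fun t : Zd d => (f^\+)%R (v, t)).
Local Notation fn v := (fun t : Zd d => (f^\-)%R (v, t)).
Local Notation mass v := (\int[zeta R d]_u (`|f (v, u)| `^ alpha)%:E)%E.

Definition ranked_jumps N (x : R) : set ((\bar R * W) * Zd d) :=
  [set z | ranked (fun k t => cube N t /\ ((x * y k)%:E < jump f t z)%E)].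

Let fpE v t : (f^\+)%R (v, t) = Num.max (f (v, t)) 0. Proof. by []. Qed.

Let fnE v t : (f^\-)%R (v, t) = Num.max (- f (v, t)) 0. Proof. by []. Qed.

Lemma measurable_jump_gt t (x : R) : measurable [set z | (x%:E < jump f t z)%E].
Proof.
rewrite -[X in measurable X]setTI; apply: emeasurable_fun_o_infty => //.
exact: (measurable_jump hf).
Qed.

Lemma measurable_ranked_jumps N x : measurable (ranked_jumps N x).
Proof.
apply: measurable_ranked => k t; have [tN|tN] := pselect (cube N t).
  rewrite (_ : mkset _ = [set z | ((x * y k)%:E < jump f t z)%E]).
    exact: measurable_jump_gt.
  by apply/seteqP; split=> z //= [].
rewrite (_ : mkset _ = set0)//; by apply/seteqP; split=> z //= [].
Qed.

(** The levels are positive, so wherever one point exceeds them [f] has the sign of the jump [j]: a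
    positive jump uses the positive part of [f] only, a negative one the negative part. The
    reflection [t |-> u - t] gives the form of [window]. *)
Lemma ranked_jumps_section N x v u : 0 < x ->
  [set j | ranked_jumps N x ((j, v), u)] =
  [set j | ranked (fun k t => (x * y k)%:E < j * (window N u (fp v) t)%:E)%E] `|`
  [set j | ranked (fun k t => (x * y k)%:E < - j * (window N u (fn v) t)%:E)%E].
Proof.
move=> x0; have xy k : 0 < x * y k by rewrite mulr_gt0.
have sg_inj : injective (fun t : Zd d => u - t) by move=> t t' /addrI /oppr_inj.
have jpos (j : \bar R) (r : R) k : 0 <= r -> ((x * y k)%:E < j * r%:E)%E ->
    (0 < j)%E /\ 0 < r.
  move=> r0 h; have jr : (0 < j * r%:E)%E by apply: lt_trans h; rewrite lte_fin.
  have r0' : 0 < r.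
    rewrite lt_neqAle r0 andbT eq_sym; apply/eqP => re.
    by move: jr; rewrite re mule0 ltxx.
  split=> //; rewrite ltNge; apply/negP => j0.
  by move: jr; rewrite ltNge mule_le0_ge0// lee_fin.
apply/seteqP; split=> j /=; rewrite /ranked_jumps /jump/=.
  move=> hr; have [t [_ ht]] := ranked_ex (Ordinal m0) hr.
  have j0 : j != 0%E.
    by apply/eqP => j0; move: ht; rewrite j0 mul0e lte_fin ltNge ltW.
  have [jn|jp] : (j < 0)%E \/ (0 < j)%E.
    by move: j0; rewrite neq_lt => /orP[]; [left|right].
  - right; apply: (ranked_inj sg_inj); apply: ranked_sub hr => k {}t [tN {}ht].
    have fneg : f (v, u - t) < 0.
      rewrite ltNge; apply/negP => f0; move: ht.
      rewrite ltNge (le_trans (mule_le0_ge0 (ltW jn) _)) ?lee_fin// ltW//.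
    rewrite /window opprB subrKC indicE mem_set// mulr1 fnE.
    rewrite max_l; last by rewrite oppr_ge0 ltW.
    by rewrite EFinN mulNe muleN oppeK.
  - left; apply: (ranked_inj sg_inj); apply: ranked_sub hr => k {}t [tN {}ht].
    have fpos : 0 < f (v, u - t).
      rewrite ltNge; apply/negP => f0; move: ht.
      rewrite ltNge (le_trans (mule_ge0_le0 (ltW jp) _)) ?lee_fin// ltW//.
    rewrite /window opprB subrKC indicE mem_set// mulr1 fpE.
    by rewrite max_l// ltW.
case=> hr; apply: (ranked_inj sg_inj); apply: ranked_sub hr => k t.
- rewrite opprB subrKC /window indicE.
  have [ut|_] := boolP (_ \in _); last by rewrite mulr0 mule0 lte_fin ltNge ltW.
  rewrite mulr1 => ht; split; first by move: ut; rewrite inE.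
  have fp0 : 0 <= (f^\+)%R (v, t) by exact: funrpos_ge0.
  have [_] := jpos _ _ _ fp0 ht; move: ht; rewrite fpE lt_max ltxx orbF => ht ft.
  by rewrite max_l in ht => //; exact: ltW.
- rewrite opprB subrKC /window indicE.
  have [ut|_] := boolP (_ \in _); last by rewrite mulr0 mule0 lte_fin ltNge ltW.
  rewrite mulr1 => ht; split; first by move: ut; rewrite inE.
  have fn0 : 0 <= (f^\-)%R (v, t) by exact: funrneg_ge0.
  have [_] := jpos _ _ _ fn0 ht; move: ht; rewrite fnE lt_max ltxx orbF => ht ft.
  by rewrite max_l in ht; [move: ht; rewrite EFinN mulNe muleN oppeK|exact: ltW].
Qed.

Lemma rank_functional_window_lty N u (h : Zd d -> R) : (forall t, 0 <= h t) ->
  (G (window N u h) < +oo)%E.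
Proof.
move=> h0; apply: (le_lt_trans (rank_functional_window_le hd a0 m0 y0 (D := setT) h0 (fun _ _ => I))).
by rewrite sumEFin ltry.
Qed.

Lemma nu_alpha_ranked_jumps N x v u : 0 < x ->
  (nu_alpha [set j | ranked_jumps N x ((j, v), u)] = (x `^ (- alpha))%:E *
    (G (window N u (fp v)) + G (window N u (fn v))))%E.
Proof.
move=> x0; rewrite ranked_jumps_section//.
set S1 := [set j | _]; set S2 := [set j | _].
have h0 (b : bool) t : 0 <= window N u (if b then fp v else fn v) t.
  by case: b; apply: window_ge0 => s; [exact: funrpos_ge0|exact: funrneg_ge0].
have mS (b : bool) h : measurable [set j : \bar R | ranked (fun k (t : Zd d) =>
    (x * y k)%:E < (if b then j else - j) * (h t)%:E)%E].
  apply: measurable_ranked => k t; rewrite -[X in measurable X]setTI.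
  apply: emeasurable_fun_o_infty => //; apply: emeasurable_funM => //.
  by case: b => //; exact: measurableT_comp.
have -> : nu_alpha (S1 `|` S2) = (nu_alpha S1 + nu_alpha S2)%E.
  apply: measureU; [exact: (mS true)|exact: (mS false)|].
  apply/seteqP; split=> // j [/= h1 h2].
  have [t ht] := ranked_ex (Ordinal m0) h1; have [s hs] := ranked_ex (Ordinal m0) h2.
  have xy : 0 < x * y (Ordinal m0) by rewrite mulr_gt0.
  have [j0|j0] := leP j 0%E.
    move: ht; rewrite ltNge (le_trans (mule_le0_ge0 j0 _)) ?lee_fin ?(ltW xy)//.
    exact: (h0 true).
  move: hs; rewrite ltNge (le_trans (mule_le0_ge0 _ _)) ?lee_fin ?(ltW xy)//.
    by rewrite leeNl oppe0 ltW.
  exact: (h0 false).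
rewrite ge0_muleDr ?rank_functional_ge0//; congr (_ + _)%E.
- apply: (nu_alpha_ranked hd a0 m0 y0 hna true) => //; first exact: (h0 true).
  by apply: rank_functional_window_lty => t; exact: funrpos_ge0.
- apply: (nu_alpha_ranked hd a0 m0 y0 hna false) => //; first exact: (h0 false).
  by apply: rank_functional_window_lty => t; exact: funrneg_ge0.
Qed.

Let measurable_window_sum N (g : W * Zd d -> R) : measurable_fun setT g ->
  (forall z, 0 <= g z) ->
  measurable_fun [set: W]
    (fun v => window_sum alpha y N (fun t => g (v, t))).
Proof.
move=> mg g0.
apply: (measurable_fun_fubini_tonelli_F
  (fun z : W * Zd d => G (window N z.2 (fun t => g (z.1, t))))).
  apply: measurable_rank_functional => // [t|t z]; last by rewrite mulr_ge0.
  apply: measurable_funM.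
    by apply: (measurableT_comp mg); exact: measurable_fun_pair.
  have mi : measurable_fun [set: Zd d] (fun u : Zd d => \1_(cube N) (u - t) : R).
    exact: measurable_fun_Zd.
  exact: (measurableT_comp mi).
by move=> z; exact: rank_functional_ge0.
Qed.

Let mfp : measurable_fun setT (f^\+)%R.
Proof. by apply: measurable_funrpos; exact: (measurable_Lfun hf). Qed.

Let mfn : measurable_fun setT (f^\-)%R.
Proof. by apply: measurable_funrneg; exact: (measurable_Lfun hf). Qed.

Definition window_sums N v : \bar R :=
  (window_sum alpha y N (fp v) + window_sum alpha y N (fn v))%E.

Lemma measurable_window_sums N : measurable_fun [set: W] (window_sums N).
Proof.
apply: emeasurable_funD; apply: measurable_window_sum => //.
Qed.

Lemma window_sum_ge0 N (h : Zd d -> R) : (0 <= window_sum alpha y N h)%E.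
Proof. by apply: integral_ge0 => u _; exact: rank_functional_ge0. Qed.

Lemma intensity_ranked_jumps N x : 0 < x ->
  (M (ranked_jumps N x) =
    (x `^ (- alpha))%:E * \int[nu]_v window_sums N v)%E.
Proof.
move=> x0; rewrite (intensityE a0 hna _ (measurable_ranked_jumps N x)).
transitivity (\int[nu]_v ((x `^ (- alpha))%:E * window_sums N v))%E.
  apply: eq_integral => v _.
  under eq_integral do rewrite nu_alpha_ranked_jumps//.
  rewrite ge0_integralZl; [|by []|exact: measurable_fun_Zd
    |by move=> u _; rewrite adde_ge0 ?rank_functional_ge0
    |by rewrite lee_fin powR_ge0].
  by rewrite ge0_integralD; [|by []|by move=> u _; exact: rank_functional_ge0
    |exact: measurable_fun_Zd|by move=> u _; exact: rank_functional_ge0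
    |exact: measurable_fun_Zd].
rewrite ge0_integralZl//; first exact: measurable_window_sums.
  by move=> v _; rewrite adde_ge0 ?window_sum_ge0.
by rewrite lee_fin powR_ge0.
Qed.

Definition rank_density v : \bar R := (G (fp v) + G (fn v))%E.

Let C0 := (y (Ordinal m0))^-1 `^ alpha.

Let power_sum_le v (g : Zd d -> R) : (forall t, 0 <= g t <= `|f (v, t)|) ->
  (power_sum alpha m0 y g <= C0%:E * mass v)%E.
Proof.
move=> hg; rewrite -ge0_integralZl; [|by []|exact: measurable_fun_Zd
  |by move=> u _; rewrite lee_fin powR_ge0|by rewrite lee_fin powR_ge0].
apply: le_integral_zeta => t; first by rewrite lee_fin power_density_ge0.
rewrite -EFinM lee_fin ler_wpM2l ?powR_ge0//.
have /andP[g0 gf] := hg t.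
by apply: ge0_ler_powR; rewrite ?nnegrE ?(ltW a0).
Qed.

Let fp_abs v t : 0 <= (f^\+)%R (v, t) <= `|f (v, t)|.
Proof. by rewrite funrpos_ge0/= fpE ge_max normr_ge0 ler_norm. Qed.

Let fn_abs v t : 0 <= (f^\-)%R (v, t) <= `|f (v, t)|.
Proof. by rewrite funrneg_ge0/= fnE ge_max normr_ge0 -normrN ler_norm. Qed.

Lemma integrable_mass : nu.-integrable [set: W] (fun v => mass v).
Proof.
apply/integrableP; split.
  exact: (measurable_fun_fubini_tonelli_F _ (measurable_alpha_density hf)).
rewrite (eq_integral (fun v => mass v)).
  exact: (alpha_mass_lty a0 hf).
by move=> v _; rewrite gee0_abs// integral_ge0// => u _; rewrite lee_fin powR_ge0.
Qed.

(** Dominated convergence in [v]: [window_sum_cvg] gives the limit wherever the mass of [f (v, .)]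
    is finite, hence almost everywhere, and a multiple of that mass dominates. *)
Lemma intensity_ranked_jumps_cvg (n0 : nat -> nat) (lambda : R) : 0 < lambda ->
  (n0 n)%:R / n%:R @[n --> \oo] --> lambda ->
  nu.-integrable [set: W] rank_density /\
  ((n%:R ^+ d)^-1%:E * \int[nu]_v window_sums (n0 n) v)%E @[n --> \oo] -->
    (((2 * lambda) ^+ d)%:E * \int[nu]_v rank_density v)%E.
Proof.
move=> l0 hn.
have m_rank : measurable_fun [set: W] rank_density.
  apply: emeasurable_funD; apply: (measurable_rank_functional hd a0 y0) => t *;
    rewrite ?funrpos_ge0 ?funrneg_ge0//.
    by apply: (measurableT_comp mfp); exact: measurable_fun_pair.
  by apply: (measurableT_comp mfn); exact: measurable_fun_pair.
have L0 : 0 < (2 * lambda) ^+ d by rewrite exprn_gt0// mulr_gt0.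
have rk0 v : (0 <= rank_density v)%E by rewrite adde_ge0 ?rank_functional_ge0.
(* A convergent sequence is bounded, which makes the dominating function independent of [n]. *)
have [C hC] : exists C : R, forall n, (2 * (n0 n)%:R + 1) ^+ d / n%:R ^+ d <= C.
  have h := @cvg_pow_add R n0 lambda d 1 hn.
  have : cvgn (fun n => (2 * (n0 n)%:R + 1) ^+ d / n%:R ^+ d : R).
    by apply/cvg_ex; eexists; exact: h.
  move=> /cvg_seq_bounded /pinfty_ex_gt0[C _ hC]; exists C => n.
  by apply: le_trans (ler_norm _) _; exact: hC.
have ws_bound n v : ((n%:R ^+ d)^-1%:E * window_sums (n0 n) v <=
    (2 * C * C0)%:E * mass v)%E.
  have mv : (0 <= mass v)%E.
    by apply: integral_ge0 => u _; rewrite lee_fin powR_ge0.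
  have b (g : Zd d -> R) : (forall t, 0 <= g t <= `|f (v, t)|) ->
      ((n%:R ^+ d)^-1%:E * window_sum alpha y (n0 n) g <= (C * C0)%:E * mass v)%E.
    move=> hg; have g0 t : 0 <= g t by case/andP: (hg t).
    have i0 : (0 <= ((n%:R ^+ d)^-1)%:E :> \bar R)%E.
      by rewrite lee_fin invr_ge0 exprn_ge0.
    apply: le_trans (lee_wpmul2l i0 (window_sum_bound hd a0 m0 y0 g0 (n0 n))) _.
    rewrite muleA -EFinM mulrC (EFinM C) -muleA.
    apply: lee_pmul.
    - by rewrite lee_fin divr_ge0 ?exprn_ge0// addr_ge0// mulr_ge0.
    - by apply: integral_ge0 => t _; rewrite lee_fin power_density_ge0.
    - by rewrite lee_fin.
    - exact: power_sum_le.
  rewrite ge0_muleDr ?window_sum_ge0//.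
  have -> : (2 * C * C0)%:E = ((C * C0)%:E + (C * C0)%:E)%E.
    by rewrite -EFinD; congr EFin; ring.
  have CC0 : (0 <= (C * C0)%:E)%E.
    rewrite lee_fin; apply: mulr_ge0; last exact: powR_ge0.
    apply: le_trans (hC 0%N); by apply: divr_ge0; apply: exprn_ge0.
  rewrite ge0_muleDl//; apply: leeD; apply: b => t; [exact: fp_abs|exact: fn_abs].
have dc := @dominated_convergence _ _ _ nu [set: W] measurableT
  (fun n v => (n%:R ^+ d)^-1%:E * window_sums (n0 n) v)%E
  (fun v => ((2 * lambda) ^+ d)%:E * rank_density v)%E
  (fun v => (2 * C * C0)%:E * mass v)%E.
have [|||||i1 _ cv] := dc.
- by move=> n; apply: emeasurable_funM => //; exact: measurable_window_sums.
- exact: emeasurable_funM.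
- have := integrable_ae measurableT integrable_mass.
  apply: filterS => v /(_ I) mv _.
  have cvw (g : Zd d -> R) : (forall t, 0 <= g t <= `|f (v, t)|) ->
      ((n%:R ^+ d)^-1%:E * window_sum alpha y (n0 n) g)%E @[n --> \oo] -->
        (((2 * lambda) ^+ d)%:E * G g)%E /\ (G g < +oo)%E.
    move=> hg; have g0 t : 0 <= g t by case/andP: (hg t).
    have ps : (power_sum alpha m0 y g < +oo)%E.
      apply: le_lt_trans (power_sum_le hg) _.
      by rewrite lte_mul_pinfty ?lee_fin ?powR_ge0// ltey_eq mv.
    split; first exact: (window_sum_cvg hd a0 y0 g0 ps l0 hn).
    exact: (rank_functional_lty hd a0 y0 g0 ps).
  have [c1 f1] := cvw _ (fp_abs v); have [c2 f2] := cvw _ (fn_abs v).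
  rewrite /rank_density ge0_muleDr ?rank_functional_ge0//.
  have -> : (fun n => (n%:R ^+ d)^-1%:E * window_sums (n0 n) v)%E =
    (fun n => (n%:R ^+ d)^-1%:E * window_sum alpha y (n0 n) (fp v) +
      (n%:R ^+ d)^-1%:E * window_sum alpha y (n0 n) (fn v))%E.
    by apply/funext => n; rewrite ge0_muleDr ?window_sum_ge0.
  apply: cvgeD => //; apply: ge0_adde_def; rewrite inE mule_ge0 ?lee_fin ?(ltW L0) ?rank_functional_ge0//.
- exact: integrableZl integrable_mass.
- apply: aeW => v n _; rewrite gee0_abs; first exact: ws_bound.
  by rewrite mule_ge0 ?lee_fin ?invr_ge0 ?exprn_ge0// adde_ge0 ?window_sum_ge0.
split.
  (* Dominated convergence also makes the limit integrable; the positive factor is divided out. *)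
  have := integrableZl measurableT ((2 * lambda) ^+ d)^-1 i1.
  apply: eq_integrable => // v _.
  by rewrite muleA -EFinM mulVf ?gt_eqF// mul1e.
rewrite ge0_integralZl in cv; [|by []|by []|by []|by rewrite lee_fin ltW].
have -> : (fun n => (n%:R ^+ d)^-1%:E * \int[nu]_v window_sums (n0 n) v)%E =
    (fun n => \int[nu]_v ((n%:R ^+ d)^-1%:E * window_sums (n0 n) v))%E.
  apply/funext => n; rewrite -ge0_integralZl//.
  - exact: measurable_window_sums.
  - by move=> v _; rewrite adde_ge0 ?window_sum_ge0.
exact: cv.
Qed.

End RankedJumps.

(** * The single big jump *)

Section SingleJump.
Context {R : realType} (dO : measure_display) (Omega : measurableType dO)
  (P : probability Omega R) (dE : measure_display) (E : measurableType dE)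
  (M : {measure set E -> \bar R}) (p : nat -> Omega -> E)
  (hp : poisson_random_measure P M p).

Lemma point_measure_le1 (A : set E) w i k : (point_measure R p A w <= 1)%E ->
  A (p i w) -> A (p k w) -> i = k.
Proof.
move=> hN Ai Ak; apply/eqP; apply: contraT => ik; move: hN.
rewrite /point_measure (@nneseriesD1 _ _ i)// (@nneseriesD1 _ _ k)//; last first.
  by rewrite eq_sym.
rewrite !diracE !mem_set// addeA -EFinD.
have S0 : (0 <= \sum_(0 <= l <oo | (true && (l != i)) && (l != k)) \d_(p l w) A
    :> \bar R)%E by apply: nneseries_ge0.
move=> h; have := le_trans (leeDl (2%:R : R)%:E S0) h.
by rewrite lee_fin (ler_nat _ 2 1).
Qed.

Lemma big_jump_sum_single (h : E -> \bar R) x w i0 :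
  (forall i, i != i0 -> ~ (x%:E < `|h (p i w)|)%E) ->
  big_jump_sum p h x w =
    if (x%:E < `|h (p i0 w)|)%E then fine (h (p i0 w)) else 0.
Proof.
move=> hi; rewrite /big_jump_sum; case: ifP => hx.
  rewrite (_ : mkset _ = [set i0]) ?fsbig_set1//.
  apply/seteqP; split=> i /= => [ix|->//].
  by apply/eqP; apply: contraT => /hi.
rewrite (_ : mkset _ = set0) ?fsbig_set0//.
apply/seteqP; split=> i //= ix.
have [ii0|/hi//] := eqVneq i i0.
by move: ix; rewrite ii0 hx.
Qed.

Lemma big_jump_sum_neq0 (h : E -> \bar R) x w : big_jump_sum p h x w != 0 ->
  exists i, (x%:E < `|h (p i w)|)%E.
Proof.
move=> h0; apply: contrapT => hn; move/eqP: h0; apply.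
rewrite /big_jump_sum (_ : mkset _ = set0) ?fsbig_set0//.
by apply/seteqP; split=> i //= ix; apply: hn; exists i.
Qed.

End SingleJump.

Lemma measure_fset_le {R : realType} d (T : measurableType d)
    (mu : {measure set T -> \bar R}) (I : eqType) (s : seq I) (F : I -> set T)
    (e : R) :
  (forall i, measurable (F i)) -> (forall i, mu (F i) <= e%:E)%E ->
  measurable [set x | exists2 i, i \in s & F i x] /\
  (mu [set x | exists2 i, i \in s & F i x] <= ((size s)%:R * e)%:E)%E.
Proof.
move=> mF hF; elim: s => [|i s [ms hs]].
  rewrite (_ : mkset _ = set0); last by apply/seteqP; split=> x //= [].
  by rewrite measure0 mul0r.
rewrite (_ : mkset _ = F i `|` [set x | exists2 i, i \in s & F i x]).
  split; first exact: measurableU.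
  apply: (@le_trans _ _ (mu (F i) + mu [set x | exists2 i, i \in s & F i x])%E).
    exact: measureU2.
  by rewrite /= -natr1 mulrDl mul1r addrC EFinD leeD.
apply/seteqP; split=> x /=.
  by move=> [k]; rewrite inE => /orP[/eqP ->|ks]; [left|right; exists k].
case=> [Fi|[k ks Fk]]; first by exists i; rewrite ?mem_head.
by exists k; rewrite // inE ks orbT.
Qed.

Section Sandwich.
Context {R : realType} (alpha : R) (halpha : 0 < alpha < 2) {d : nat}
  (hd : (0 < d)%N)
  (dW : measure_display) (W : measurableType dW)
  (nu : {sigma_finite_measure set W -> \bar R})
  (f : W * Zd d -> R) (hf : f \in Lfun (nu \x zeta R d)%E alpha%:E)
  (nu_alpha : {measure set (\bar R) -> \bar R})
  (hna : is_nu_alpha alpha nu_alpha)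
  (dO : measure_display) (Omega : measurableType dO) (P : probability Omega R)
  (j : nat -> Omega -> \bar R) (v : nat -> Omega -> W)
  (u : nat -> Omega -> Zd d)
  (hprm : poisson_random_measure P ((nu_alpha \x nu) \x zeta R d)%E
    (fun i w => (j i w, v i w, u i w)))
  (X : Zd d -> {RV P >-> R})
  (hX : forall t : Zd d,
    is_stable_series P j (fun i w => (v i w, u i w))
      (fun z => f (z.1, z.2 - t)) (X t))
  {m : nat} (m0 : (0 < m)%N) (y : 'I_m -> R) (y0 : forall k, 0 < y k).

Let a0 : 0 < alpha. Proof. by case/andP: halpha. Qed.
Local Notation M := ((nu_alpha \x nu) \x zeta R d)%E.
Local Notation p := (fun i w => (j i w, v i w, u i w)).
Let c := fine (alpha_mass alpha nu f).

Definition field_event N (x : R) : set Omega :=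
  [set w | ranked (fun k t => cube N t /\ x * y k < X t w)].

Lemma measurable_field_event N x : measurable (field_event N x).
Proof.
apply: measurable_ranked => k t; have [tN|tN] := pselect (cube N t).
  rewrite (_ : mkset _ = X t @^-1` `]x * y k, +oo[).
    by rewrite -[X in measurable X]setTI; exact: measurable_funP.
  by apply/seteqP; split=> w /=; rewrite in_itv/= andbT => // -[].
rewrite (_ : mkset _ = set0)//; by apply/seteqP; split=> w //= [].
Qed.

Lemma fine_alpha_mass_ge0 : 0 <= c.
Proof. by rewrite fine_ge0// alpha_mass_ge0. Qed.

Definition large_jumps N (x : R) : set ((\bar R * W) * Zd d) :=
  [set z | exists2 t, t \in fset_set (cube N) & (x%:E < `|jump f t z|)%E].

Lemma in_fset_cube N (t : Zd d) : (t \in fset_set (cube N)) <-> cube N t.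
Proof.
by rewrite in_fset_set; [split=> [/set_mem|/mem_set]|exact: finite_cube].
Qed.

Lemma intensity_jump_abs t (x : R) : 0 < x ->
  measurable [set z | (x%:E < `|jump f t z|)%E] /\
  (M [set z | (x%:E < `|jump f t z|)%E] <= (2 * c * x `^ (- alpha))%:E)%E.
Proof.
move=> x0.
pose T (b : bool) := [set z | (x%:E < if b then jump f t z else - jump f t z)%E].
have mT b : measurable (T b).
  rewrite -[X in measurable X]setTI; apply: emeasurable_fun_o_infty => //.
  by case: b; [|apply: measurableT_comp => //]; exact: (measurable_jump hf).
have MT b : M (T b) = (c * x `^ (- alpha))%:E.
  exact: (intensity_jump_tail a0 hna hf).
have -> : [set z | (x%:E < `|jump f t z|)%E] = T true `|` T false.
  apply/seteqP; split=> z; rewrite /T/=.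
    case: (jump f t z) => [r| |] /=; rewrite ?lte_fin ?ltry; [|by left|by right].
    by have [r0|r0] := leP 0 r; [left; rewrite -(ger0_norm r0)|
      right; rewrite -(ltr0_norm r0)].
  move=> [] /lt_le_trans; apply; first exact: lee_abs.
  by rewrite -abseN lee_abs.
split; first exact: measurableU.
apply: (@le_trans _ _ (M (T true) + M (T false))%E); first exact: measureU2.
by rewrite !MT -EFinD lee_fin; lra.
Qed.

Lemma intensity_large_jumps N (x : R) : 0 < x ->
  measurable (large_jumps N x) /\
  (M (large_jumps N x) <=
    ((2 * N%:R + 1) ^+ d * (2 * c * x `^ (- alpha)))%:E)%E.
Proof.
move=> x0.
have := @measure_fset_le _ _ _ M _ (fset_set (cube (d := d) N))
  (fun t => [set z | (x%:E < `|jump f t z|)%E]) (2 * c * x `^ (- alpha))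
  (fun t => (intensity_jump_abs t x0).1) (fun t => (intensity_jump_abs t x0).2).
by rewrite (card_cube N : size _ = _) natrX natrD natrM.
Qed.

Lemma ranked_jumps_large N (x eta : R) z : (forall k, eta <= x * y k) ->
  ranked_jumps f y N x z -> large_jumps N eta z.
Proof.
move=> ex /(ranked_ex (Ordinal m0))[t [tN ht]].
exists t; first exact/in_fset_cube.
apply: (lt_le_trans (le_lt_trans _ ht)); [by rewrite lee_fin|exact: lee_abs].
Qed.

Definition error_event N (eta kappa : R) : set Omega :=
  [set w | exists2 t, t \in fset_set (cube N) &
    kappa < `|big_jump_sum p (jump f t) eta w - X t w|].

Lemma prob_error_event N (eta kappa : R) : 0 < eta -> 0 < kappa ->
  measurable (error_event N eta kappa) /\
  (P (error_event N eta kappa) <= ((2 * N%:R + 1) ^+ d *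
    (32 * c * (alpha / (2 - alpha)) * eta `^ (2 - alpha) / kappa ^+ 2))%:E)%E.
Proof.
move=> e0 k0.
have := @measure_fset_le _ _ _ P _ (fset_set (cube (d := d) N))
  (fun t => [set w | kappa < `|big_jump_sum p (jump f t) eta w - X t w|])
  (32 * c * (alpha / (2 - alpha)) * eta `^ (2 - alpha) / kappa ^+ 2).
rewrite (card_cube N : size _ = _) natrX natrD natrM; apply=> t.
  rewrite -[X in measurable X]setTI.
  have mZ : measurable_fun [set: Omega]
      (fun w => `|big_jump_sum p (jump f t) eta w - X t w|).
    apply: measurableT_comp => //; apply: measurable_funB => //.
    by apply: (measurable_big_jump_sum hprm (measurable_jump hf t)); exact: ltW.
  have := mZ measurableT `]kappa, +oo[%classic (measurable_itv _).
  by congr measurable; apply/seteqP; split=> w [_ /=];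
    rewrite ?in_itv/= ?andbT => ?; split=> //=; rewrite in_itv/= andbT.
apply: (big_jump_sum_error hprm (measurable_jump hf t) halpha fine_alpha_mass_ge0) => //.
- by move=> b x x0; exact: (intensity_jump_tail a0 hna hf).
- exact: hX.
Qed.

(** Infinite jumps lie in every tail, so they form a null set. They have to be excluded because
    [fine] turns them into 0 in the truncated sum. *)
Lemma intensity_infinite_jumps :
  measurable [set z : (\bar R * W) * Zd d | (`|z.1.1| = +oo)%E] /\
  M [set z | (`|z.1.1| = +oo)%E] = 0%E.
Proof.
have mI : measurable [set z : (\bar R * W) * Zd d | (`|z.1.1| = +oo)%E].
  have mg : measurable_fun [set: (\bar R * W) * Zd d]
      (fun z : (\bar R * W) * Zd d => `|z.1.1|%E).
    by apply: measurableT_comp => //; apply: measurableT_comp.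
  rewrite -[X in measurable X]setTI.
  exact: mg measurableT _ (emeasurable_set1 _).
split => //; rewrite (intensityE a0 hna _ mI).
have nu0 : nu_alpha [set j : \bar R | (`|j| = +oo)%E] = 0%E.
  apply/eqP; rewrite eq_le measure_ge0 andbT; apply/lee_addgt0Pr => e e0.
  rewrite add0e.
  (* Each of the two tails beyond this [x] has mass [e / 2]. *)
  pose x := (e / 2) `^ (- alpha^-1).
  have x0 : 0 < x by rewrite powR_gt0// divr_gt0.
  have xa : x `^ (- alpha) = e / 2.
    by rewrite -powRrM mulrNN mulVf ?gt_eqF// powRr1// ltW// divr_gt0.
  pose S (r : R) := [set j : \bar R | (x%:E < j * r%:E)%E].
  have mS r : measurable (S r).
    rewrite /S -[X in measurable X]setTI; apply: emeasurable_fun_o_infty => //.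
    exact: emeasurable_funM.
  have hS r : nu_alpha (S r) = (e / 2 * `|r| `^ alpha)%:E.
    by rewrite -xa; exact: (nu_alpha_gt hna).
  apply: (@le_trans _ _ (nu_alpha (S 1%R `|` S (-1)%R))).
    apply: le_measure; rewrite ?inE; last 2 first.
    - exact: measurableU.
    - move=> [r| |]//= _; [left|right]; rewrite /S/=.
        by rewrite mule1 ltry.
      by rewrite EFinN muleN mule1 ltry.
    have mabs : measurable_fun [set: \bar R] (fun j : \bar R => `|j|%E).
      by apply: measurableT_comp.
    rewrite -[X in measurable X]setTI.
    exact: mabs measurableT _ (emeasurable_set1 _).
  apply: (@le_trans _ _ (nu_alpha (S 1%R) + nu_alpha (S (-1)%R))%E).
    exact: measureU2.
  by rewrite !hS normrN normr1 powR1 mulr1 -EFinD -splitr.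
by rewrite integral0_eq// => w _; rewrite integral0_eq.
Qed.

(** Where the field exceeds a level, the truncated sum is still positive, so some large jump is
    present; as there is at most one large point, the same [i] is responsible at every [t]. *)
Lemma field_event_sub N (g dl ys eta : R) w : 0 < g -> 0 < dl < 1 ->
  0 < ys -> (forall k, ys <= y k) -> 0 < eta ->
  (point_measure R p (large_jumps N (eta * g)) w <= 1)%E ->
  ~ error_event N (eta * g) (dl * ys * g) w ->
  field_event N g w ->
  exists i, ranked_jumps f y N ((1 - dl) * g) (p i w).
Proof.
move=> g0 /andP[dl0 dl1] ys0 ysy eta0 hN herr hE.
(* The tolerance uses the lower bound [ys] of the levels, so it costs at most the fraction [dl] of
   each of them. *)
have kap k : dl * ys * g <= dl * g * y k.
  by rewrite mulrAC ler_wpM2l// mulr_ge0// ltW.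
have clo t : cube N t ->
    `|big_jump_sum p (jump f t) (eta * g) w - X t w| <= dl * ys * g.
  move=> tN; rewrite leNgt; apply/negP => h; apply: herr.
  by exists t => //; exact/in_fset_cube.
have lowX k t : cube N t -> g * y k < X t w ->
    (1 - dl) * g * y k < big_jump_sum p (jump f t) (eta * g) w.
  move=> tN ht; have := clo t tN; rewrite ler_distl => /andP[h _].
  by have := kap k; lra.
have pos k : 0 < (1 - dl) * g * y k by rewrite !mulr_gt0// subr_gt0.
have [t1 [t1N ht1]] := ranked_ex (Ordinal m0) hE.
have [i hi] : exists i, ((eta * g)%:E < `|jump f t1 (p i w)|)%E.
  apply: (big_jump_sum_neq0 (p := p)); rewrite gt_eqF//.
  exact: lt_trans (pos _) (lowX _ _ t1N ht1).
exists i; apply: ranked_sub hE => k t [tN ht]; split=> //.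
have := lowX _ _ tN ht.
rewrite (big_jump_sum_single (p := p) (i0 := i)); last first.
  move=> l li hl; move/eqP: li; apply.
  apply: (point_measure_le1 hN); [exists t|exists t1] => //; exact/in_fset_cube.
case: ifP => _ h; last by have := lt_trans (pos k) h; rewrite ltxx.
case: (jump f t _) h => [r| |] //=.
- by rewrite ltNge (ltW (pos k)).
- by rewrite ltNge (ltW (pos k)).
Qed.

(** Since [eta <= ys], a contribution above a raised level passes the truncation threshold and is
    the only term of the truncated sum. Finiteness of [j i w] keeps [fine] from replacing it by
    0. *)
Lemma field_event_sup N (g dl ys eta : R) w i : 0 < g -> 0 < dl ->
  0 < ys -> (forall k, ys <= y k) -> 0 < eta -> eta <= ys ->
  (point_measure R p (large_jumps N (eta * g)) w <= 1)%E ->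
  ~ error_event N (eta * g) (dl * ys * g) w ->
  (`|j i w| < +oo)%E ->
  ranked_jumps f y N ((1 + dl) * g) (p i w) -> field_event N g w.
Proof.
move=> g0 dl0 ys0 ysy eta0 etays hN herr jfin hB.
have kap k : dl * ys * g <= dl * g * y k.
  by rewrite mulrAC ler_wpM2l// mulr_ge0// ltW.
have clo t : cube N t ->
    `|big_jump_sum p (jump f t) (eta * g) w - X t w| <= dl * ys * g.
  move=> tN; rewrite leNgt; apply/negP => h; apply: herr.
  by exists t => //; exact/in_fset_cube.
have etay k : eta * g <= (1 + dl) * g * y k.
  have := ysy k; have := ler_wpM2r (ltW g0) etays => h1 h2.
  have := ler_wpM2l (ltW g0) h2; have : 0 <= dl * g * y k.
    by rewrite !mulr_ge0// ltW.
  by lra.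
have large t : ((eta * g)%:E < `|jump f t (p i w)|)%E -> cube N t ->
    large_jumps N (eta * g) (p i w).
  by move=> h tN; exists t => //; exact/in_fset_cube.
apply: ranked_sub hB => k t [tN ht]; split=> //.
have hl : ((eta * g)%:E < `|jump f t (p i w)|)%E.
  apply: (lt_le_trans (le_lt_trans _ ht)); [by rewrite lee_fin|exact: lee_abs].
have := clo t tN.
rewrite (big_jump_sum_single (p := p) (i0 := i)); last first.
  move=> l li hl'; move/eqP: li; apply.
  apply: (point_measure_le1 hN); last exact: large hl tN.
  by exists t => //; exact/in_fset_cube.
rewrite hl ler_distl => /andP[h1 h2].
have : (1 + dl) * g * y k < fine (jump f t (p i w)).
  rewrite -lte_fin fineK// /jump/= fin_numM// fin_numElt.
  by move: jfin; case: (j i w) => //= r _; rewrite ltNyr ltry.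
by have := kap k; lra.
Qed.

Let hatP (A : set Omega) : measurable A -> P A = (fine (P A))%:E.
Proof. by move=> mA; rewrite fineK// fin_num_measure. Qed.

(** Here [q] is the number of sites of the window, [V] bounds the error probability at one site and
    [mu] the mean number of large points. In the second bound [mu ^+ 2] occurs twice: for a second
    large point, and for the quadratic term of [onem_expRN_ge]. *)
Lemma prob_field_event_bounds N (g dl ys eta : R) :
  let q := (2 * N%:R + 1) ^+ d in
  let V := 32 * c * (alpha / (2 - alpha)) * (eta * g) `^ (2 - alpha) /
    (dl * ys * g) ^+ 2 in
  let mu := q * (2 * c * (eta * g) `^ (- alpha)) in
  0 < g -> 0 < dl -> 0 < ys -> (forall k, ys <= y k) -> 0 < eta ->
  (dl < 1 -> eta <= (1 - dl) * ys ->
    fine (P (field_event N g)) <=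
      fine (M (ranked_jumps f y N ((1 - dl) * g))) + q * V + mu ^+ 2) /\
  (eta <= ys ->
    fine (M (ranked_jumps f y N ((1 + dl) * g))) - mu ^+ 2 <=
      fine (P (field_event N g)) + q * V + mu ^+ 2).
Proof.
move=> q V mu g0 dl0 ys0 ysy eta0.
have eg0 : 0 < eta * g by rewrite mulr_gt0.
have kg0 : 0 < dl * ys * g by rewrite !mulr_gt0.
have [mC MC] := intensity_large_jumps N eg0.
have [mErr PErr] := prob_error_event N eg0 kg0.
rewrite -/q -/mu in MC; rewrite -/q -/V in PErr.
have Cfin : (M (large_jumps N (eta * g)) < +oo)%E.
  by apply: le_lt_trans MC _; rewrite ltry.
set T2 := [set w | (1 < point_measure R p (large_jumps N (eta * g)) w)%E].
have mT2 : measurable T2.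
  rewrite /T2 -[X in measurable X]setTI; apply: emeasurable_fun_o_infty => //.
  exact: (measurable_point_measure hprm).
have fC : fine (M (large_jumps N (eta * g))) <= mu.
  by rewrite -lee_fin fineK// ge0_fin_numE// measure_ge0.
have PT2 : (P T2 <= (mu ^+ 2)%:E)%E.
  apply: le_trans (prob_point_measure_ge2 hprm mC Cfin) _.
  have fC0 : 0 <= fine (M (large_jumps N (eta * g))) by rewrite fine_ge0.
  by rewrite lee_fin ler_pXn2r ?nnegrE// (le_trans fC0).
have mE := measurable_field_event N g.
set Err := error_event _ _ _ in mErr PErr.
have mB x : measurable (ranked_jumps f y N x).
  exact: (measurable_ranked_jumps hf).
have hB x : (forall k, eta * g <= x * y k) ->
    (M (ranked_jumps f y N x) <= M (large_jumps N (eta * g)))%E.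
  by move=> hx; apply: le_measure; rewrite ?inE// => z; exact: ranked_jumps_large.
pose NB x := [set w | point_measure R p (ranked_jumps f y N x) w != 0%E].
have mNB A : measurable A -> measurable [set w | point_measure R p A w != 0%E].
  move=> mA; rewrite (_ : mkset _ = ~` [set w | point_measure R p A w = 0%E]).
    by apply: measurableC; exact: (measurable_point_measure_eq hprm).
  by apply/seteqP; split=> w /= /eqP.
have ptNB A w : point_measure R p A w != 0%E -> exists i, A (p i w).
  move=> h; apply: contrapT => hn; move/eqP: h; apply.
  by apply/point_measure_eq0 => i Ai; apply: hn; exists i.
split.
- move=> dl1 etays; set x := (1 - dl) * g.
  have hx k : eta * g <= x * y k.
    have := ler_wpM2r (ltW g0) etays => h.
    have : (1 - dl) * g * ys <= (1 - dl) * g * y k.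
      by rewrite ler_wpM2l// mulr_ge0 ?subr_ge0 ?ltW.
    by rewrite /x; lra.
  have Bfin := le_lt_trans (hB x hx) Cfin.
  have sub : field_event N g `<=` NB x `|` Err `|` T2.
    move=> w hw; apply: contrapT => /not_orP[/not_orP[n1 n2] n3].
    have dl01 : 0 < dl < 1 by rewrite dl0.
    have N1 : (point_measure R p (large_jumps N (eta * g)) w <= 1)%E.
      by rewrite leNgt; apply/negP.
    have [i Bi] := field_event_sub g0 dl01 ys0 ysy eta0 N1 n2 hw.
    apply: n1; apply/eqP => /point_measure_eq0 /(_ i); exact.
  rewrite -lee_fin -hatP// EFinD EFinD.
  apply: (@le_trans _ _ (P (NB x `|` Err `|` T2))).
    apply: le_measure; rewrite ?inE//.
    by apply: measurableU => //; apply: measurableU => //; exact: mNB.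
  apply: (@le_trans _ _ (P (NB x `|` Err) + P T2)%E).
    by apply: measureU2 => //; apply: measurableU => //; exact: mNB.
  apply: leeD => //.
  apply: (@le_trans _ _ (P (NB x) + P Err)%E).
    by apply: measureU2 => //; exact: mNB.
  apply: leeD => //.
  rewrite [leLHS](prob_point_measure_pos hprm (mB x) Bfin).
  by rewrite lee_fin; exact: onem_expRN_le.
- move=> etays; set x := (1 + dl) * g.
  have hx k : eta * g <= x * y k.
    have h1 := ler_wpM2r (ltW g0) etays.
    have h2 := ler_wpM2l (ltW g0) (ysy k).
    have : 0 <= dl * g * y k by rewrite !mulr_ge0// ltW.
    by rewrite /x; lra.
  have Bfin := le_lt_trans (hB x hx) Cfin.
  have [mI MI] := intensity_infinite_jumps.
  set I0 := [set z | _] in mI MI.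
  pose NI := [set w | point_measure R p I0 w != 0%E].
  have PI : P NI = 0%E.
    rewrite [LHS](prob_point_measure_pos hprm mI); last by rewrite [ltLHS]MI.
    by rewrite [X in fine X]MI oppr0 expR0 subrr.
  have sub : NB x `<=` field_event N g `|` Err `|` T2 `|` NI.
    move=> w hw; apply: contrapT => /not_orP[/not_orP[/not_orP[n1 n2] n3] n4].
    have [i Bi] := ptNB _ _ hw; apply: n1.
    apply: (@field_event_sup N g dl ys eta w i g0 dl0 ys0 ysy eta0 etays _ n2 _ Bi).
      by rewrite leNgt; apply/negP.
    rewrite ltey; apply/eqP => ji; apply: n4.
    by apply/eqP => /point_measure_eq0 /(_ i); exact.
  have b0 : 0 <= fine (M (ranked_jumps f y N x)) by rewrite fine_ge0.
  have bmu : fine (M (ranked_jumps f y N x)) <= mu.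
    apply: le_trans fC; apply: fine_le; rewrite ?ge0_fin_numE//; exact: hB.
  apply: (@le_trans _ _ (1 - expR (- fine (M (ranked_jumps f y N x))))).
    apply: le_trans (onem_expRN_ge b0); rewrite lerD2l lerN2.
    by rewrite ler_pXn2r ?nnegrE// (le_trans b0).
  rewrite -lee_fin -[leLHS](prob_point_measure_pos hprm (mB x) Bfin) !EFinD -hatP//.
  have m1 : measurable (field_event N g `|` Err) by exact: measurableU.
  have m2 : measurable (field_event N g `|` Err `|` T2) by exact: measurableU.
  apply: (@le_trans _ _ (P (field_event N g `|` Err `|` T2 `|` NI))).
    apply: le_measure; rewrite ?inE//; first exact: mNB.
    by apply: measurableU => //; exact: mNB.
  apply: (@le_trans _ _ (P (field_event N g `|` Err `|` T2) + P NI)%E).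
    by apply: measureU2 => //; exact: mNB.
  rewrite [X in (_ + X)%E]PI adde0.
  apply: (@le_trans _ _ (P (field_event N g `|` Err) + P T2)%E).
    exact: measureU2.
  apply: leeD => //.
  apply: (@le_trans _ _ (P (field_event N g) + P Err)%E); first exact: measureU2.
  exact: leeD.
Qed.

End Sandwich.

(** * Asymptotics *)

(** Infinite [x] is allowed: both sides are then 0. *)
Lemma fine_EFinM {R : realType} (c : R) (x : \bar R) :
  fine (c%:E * x)%E = c * fine x.
Proof.
case: x => [x| |]//=; rewrite mulr0; case: (ltgtP c 0) => c0;
  rewrite ?c0 ?mul0e//.
- by rewrite lt0_muley ?lte_fin.
- by rewrite gt0_muley ?lte_fin.
- by rewrite lt0_muleNy ?lte_fin.
- by rewrite gt0_muleNy ?lte_fin.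
Qed.

Lemma small_powR {R : realType} (K b e x0 : R) :
  0 <= K -> 0 < b -> 0 < e -> 0 < x0 ->
  exists x, [/\ 0 < x, x <= x0 & K * x `^ b <= e].
Proof.
move=> K0 b0 e0 x00; pose z := e / (K + 1).
have K1 : 0 < K + 1 by rewrite ltr_wpDl.
have z0 : 0 < z by rewrite divr_gt0.
have zb0 : 0 < z `^ b^-1 by rewrite powR_gt0.
exists (Num.min x0 (z `^ b^-1)); split.
- by rewrite lt_min x00.
- by rewrite ge_min lexx.
- apply: (@le_trans _ _ (K * z)).
    apply: ler_wpM2l => //; rewrite -[leRHS](powRr1 (ltW z0)) -(mulVf (lt0r_neq0 b0)).
    rewrite powRrM; apply: ge0_ler_powR; rewrite ?nnegrE ?(ltW b0) ?powR_ge0//.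
      by rewrite le_min (ltW x00) powR_ge0.
    by rewrite ge_min lexx orbT.
  by rewrite /z mulrCA ger_pMr// ler_pdivrMr// mul1r lerDl.
Qed.

Lemma powR_gt1 {R : realType} (s b : R) : 1 < s -> 0 < b -> 1 < s `^ b.
Proof.
move=> s1 b0; have -> : 1 = 1 `^ b :> R by rewrite powR1.
by rewrite gt0_ltr_powR ?nnegrE// (le_trans _ (ltW s1)).
Qed.

(** Supplies the factor [1 - dl] on the levels, as the solution of [x ^ (- a) = 1 + e / (L + 1)];
    the [+ 1] covers [L = 0]. The next lemma does the same for [1 + dl], with the reciprocal. *)
Lemma powR_near1_le {R : realType} (a L e : R) : 0 < a -> 0 <= L -> 0 < e ->
  exists x, [/\ 0 < x, x < 1 & x `^ (- a) * L <= L + e].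
Proof.
move=> a0 L0 e0; pose s := 1 + e / (L + 1).
have L1 : 0 < L + 1 by rewrite ltr_wpDl.
have eL : 0 < e / (L + 1) by rewrite divr_gt0.
have s1 : 1 < s by rewrite ltrDl.
have s0 : 0 < s by rewrite (lt_trans _ s1).
exists (s `^ (- a^-1)); split; first by rewrite powR_gt0.
  by rewrite powRN invf_lt1 ?powR_gt0// powR_gt1// invr_gt0.
rewrite -powRrM mulrNN mulVf ?lt0r_neq0// (powRr1 (ltW s0)) mulrDl mul1r lerD2l.
by rewrite -mulrA ger_pMr// mulrC ler_pdivrMr// mul1r lerDl.
Qed.

Lemma powR_near1_ge {R : realType} (a L e : R) : 0 < a -> 0 <= L -> 0 < e ->
  exists x, 1 < x /\ L - e <= x `^ (- a) * L.
Proof.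
move=> a0 L0 e0; pose s := 1 + e / (L + 1).
have L1 : 0 < L + 1 by rewrite ltr_wpDl.
have eL : 0 < e / (L + 1) by rewrite divr_gt0.
have s1 : 1 < s by rewrite ltrDl.
have s0 : 0 < s by rewrite (lt_trans _ s1).
exists (s `^ a^-1); split.
  by rewrite powR_gt1// invr_gt0.
rewrite -powRrM mulrN mulVf ?lt0r_neq0// (powR_inv1 (ltW s0)).
rewrite mulrC ler_pdivlMr// /s mulrDr mulr1.
rewrite -subr_ge0.
have -> : L - (L - e + (L - e) * (e / (L + 1))) =
  e * ((L + 1 - (L - e)) / (L + 1)) by field; rewrite lt0r_neq0.
by apply: mulr_ge0; [exact: ltW|apply: divr_ge0; lra].
Qed.

Lemma le_all_fin {R : realType} (m : nat) (y : 'I_m -> R) :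
  (forall k, 0 < y k) -> exists2 z, 0 < z & forall k, z <= y k.
Proof.
elim: m y => [|m ih] y y0; first by exists 1 => // -[].
have [z z0 zy] := ih (fun k => y (lift ord0 k)) (fun k => y0 _).
exists (Num.min z (y ord0)); first by rewrite lt_min z0 y0.
move=> k; case: (unliftP ord0 k) => [i|] ->.
  by rewrite ge_min zy.
by rewrite ge_min lexx orbT.
Qed.

Section Asymptotics.
Context {R : realType} (alpha : R) (halpha : 0 < alpha < 2) {d : nat}
  (hd : (0 < d)%N)
  (dW : measure_display) (W : measurableType dW)
  (nu : {sigma_finite_measure set W -> \bar R})
  (f : W * Zd d -> R) (hf : f \in Lfun (nu \x zeta R d)%E alpha%:E)
  (nu_alpha : {measure set (\bar R) -> \bar R})
  (hna : is_nu_alpha alpha nu_alpha)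
  (dO : measure_display) (Omega : measurableType dO) (P : probability Omega R)
  (j : nat -> Omega -> \bar R) (v : nat -> Omega -> W)
  (u : nat -> Omega -> Zd d)
  (hprm : poisson_random_measure P ((nu_alpha \x nu) \x zeta R d)%E
    (fun i w => (j i w, v i w, u i w)))
  (X : Zd d -> {RV P >-> R})
  (hX : forall t : Zd d,
    is_stable_series P j (fun i w => (v i w, u i w))
      (fun z => f (z.1, z.2 - t)) (X t))
  (gamma : nat -> R) (hgamma : forall n, 0 < gamma n)
  (hgamma_lim : n%:R `^ (d%:R / alpha) / gamma n @[n --> \oo] --> (0 : R))
  {m : nat} (m0 : (0 < m)%N) (y : 'I_m -> R) (y0 : forall k, 0 < y k)
  (n0 : nat -> nat) (lambda : R) (l0 : 0 < lambda)
  (hn0 : (n0 n)%:R / n%:R @[n --> \oo] --> lambda).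

Let a0 : 0 < alpha. Proof. by case/andP: halpha. Qed.
Local Notation M := ((nu_alpha \x nu) \x zeta R d)%E.
Let c := fine (alpha_mass alpha nu f).
Let A n := gamma n `^ alpha / n%:R ^+ d.
Let r n : R := (2 * (n0 n)%:R + 1) ^+ d / n%:R ^+ d.
Let S n := fine (\int[nu]_x window_sums alpha f y (n0 n) x).

(** The growth hypothesis on [gamma], raised to the power [alpha]. *)
Lemma cvg_norming_inv : (A n)^-1 @[n --> \oo] --> (0 : R).
Proof.
have h : (n%:R `^ (d%:R / alpha) / gamma n) `^ alpha @[n --> \oo] --> (0 : R).
  apply/cvgr0Pnorm_le => e e0; near=> n.
  rewrite ger0_norm ?powR_ge0//.
  have -> : e = (e `^ alpha^-1) `^ alpha.
    by rewrite -powRrM mulVf ?lt0r_neq0// powRr1// ltW.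
  apply: ge0_ler_powR; rewrite ?nnegrE ?(ltW a0) ?powR_ge0//.
    by rewrite divr_ge0 ?powR_ge0// ltW.
  apply: le_trans (ler_norm _) _; near: n.
  by move/cvgr0Pnorm_le: hgamma_lim; apply; rewrite powR_gt0.
apply: cvg_trans h; apply: near_eq_cvg; near=> n.
rewrite powRM ?powR_ge0 ?invr_ge0 ?(ltW (hgamma n))//.
rewrite -powRrM -mulrA mulVf ?lt0r_neq0// mulr1 powR_mulrn ?ler0n//.
by rewrite -powR_inv1 ?(ltW (hgamma n))// -powRrM mulN1r powRN /A invf_div.
Unshelve. all: by end_near. Qed.

Lemma norming_intensity n x : 0 < x ->
  A n * fine (M (ranked_jumps f y (n0 n) (x * gamma n))) =
  x `^ (- alpha) * ((n%:R ^+ d)^-1 * S n).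
Proof.
move=> x0; have g0 := hgamma n.
rewrite (intensity_ranked_jumps a0 hd hna hf m0 y0 _ (mulr_gt0 x0 g0)).
rewrite fine_EFinM -/(S n) powRM ?ltW// [gamma n `^ (- alpha)]powRN /A.
have h : gamma n `^ alpha != 0 by rewrite lt0r_neq0 ?powR_gt0.
rewrite [LHS](_ : _ = (gamma n `^ alpha / gamma n `^ alpha) *
  (x `^ (- alpha) * ((n%:R ^+ d)^-1 * S n))); last by ring.
by rewrite divff// mul1r.
Qed.

(** The powers [alpha] and [2 - alpha] of [gamma n] multiply to the square in the denominator, so
    that only the convergent ratio [r n] still depends on [n]. *)
Lemma norming_error n (eta k : R) : 0 < eta -> 0 < k ->
  A n * ((2 * (n0 n)%:R + 1) ^+ d * (32 * c * (alpha / (2 - alpha)) *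
     (eta * gamma n) `^ (2 - alpha) / (k * gamma n) ^+ 2)) =
  r n * (32 * c * (alpha / (2 - alpha)) / k ^+ 2 * eta `^ (2 - alpha)).
Proof.
move=> e0 k0; have g0 := hgamma n.
rewrite powRM ?ltW// /A /r exprMn.
have h : gamma n `^ alpha * gamma n `^ (2 - alpha) = gamma n ^+ 2.
  by rewrite -powRD ?lt0r_neq0 ?implybT// subrKC powR_mulrn// ltW.
rewrite invfM.
rewrite [LHS](_ : _ = (gamma n `^ alpha * gamma n `^ (2 - alpha)) / gamma n ^+ 2 *
  ((2 * (n0 n)%:R + 1) ^+ d / n%:R ^+ d * (32 * c * (alpha / (2 - alpha)) / k ^+ 2 *
   eta `^ (2 - alpha)))); last by ring.
by rewrite h divff ?mul1r// expf_neq0// lt0r_neq0.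
Qed.

(** The mean number of large points is of order [(A n)^-1]; its square keeps one such factor after
    norming and therefore vanishes in the limit. *)
Lemma norming_square n (eta : R) : 0 < eta -> (0 < n)%N ->
  A n * ((2 * (n0 n)%:R + 1) ^+ d * (2 * c * (eta * gamma n) `^ (- alpha))) ^+ 2 =
  (r n * (2 * c * eta `^ (- alpha))) ^+ 2 * (A n)^-1.
Proof.
move=> e0 nn0; have g0 := hgamma n.
have An0 : A n != 0.
  by rewrite lt0r_neq0// divr_gt0 ?powR_gt0// exprn_gt0// ltr0n.
have h : A n * gamma n `^ (- alpha) = (n%:R ^+ d)^-1.
  rewrite /A powRN mulrAC divff ?mul1r//.
  by rewrite lt0r_neq0// powR_gt0.
rewrite powRM ?ltW//.
rewrite [LHS](_ : _ = (A n * gamma n `^ (- alpha) *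
   ((2 * (n0 n)%:R + 1) ^+ d * (2 * c * eta `^ (- alpha)))) ^+ 2 * (A n)^-1).
  by rewrite h /r; ring.
by field.
Qed.

(** Given [e], the factor [x = 1 -+ dl] on the levels is chosen first, so that [x ^ (- alpha)] costs
    at most [e / 2]; then [eta], small in terms of [dl], so that the limiting error of the small
    jumps is at most [e / 2] and the truncation stays below the levels; [n] grows last. *)
Lemma field_event_asymptotics :
  ((gamma n `^ alpha / n%:R ^+ d)%:E *
    P (field_event X y (n0 n) (gamma n)))%E @[n --> \oo] -->
  (((2 * lambda) ^+ d)%:E * \int[nu]_x rank_density alpha f y x)%E.
Proof.
have [int cvI] := intensity_ranked_jumps_cvg a0 hd hf m0 y0 l0 hn0.
set D := (\int[nu]_x rank_density alpha f y x)%E in cvI *.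
have Dfin : D \is a fin_num by exact: integrable_fin_num.
rewrite -(fineK Dfin) -EFinM in cvI *.
set L := (2 * lambda) ^+ d * fine D in cvI *.
have {cvI} cI : (n%:R ^+ d)^-1 * S n @[n --> \oo] --> L.
  have [_] := (@fine_cvgP _ _ _ _ _ _).1 cvI; apply: cvg_trans; apply: near_eq_cvg.
  by near=> n; rewrite /= fine_EFinM.
have L0 : 0 <= L.
  rewrite mulr_ge0 ?exprn_ge0 ?mulr_ge0 ?(ltW l0)// fine_ge0//.
  by apply: integral_ge0 => x _; rewrite /rank_density adde_ge0 ?rank_functional_ge0.
have cr : r n @[n --> \oo] --> (2 * lambda) ^+ d.
  exact: (@cvg_pow_add R n0 lambda d 1 hn0).
set Lam := (2 * lambda) ^+ d in cr *.
have Lam0 : 0 <= Lam by rewrite exprn_ge0// mulr_ge0// ltW.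
have cge0 : 0 <= c := fine_alpha_mass_ge0 alpha nu f.
have a2 : 0 < 2 - alpha by rewrite subr_gt0; case/andP: halpha.
have [ys ys0 ysy] := le_all_fin y0.
have K0 k : 0 <= 32 * c * (alpha / (2 - alpha)) / k ^+ 2.
  rewrite divr_ge0 ?sqr_ge0// mulr_ge0 ?divr_ge0 ?(ltW a0) ?(ltW a2)//.
  by rewrite mulr_ge0.
have rest K (eta : R) : 0 < eta ->
    r n * (K * eta `^ (2 - alpha)) +
    (r n * (2 * c * eta `^ (- alpha))) ^+ 2 * (A n)^-1 @[n --> \oo] -->
    Lam * (K * eta `^ (2 - alpha)).
  move=> eta0; rewrite -[X in _ --> X]addr0.
  rewrite -[X in _ --> _ + X](mulr0 ((Lam * (2 * c * eta `^ (- alpha))) ^+ 2)).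
  apply: cvgD; first by apply: cvgMl.
  apply: cvgM; last exact: cvg_norming_inv.
  by rewrite expr2; apply: cvgM; apply: cvgMl.
have A0 n : 0 <= A n by rewrite divr_ge0 ?powR_ge0 ?exprn_ge0.
apply/fine_cvgP; split.
  by near=> n; rewrite fin_numM// fin_num_measure//; exact: measurable_field_event.
rewrite (_ : fine \o _ = fun n => A n * fine (P (field_event X y (n0 n) (gamma n))));
  last by apply/funext => n /=; rewrite fine_EFinM.
apply: cvg_sandwich => e e0; have e20 : 0 < e / 2 by rewrite divr_gt0.
- have [x [x0 x1 xL]] := powR_near1_le a0 L0 e20.
  have dl0 : 0 < 1 - x by rewrite subr_gt0.
  have [eta [eta0 etax etaK]] := small_powR (mulr_ge0 Lam0 (K0 ((1 - x) * ys)))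
    a2 e20 (mulr_gt0 x0 ys0).
  eexists; exists (x `^ (- alpha) * L + Lam * (32 * c * (alpha / (2 - alpha)) /
      ((1 - x) * ys) ^+ 2 * eta `^ (2 - alpha))); split.
  + by apply: cvgD; [apply: cvgMr; exact: cI|exact: (rest _ _ eta0)].
  + by rewrite [e in leRHS]splitr addrA; apply: lerD => //; rewrite mulrA.
  + near=> n.
    have nn0 : (0 < n)%N by near: n; exists 1%N.
    have [+ _] := prob_field_event_bounds halpha hf hna hprm hX m0 y0 (n0 n)
      (hgamma n) dl0 ys0 ysy eta0.
    have dl1 : 1 - x < 1 by rewrite gtrBl.
    rewrite opprB subrKC => /(_ dl1 etax) /(ler_wpM2l (A0 n)) /le_trans; apply.
    rewrite !mulrDr norming_intensity// norming_error ?mulr_gt0// norming_square//.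
    by rewrite addrA.
- have [x [x1 xL]] := powR_near1_ge a0 L0 e20.
  have dl0 : 0 < x - 1 by rewrite subr_gt0.
  have x0 : 0 < x by rewrite (lt_trans _ x1).
  have [eta [eta0 etax etaK]] := small_powR (mulr_ge0 Lam0 (K0 ((x - 1) * ys)))
    a2 e20 ys0.
  pose B n := (r n * (2 * c * eta `^ (- alpha))) ^+ 2 * (A n)^-1.
  have cB : B n @[n --> \oo] --> (0 : R).
    rewrite -(mulr0 ((Lam * (2 * c * eta `^ (- alpha))) ^+ 2)).
    apply: cvgM; last exact: cvg_norming_inv.
    by rewrite expr2; apply: cvgM; apply: cvgMl.
  exists (fun n => x `^ (- alpha) * ((n%:R ^+ d)^-1 * S n) - B n -
    (r n * (32 * c * (alpha / (2 - alpha)) / ((x - 1) * ys) ^+ 2 *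
      eta `^ (2 - alpha)) + B n)).
  exists (x `^ (- alpha) * L - 0 - Lam * (32 * c * (alpha / (2 - alpha)) /
      ((x - 1) * ys) ^+ 2 * eta `^ (2 - alpha))); split.
  + apply: cvgB; last exact: (rest _ _ eta0).
    by apply: cvgB => //; apply: cvgMr; exact: cI.
  + by rewrite subr0 {1}[e]splitr opprD addrA; apply: lerB => //; rewrite mulrA.
  + near=> n.
    have nn0 : (0 < n)%N by near: n; exists 1%N.
    have [_] := prob_field_event_bounds halpha hf hna hprm hX m0 y0 (n0 n)
      (hgamma n) dl0 ys0 ysy eta0.
    rewrite subrKC => /(_ etax) /(ler_wpM2l (A0 n)).
    rewrite !(mulrDr, mulrN) norming_intensity// norming_error ?mulr_gt0//.
    by rewrite norming_square// -/(B n) !lerBlDr; lra.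
Unshelve. all: by end_near. Qed.

End Asymptotics.

(** * Order statistics and hitting radii as ranked exceedances *)

(** [c >= 0] matters past the end of [s], where [nth] returns the default 0 and both sides must be
    false. Ranks above the number of sites of a small box are covered in this way. *)
Lemma lt_nth_sorted {R : realType} (s : seq R) (c : R) i :
  0 <= c -> sorted >=%R s -> (c < nth 0 s i) = (i < count (> c) s)%N.
Proof.
move=> c0; elim: s i => [|x s ih] i /=; first by rewrite nth_nil ltNge c0.
move=> xs; have [cx|xc] := boolP (c < x).
  by case: i => [|i] //=; rewrite ?ih ?(path_sorted xs)//; rewrite add1n ltnS.
have sx : {in s, forall z, z <= x}.
  apply/allP; apply: order_path_min xs.
  by move=> a b e /=; exact: ge_trans.
have -> : count (> c) s = 0%N.
  apply/eqP; rewrite -leqn0 leqNgt -has_count; apply/hasPn => z /sx zx /=.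
  by rewrite -leNgt (le_trans zx)// leNgt.
rewrite addn0 ltn0; apply/negbTE; rewrite -leNgt.
case: i => [|i] /=; first by rewrite leNgt.
have [si|si] := ltnP i (size s).
  by rewrite (le_trans (sx _ (mem_nth 0 si)))// leNgt.
by rewrite nth_default.
Qed.

Lemma box_order_stat_gt {R : realType} (d : nat) (x : Zd d -> R) n (c : R) i :
  0 <= c -> (c < box_order_stat x n i.+1) <->
  exists s : seq (Zd d), [/\ uniq s, size s = i.+1 &
    forall t, t \in s -> cube n t /\ c < x t].
Proof.
move=> c0; rewrite /box_order_stat lt_nth_sorted//; last first.
  by apply: sort_sorted => a b; exact: le_total.
rewrite count_sort count_map -size_filter.
set l := [seq t <- _ | _].
have lP t : t \in l <-> cube n t /\ c < x t.
  rewrite mem_filter /=; split=> [/andP[h /in_fset_cube]|[h1 h2]]; first by [].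
  by apply/andP; split=> //; apply/in_fset_cube.
have ul : uniq l by rewrite filter_uniq ?fset_uniq.
split=> [il|[s [us ss sl]]].
  exists (take i.+1 l); split; first exact: take_uniq.
    by rewrite size_takel.
  by move=> t /mem_take /lP.
by rewrite -ss; apply: uniq_leq_size => // t /sl /lP.
Qed.

Lemma mx_norm_cube (d N : nat) (t : Zd d) : mx_norm t <= N%:Z <-> cube N t.
Proof.
have -> : mx_norm t = \big[Order.max/0]_ij `|t ij.1 ij.2| by exact: mx_normrE.
rewrite cubeP; split=> [/bigmax_leP[_ h] k|h]; first exact: (h (ord0, k)).
by apply/bigmax_leP; split=> // -[i k] _ /=; rewrite ord1.
Qed.

Lemma hitting_radius_le {R : realType} (d : nat) (x : Zd d -> R) (c r : R) :
  0 <= r -> (hitting_radius x c <= r%:E)%E <->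
  exists t, cube (Num.truncn r) t /\ c < x t.
Proof.
move=> r0; split=> [h|[t [/mx_norm_cube tN ct]]]; last first.
  apply: ge_ereal_inf; exists ((mx_norm t)%:~R%:E); first by exists t.
  rewrite lee_fin (le_trans _ (_ : (Num.truncn r)%:R <= r)) ?truncn_le//.
  by rewrite pmulrn ler_int.
apply: contrapT => h'; move: h; apply/negP; rewrite -ltNge.
apply: (@lt_le_trans _ _ (Num.truncn r).+1%:R%:E).
  by rewrite lte_fin truncnS_gt.
apply: le_ereal_inf_tmp => _ [t /= ct <-].
rewrite lee_fin pmulrn ler_int leNgt; apply/negP => tr; apply: h'; exists t.
by split=> //; apply/mx_norm_cube; rewrite -ltzD1 addrC.
Qed.

Lemma cvg_truncn_ratio {R : realType} (lambda : R) : 0 < lambda ->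
  (Num.truncn (lambda * n%:R))%:R / n%:R @[n --> \oo] --> lambda.
Proof.
move=> l0; have inv0 : (n%:R^-1 : R) @[n --> \oo] --> (0 : R).
  by rewrite -(cvg_shiftS (fun n => n%:R^-1 : R)); exact: cvg_harmonic.
apply: (@squeeze_cvgr _ _ _ _ (fun n => lambda - n%:R^-1) (fun=> lambda)).
- near=> n; have n0 : 0 < n%:R :> R by rewrite ltr0n; near: n; exists 1%N.
  have ln : 0 <= lambda * n%:R by rewrite mulr_ge0 ?ltW.
  rewrite ler_pdivrMr// truncn_le ln andbT ler_pdivlMr// mulrBl mulVf ?lt0r_neq0//.
  by rewrite lerBlDr natr1 ltW// truncnS_gt.
- by rewrite -[X in _ --> X]subr0; apply: cvgB => //; exact: cvg_cst.
- exact: cvg_cst.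
Unshelve. all: by end_near. Qed.

Lemma rank_functional1 {R : realType} (d : nat) (hd : (0 < d)%N) (alpha a : R)
    (h : Zd d -> R) : (forall t, 0 <= h t) -> 0 < a ->
  (ereal_sup [set (h t)%:E | t in [set: Zd d]] `^ alpha)%E =
  ((a `^ alpha)%:E * rank_functional alpha (fun _ : 'I_1 => a) h)%E.
Proof.
move=> h0 a0; rewrite /rank_functional big_ord_recl big_ord0 min_l ?leey//.
rewrite -order_stat1 poweRM ?order_stat_ge0 ?lee_fin ?invr_ge0 ?(ltW a0)//.
rewrite poweR_EFin muleCA -EFinM -powRM ?invr_ge0 ?(ltW a0)//.
by rewrite mulfV ?lt0r_neq0// powR1 mule1.
Qed.

Theorem corollary3p2 (R : realType) (alpha : R) (halpha : 0 < alpha < 2)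
  (d : nat) (hd : (1 <= d)%N)
  (dW : measure_display) (W : measurableType dW) (hW : standard_borel R W)
  (nu : {sigma_finite_measure set W -> \bar R})
  (f : W * Zd d -> R) (hf : f \in Lfun (nu \x zeta R d)%E alpha%:E)
  (nu_alpha : {measure set (\bar R) -> \bar R})
  (hnu_alpha : is_nu_alpha alpha nu_alpha)
  (dO : measure_display) (Omega : measurableType dO) (P : probability Omega R)
  (j : nat -> Omega -> \bar R) (v : nat -> Omega -> W)
  (u : nat -> Omega -> Zd d)
  (hprm : poisson_random_measure P ((nu_alpha \x nu) \x zeta R d)%E
    (fun i w => (j i w, v i w, u i w)))
  (X : Zd d -> {RV P >-> R})
  (hX : forall t : Zd d,
    is_stable_series P j (fun i w => (v i w, u i w))
      (fun z => f (z.1, z.2 - t)) (X t))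
  (gamma : nat -> R) (hgamma : forall n, 0 < gamma n)
  (hgamma_lim : n%:R `^ (d%:R / alpha) / gamma n @[n --> \oo] --> (0 : R)) :
  (forall (m : nat) (y : 'I_m -> R), (1 <= m)%N -> (forall i, 0 < y i) ->
    ((gamma n `^ alpha / n%:R ^+ d)%:E *
      P [set w | forall i : 'I_m,
           (gamma n * y i < box_order_stat (fun t => X t w) n i.+1)%R])%E
      @[n --> \oo] -->
    ((2 ^+ d)%:E *
      \int[nu]_x
        (\big[Order.min/+oo]_(i < m)
           ((order_stat (fun t => (f^\+)%R (x, t)) i.+1 * ((y i)^-1)%:E)
              `^ alpha) +
         \big[Order.min/+oo]_(i < m)
           ((order_stat (fun t => (f^\-)%R (x, t)) i.+1 * ((y i)^-1)%:E)
              `^ alpha)))%E)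
  /\
  (forall a lambda : R, 0 < a -> 0 < lambda ->
    ((gamma n `^ alpha / n%:R ^+ d)%:E *
      P [set w | (hitting_radius (fun t => X t w) (a * gamma n)
                  <= (lambda * n%:R)%:E)])%E
      @[n --> \oo] -->
    (((2 * lambda) ^+ d * a `^ (- alpha))%:E *
      \int[nu]_x
        (ereal_sup [set ((f^\+)%R (x, t))%:E | t in [set: Zd d]] `^ alpha +
         ereal_sup [set ((f^\-)%R (x, t))%:E | t in [set: Zd d]] `^ alpha))%E).
Proof.
have a0 : 0 < alpha by case/andP: halpha.
split=> [m y m0 y0|a lambda la ll].
- have n1 : n%:R / n%:R @[n --> \oo] --> (1 : R).
    apply: (@cvg_trans _ (cst (1 : R) @ \oo)); last exact: cvg_cst.
    apply: near_eq_cvg; near=> n; rewrite divff// pnatr_eq0 -lt0n.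
    by near: n; exists 1%N.
  have := field_event_asymptotics halpha hd hf hnu_alpha hprm hX hgamma
    hgamma_lim m0 y0 ltr01 n1.
  rewrite [2 * 1]mulr1; apply: cvg_trans; apply: near_eq_cvg; near=> n.
  congr (_ * P _)%E; apply/seteqP; split=> w /= h k.
    by apply/box_order_stat_gt; [rewrite mulr_ge0// ltW|exact: h].
  by apply/box_order_stat_gt; [rewrite mulr_ge0// ltW|exact: h].
(* Hitting times are the case of the single level [a], in windows whose radius is the integer part
   of [lambda * n]. *)
- have := field_event_asymptotics halpha hd hf hnu_alpha hprm hX hgamma
    hgamma_lim (ltn0Sn 0) (fun=> la) ll (cvg_truncn_ratio ll).
  (* The integrability serves to make the density measurable, so that the constant [a ^ alpha] can
     be moved through the integral. *)
  have [int _] := intensity_ranked_jumps_cvg a0 hd hf (ltn0Sn 0)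
    (fun=> la) ll (cvg_truncn_ratio ll).
  have -> : (\int[nu]_x
      (ereal_sup [set ((f^\+)%R (x, t))%:E | t in [set: Zd d]] `^ alpha +
       ereal_sup [set ((f^\-)%R (x, t))%:E | t in [set: Zd d]] `^ alpha))%E =
      ((a `^ alpha)%:E * \int[nu]_x rank_density alpha f (fun _ : 'I_1 => a) x)%E.
    rewrite -ge0_integralZl//; last 3 first.
    - exact: measurable_int int.
    - by move=> x _; rewrite /rank_density adde_ge0 ?rank_functional_ge0.
    - by rewrite lee_fin powR_ge0.
    apply: eq_integral => x _.
    rewrite !(@rank_functional1 _ _ hd alpha a)// /rank_density.
      by rewrite ge0_muleDr ?rank_functional_ge0.
  rewrite muleA -EFinM -mulrA -powRD ?lt0r_neq0 ?implybT// addNr powRr0 mulr1.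
  apply: cvg_trans; apply: near_eq_cvg; near=> n; congr (_ * P _)%E.
  have r0 : 0 <= lambda * n%:R by rewrite mulr_ge0// ltW.
  rewrite [a * gamma n]mulrC; apply/seteqP; split=> w /=.
    move=> /(_ ord0)[s [us ss sl]]; apply/hitting_radius_le => //.
    case: s us ss sl => // t s _ _ sl; exists t; apply: sl.
    by rewrite inE eqxx.
  move=> /hitting_radius_le -/(_ r0)[t tX] k; exists [:: t].
  by rewrite (ord1 k); split=> // z; rewrite inE => /eqP ->.
Unshelve. all: by end_near. Qed.
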